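(* The set of orbits $\widetilde{\mathcal M}_1(\mathbb R^d)$ is dense in $(\widetilde{\mathcal X},\mathbf D)$. Furthermore, given any sequence $(\widetilde\mu_n)_n$ in $\widetilde{\mathcal M}_1(\mathbb R^d)$, there is a subsequence that converges to a limit in $(\widetilde{\mathcal X},\mathbf D)$. Hence $\widetilde{\mathcal X}$ is a compactification of $\widetilde{\mathcal M}_1(\mathbb R^d)$ (that is, $(\widetilde{\mathcal X},\mathbf D)$ is a compact metric space containing $\widetilde{\mathcal M}_1(\mathbb R^d)$ as a dense subset). It is then also the completion under the metric $\mathbf D$ of the totally bounded space $\widetilde{\mathcal M}_1(\mathbb R^d)$.
   Context: Let $\mathcal M_1(\mathbb R^d)$ be the set of probability measures on $\mathbb R^d$ and $\mathcal M_{\le 1}(\mathbb R^d)$ the set of sub-probability measures (nonnegative measures of total mass at most $1$). The orbit of $\alpha\in\mathcal M_{\le 1}(\mathbb R^d)$ is $\widetilde\alpha=\{\alpha\star\delta_x:x\in\mathbb R^d\}$, and $\widetilde{\mathcal M}_1(\mathbb R^d)=\{\widetilde\mu:\mu\in\mathcal M_1(\mathbb R^d)\}$. $\widetilde{\mathcal X}$ is the set of all empty, finite or countable collections $\xi=\{\widetilde\alpha_i\}_{i\in I}$ of orbits of nonzero measures $\alpha_i\in\mathcal M_{\le 1}(\mathbb R^d)$ with $\sum_{i\in I}\alpha_i(\mathbb R^d)\le 1$; collections are multisets (orbits counted with multiplicity). $\widetilde{\mathcal M}_1(\mathbb R^d)$ is embedded in $\widetilde{\mathcal X}$ by $\widetilde\mu\mapsto\{\widetilde\mu\}$.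 For $k\ge 2$, $\mathcal F_k$ is the space of continuous functions $f:(\mathbb R^d)^k\to\mathbb R$ that are translation invariant, $f(x_1+y,\dots,x_k+y)=f(x_1,\dots,x_k)$, and satisfy $\lim_{\max_{i\ne j}|x_i-x_j|\to\infty}f(x_1,\dots,x_k)=0$. $\mathcal F=\bigcup_{k\ge2}\mathcal F_k$, and $\{f_r(x_1,\dots,x_{k_r})\}_{r\in\mathbb N}$, $f_r\in\mathcal F_{k_r}$, is a fixed enumeration of the union over $k$ of countable uniformly dense subsets of $\mathcal F_k$. The metric $\mathbf D$ on $\widetilde{\mathcal X}$ is $$\mathbf D(\xi_1,\xi_2)=\sum_{r=1}^\infty\frac{1}{2^r}\frac{1}{1+\|f_r\|_\infty}\bigg|\sum_{\widetilde\alpha\in\xi_1}\int f_r\prod_{i=1}^{k_r}\alpha(\mathrm dx_i)-\sum_{\widetilde\alpha\in\xi_2}\int f_r\prod_{i=1}^{k_r}\alpha(\mathrm dx_i)\bigg|,$$ where sums are taken with multiplicity and sums over the empty collection are $0$. *)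

(* Defs.v *)
From HB Require Import structures.
From mathcomp Require Import all_boot all_order all_algebra.
From mathcomp Require Import all_classical all_reals all_analysis.

Set Implicit Arguments.
Unset Strict Implicit.
Unset Printing Implicit Defensive.

Import Order.TTheory GRing.Theory Num.Theory.
Import numFieldNormedType.Exports.

Local Open Scope classical_set_scope.
Local Open Scope ring_scope.

Section metric_space.
Context {R : realType}.

Definition is_metric (T : Type) (D : T -> T -> R) : Prop :=
  [/\ forall x, D x x = 0,
      forall x y, D x y = 0 -> x = y,
      forall x y, D x y = D y x &
      forall y x z, D x z <= D x y + D y z].

Definition metric_space (T : Type) (D : T -> T -> R) (h : is_metric D) : Type :=
  T.

Section instances.
Context (T : Type) (D : T -> T -> R) (h : is_metric D).
HB.instance Definition _ := gen_eqMixin (metric_space h).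
HB.instance Definition _ := gen_choiceMixin (metric_space h).
HB.instance Definition _ := @isMetric.Build R (metric_space h) D
  (let: And4 p _ _ _ := h in p) (let: And4 _ p _ _ := h in p)
  (let: And4 _ _ p _ := h in p) (let: And4 _ _ _ p := h in p).
End instances.

Definition totally_bounded (M : metricType R) : Prop :=
  forall e : R, 0 < e ->
    exists2 A : set M, finite_set A & \bigcup_(x in A) ball x e = setT.

Definition complete_space (M : metricType R) : Prop :=
  forall F : set_system M, ProperFilter F -> cauchy F -> exists l : M, F --> l.

Definition is_completion (M N : metricType R) (e : M -> N) : Prop :=
  [/\ forall x y, mdist (e x) (e y) = mdist x y,
      dense (range e) & complete_space N].

End metric_space.

Section borel_measures.
Context (R : realType) (d : nat).

Definition Rvec : measurableType _ := g_sigma_algebraType (@open 'rV[R]_d).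

Definition convolution (alpha beta : set Rvec -> \bar R) : set Rvec -> \bar R :=
  pushforward (alpha \x beta)%E
    (fun z : Rvec * Rvec => (z.1 : 'rV[R]_d) + z.2 : Rvec).

(* Library measures are functions on all sets, unconstrained on the
   non-measurable ones, so measures are compared on Borel sets only: an orbit
   contains every beta that agrees there with some alpha * delta_x. *)
Definition orbit_of (alpha : subprobability Rvec R) :
    set (subprobability Rvec R) :=
  [set beta | exists x : Rvec, forall A : set Rvec, measurable A ->
    beta A = convolution alpha (\d_x) A].

Definition nz_orbit : Type :=
  {O : set (subprobability Rvec R) |
    exists2 alpha : subprobability Rvec R,
      alpha setT != 0%E & O = orbit_of alpha}.

HB.instance Definition _ := gen_eqMixin nz_orbit.
HB.instance Definition _ := gen_choiceMixin nz_orbit.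

(* Total masses and integrals of translation invariant functions do not depend
   on the representative chosen. *)
Definition repr (o : nz_orbit) : subprobability Rvec R :=
  s2val (cid2 (svalP o)).

Definition M1_orbit : Type :=
  {O : set (subprobability Rvec R) |
    exists mu : probability Rvec R, O = orbit_of mu}.

(* A multiset of orbits is its multiplicity function.  Orbits of nonzero
   measures have positive mass, so the bound on the total mass leaves room for
   finite multiplicities only. *)
Record Xtilde := MkXtilde {
  mult :> nz_orbit -> nat ;
  _ : countable [set o | mult o != 0%N] ;
  _ : (\esum_(o in [set: nz_orbit]) ((mult o)%:R%:E * repr o setT) <= 1)%E }.

Lemma M1_orbit_nz (m : M1_orbit) :
  exists2 alpha : subprobability Rvec R,
    alpha setT != 0%E & sval m = orbit_of alpha.
Proof.
case: m => O [mu OE] /=; exists mu => //.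
by rewrite [X in X != _](_ : _ = 1%E) ?oner_eq0//; exact: probability_setT.
Qed.

Definition nz_of_M1 (m : M1_orbit) : nz_orbit :=
  exist _ (sval m) (M1_orbit_nz m).

Definition single (o o' : nz_orbit) : nat := (o' == o).

Lemma single_countable o : countable [set o' | single o o' != 0%N].
Proof.
suff -> : [set o' | single o o' != 0%N] = [set o] by exact: countable1.
apply/seteqP; split=> o1 /=; rewrite /single; last by move=> ->; rewrite eqxx.
by case: (eqVneq o1 o).
Qed.

Lemma single_mass o :
  (\esum_(o' in [set: nz_orbit]) ((single o o')%:R%:E * repr o' setT) <= 1)%E.
Proof.
have ge0 o' : (0 <= (single o o')%:R%:E * repr o' setT)%E.
  by rewrite mule_ge0// lee_fin.
rewrite (esumID [set o])// setTI esum_set1// {1}/single eqxx mul1e.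
rewrite esum1 ?adde0 ?sprobability_setT// => i [_ /= io].
by rewrite /single; case: eqP io => //= _ _; rewrite mul0e.
Qed.

Definition embed (m : M1_orbit) : Xtilde :=
  MkXtilde (single_countable (nz_of_M1 m)) (single_mass (nz_of_M1 m)).

End borel_measures.

Section distance.
Context (R : realType) (d : nat).

(* Points of (R^d)^k are k x d matrices, the i-th point being the i-th row.
   The library norm on 'rV_d is the sup norm; the limit condition below does
   not depend on the choice of norm. *)
Definition spread (k : nat) (x : 'M[R]_(k, d)) : R :=
  \big[Num.max/0]_(i < k) \big[Num.max/0]_(j < k | j != i)
    `|row i x - row j x|.

Definition test_function (k : nat) (f : 'M[R]_(k, d) -> R) : Prop :=
  [/\ continuous f,
      forall (x : 'M[R]_(k, d)) (y : 'rV[R]_d),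
        f (\matrix_(i < k) (row i x + y)) = f x &
      forall e : R, 0 < e ->
        exists C : R, forall x, C <= spread x -> `|f x| < e].

Definition uniformly_dense (k : nat) (A : set ('M[R]_(k, d) -> R)) : Prop :=
  A `<=` @test_function k /\
  forall f, test_function f -> forall e : R, 0 < e ->
    exists2 g, A g & forall x, `|g x - f x| < e.

Definition tagged_function : Type := {k : nat & 'M[R]_(k, d) -> R}.

Definition dense_enumeration (f : nat -> tagged_function) : Prop :=
  exists A : forall k, set ('M[R]_(k, d) -> R),
    (forall k, (2 <= k)%N -> countable (A k) /\ uniformly_dense (A k)) /\
    range f = \bigcup_(k in [set k | (2 <= k)%N])
                [set existT (fun k => 'M[R]_(k, d) -> R) k g | g in A k].

Fixpoint power_measure (alpha : set (Rvec R d) -> \bar R) (k : nat) :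
    set (k.-tuple (Rvec R d)) -> \bar R :=
  match k with
  | 0 => \d_[tuple]
  | k'.+1 => pushforward (alpha \x power_measure alpha (k := k'))%E
      (fun z : Rvec R d * k'.-tuple (Rvec R d) => [tuple of z.1 :: z.2])
  end.

Definition power_integral (k : nat) (f : 'M[R]_(k, d) -> R)
    (alpha : set (Rvec R d) -> \bar R) : \bar R :=
  (\int[power_measure alpha (k := k)]_x
    (f (\matrix_(i < k) (tnth x i : 'rV[R]_d)))%:E)%E.

(* The unordered sum over the multiset xi, which converges absolutely for
   bounded f, as the difference of the sums of positive and negative parts. *)
Definition multiset_integral (k : nat) (f : 'M[R]_(k, d) -> R)
    (xi : Xtilde R d) : R :=
  let g (o : nz_orbit R d) := ((xi o)%:R%:E * power_integral f (repr o))%E in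
  fine (\esum_(o in [set: nz_orbit R d]) g^\+ o
        - \esum_(o in [set: nz_orbit R d]) g^\- o)%E.

Definition sup_norm (k : nat) (f : 'M[R]_(k, d) -> R) : R :=
  sup (range (fun x => `|f x|)).

(* f 0 stands for the first function of the enumeration, of weight 1/2. *)
Definition Dmetric (f : nat -> tagged_function) (xi1 xi2 : Xtilde R d) : R :=
  limn (series (fun r => (2 ^+ r.+1)^-1 * (1 + sup_norm (tagged (f r)))^-1 *
    `|multiset_integral (tagged (f r)) xi1
      - multiset_integral (tagged (f r)) xi2|)).

Definition D_M1 (f : nat -> tagged_function) (mu nu : M1_orbit R d) : R :=
  Dmetric f (embed mu) (embed nu).

End distance.

(* Main.v *)
(** Along an ultrafilter on the indices, translates of probability measures
mu_n by given positions have vague limits. Positions drifting apart carry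
disjoint mass, so modulo bounded distance only countably many of them have a
nonzero limit alpha_i, and these have total mass at most 1. A test function
sees only points at bounded distance of each other, and two independent points
are unlikely to be close in a region where all balls have small mass; hence
the integrals of mu_n^k converge to the sum over i of those of alpha_i^k. This
gives compactness. For density, the pieces of a multiset are moved far apart
and the missing mass is scattered into ever smaller atoms.

The distance separates points: products of integrals of test functions are
limits of such integrals, so high powers of 1 - (u - u(o))^2 isolate the orbit
o inside a multiset, and the same powers applied to local averages of a single
measure recover it up to translation. *)

Require Import Defs.
From HB Require Import structures.
From mathcomp Require Import all_boot all_order all_algebra.
From mathcomp Require Import all_classical all_reals all_analysis.
From mathcomp Require Import measurable_realfun ring lra.
Import Order.TTheory GRing.Theory Num.Theory.
Import numFieldNormedType.Exports.

Set Implicit Arguments.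
Unset Strict Implicit.
Unset Printing Implicit Defensive.

Local Open Scope classical_set_scope.
Local Open Scope ring_scope.

(** Ultrafilters take the place of subsequences: every bounded quantity has a limit, for all moving
    frames and all Borel sets at once, without a diagonal argument. The price is that a setwise
    limit of measures is only finitely additive and has to be regularized into a measure. The
    passage from vague limits to integrals is proved once, in [core_cvg], for positions that
    separate and leave no concentrated remainder. Compactness feeds it the frames found along an
    ultrafilter, density feeds it explicit positions. Limits of multisets are never built from
    multisets: density replaces them by single orbits, so that only sequences of probability
    measures have to be decomposed. Subsequences, completeness and total boundedness are then
    general facts about a compact metric space. In the separation argument the constant 1 is the
    obstacle: powers of [1 - (u - c)^2] contain it, but it is neither the integral of a test
    function nor summable over a general multiset. Both halves therefore work with a class of
    multipliers, [balanced] and [coefficient], each tested against functions that do make the sums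
    or integrals available. *)

Section bounded_measurable.
Context {R : realType} {dd : measure_display} {S : measurableType dd}.

(** This class is stable under algebra and bounded pointwise limits, and its members are integrable
    for every subprobability; it is the only side condition that the rules for [E] carry. *)
Definition bm (g : S -> R) : Prop :=
  measurable_fun setT g /\ exists M : R, forall x, `|g x| <= M.

Lemma bmD g h : bm g -> bm h -> bm (fun x => g x + h x).
Proof.
move=> [mg [M gM]] [mh [N hN]]; split; first exact: measurable_funD.
by exists (M + N) => x; rewrite (le_trans (ler_normD _ _))// lerD.
Qed.

Lemma bmM g h : bm g -> bm h -> bm (fun x => g x * h x).
Proof.
move=> [mg [M gM]] [mh [N hN]]; split; first exact: measurable_funM.
by exists (M * N) => x; rewrite normrM ler_pM.
Qed.

Lemma bm_cst c : bm (fun=> c).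
Proof. by split; [exact: measurable_cst|exists `|c|]. Qed.

Lemma bmZ c g : bm g -> bm (fun x => c * g x).
Proof. exact/bmM/bm_cst. Qed.

Lemma bmN g : bm g -> bm (fun x => - g x).
Proof. by move=> [mg [M gM]]; split; [exact: measurableT_comp|exists M => x; rewrite normrN]. Qed.

Lemma bmB g h : bm g -> bm h -> bm (fun x => g x - h x).
Proof. by move=> bg bh; apply: bmD => //; exact: bmN. Qed.

Lemma bm_norm g : bm g -> bm (fun x => `|g x|).
Proof.
move=> [mg [M gM]]; split; last by exists M => x; rewrite normr_id.
exact: measurableT_comp.
Qed.

Lemma bm_sum (I : Type) (r : seq I) (p : pred I) (F : I -> S -> R) :
  (forall i, p i -> bm (F i)) -> bm (fun x => \sum_(i <- r | p i) F i x).
Proof.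
by move=> bF; rewrite -fct_sumE; apply: (big_ind bm) => //; [exact: bm_cst|exact: bmD].
Qed.

Lemma bm_prod (I : Type) (r : seq I) (p : pred I) (F : I -> S -> R) :
  (forall i, p i -> bm (F i)) -> bm (fun x => \prod_(i <- r | p i) F i x).
Proof.
by move=> bF; rewrite -fct_prodE; apply: (big_ind bm) => //; [exact: bm_cst|exact: bmM].
Qed.

Lemma bm_indic (A : set S) : measurable A -> bm (\1_A : S -> R).
Proof.
move=> mA; split; first exact: measurable_indic.
by exists 1 => x; rewrite indicE; case: (_ \in _); rewrite ?normr1 ?normr0.
Qed.

Lemma bm_cvg (g_ : nat -> S -> R) (g : S -> R) (M : R) :
  (forall n, bm (g_ n)) -> (forall n x, `|g_ n x| <= M) ->
  (forall x, g_ n x @[n --> \oo] --> g x) -> bm g.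
Proof.
move=> bg gM gcvg; split.
  apply: (@measurable_fun_cvg _ _ _ _ g_) => [n|x _]; [exact: (bg n).1|exact: gcvg].
exists M => x; rewrite -(cvg_lim _ (cvg_norm (gcvg x)))//.
apply: limr_le; first by apply: is_cvg_norm; apply/cvg_ex; exists (g x); exact: gcvg.
by apply: nearW => n.
Qed.

Context (m : subprobability S R).

Definition E (g : S -> R) : R := \int[m]_x g x.

Lemma bm_integrable g : bm g -> m.-integrable setT (EFin \o g).
Proof.
move=> [mg [M gM]].
apply: (le_integrable measurableT _ _ (finite_measure_integrable_cst m M measurableT)).
- exact/measurable_EFinP.
- by move=> x _ /=; rewrite lee_fin (le_trans (gM x)) ?ler_norm.
Qed.

Lemma EE g : bm g -> (\int[m]_x (g x)%:E)%E = (E g)%:E.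
Proof. by move=> bg; rewrite /E /Rintegral fineK//; apply: integrable_fin_num => //; exact: bm_integrable. Qed.

Lemma E_cst c : E (fun=> c) = c * fine (m setT).
Proof. exact: (Rintegral_cst m measurableT). Qed.

Lemma ED g h : bm g -> bm h -> E (fun x => g x + h x) = E g + E h.
Proof. by move=> bg bh; apply: RintegralD => //; exact: bm_integrable. Qed.

Lemma EB g h : bm g -> bm h -> E (fun x => g x - h x) = E g - E h.
Proof. by move=> bg bh; apply: RintegralB => //; exact: bm_integrable. Qed.

Lemma EZ c g : bm g -> E (fun x => c * g x) = c * E g.
Proof. by move=> bg; apply: RintegralZl => //; exact: bm_integrable. Qed.

Lemma le_E g h : bm g -> bm h -> (forall x, g x <= h x) -> E g <= E h.
Proof. by move=> bg bh gh; apply: le_Rintegral => //; exact: bm_integrable. Qed.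

Lemma E_ge0 g : (forall x, 0 <= g x) -> 0 <= E g.
Proof. by move=> g0; apply: Rintegral_ge0. Qed.

Lemma norm_E g : bm g -> `|E g| <= E (fun x => `|g x|).
Proof. by move=> bg; apply: le_normr_Rintegral => //; exact: bm_integrable. Qed.

Lemma norm_E_le g M : bm g -> (forall x, `|g x| <= M) -> `|E g| <= M * fine (m setT).
Proof.
move=> bg gM; rewrite -E_cst (le_trans (norm_E bg))//.
by apply: le_E => //; [exact: bm_norm|exact: bm_cst].
Qed.

Lemma E_sum (I : Type) (r : seq I) (p : pred I) (F : I -> S -> R) :
  (forall i, p i -> bm (F i)) -> E (fun x => \sum_(i <- r | p i) F i x) = \sum_(i <- r | p i) E (F i).
Proof.
move=> bF; elim: r => [|i r IH].
  by under [X in E X]eq_fun do rewrite big_nil; rewrite E_cst mul0r big_nil.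
case: (boolP (p i)) => pi;
  under [X in E X]eq_fun do rewrite big_cons ?pi ?(negbTE pi)//;
  rewrite big_cons ?pi ?(negbTE pi)//.
by rewrite -IH -ED//; [exact: bF|exact: bm_sum].
Qed.

Lemma E_indic (A : set S) : measurable A -> E (\1_A) = fine (m A).
Proof. by move=> mA; rewrite /E /Rintegral integral_indic// setIT. Qed.

Lemma mass_le1 : fine (m setT) <= 1.
Proof.
rewrite -[leRHS]/(fine 1%E) fine_le ?fin_num_measure//.
exact: sprobability_setT.
Qed.

Lemma mass_ge0 : 0 <= fine (m setT). Proof. exact: fine_ge0. Qed.

Lemma norm_E_le1 g M : bm g -> (forall x, `|g x| <= M) -> `|E g| <= M.
Proof.
move=> bg gM; rewrite (le_trans (norm_E_le bg gM))// ler_piMr ?mass_le1//.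
by rewrite (le_trans _ (gM point)).
Qed.

Lemma E_dct (g_ : nat -> S -> R) (g : S -> R) (M : R) :
  (forall n, bm (g_ n)) -> (forall n x, `|g_ n x| <= M) ->
  (forall x, g_ n x @[n --> \oo] --> g x) -> E (g_ n) @[n --> \oo] --> E g.
Proof.
move=> bg gM gcvg; have bgl := bm_cvg bg gM gcvg.
suff h : (\int[m]_x (g_ n x)%:E)%E @[n --> \oo] --> (E g)%:E by exact: (fine_cvg h).
rewrite -EE//.
apply: (@dominated_cvg _ _ _ _ _ _ _ _ (EFin \o cst M)) => //.
- by move=> n; apply/measurable_EFinP; exact: (bg n).1.
- by move=> x _; apply: cvg_EFin; [exact: nearW|exact: gcvg].
- exact: finite_measure_integrable_cst.
- by move=> n x _ /=; rewrite lee_fin.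
Qed.

End bounded_measurable.

(** * Ultralimits and compact sets of matrices *)

Section ultralimits.
Context {R : realType} {I : Type} {U : set_system I} {UU : UltraFilter U}.

(** A cluster point of an ultrafilter is its limit: if the preimage of a neighbourhood were not in
    [U], its complement would be, against clustering. *)
Lemma ultra_bounded_cvg (u : I -> R) (C : R) :
  U [set i | `|u i| <= C] -> exists l : R, `|l| <= C /\ u @ U --> l.
Proof.
move=> uC; have := @segment_compact R (- C) C.
move=> /(_ (u @ U) _)[].
  apply: filterS uC => i /= ui. rewrite in_itv/=. rewrite -ler_norml. exact: ui.
move=> l [/=]; rewrite in_itv/= -ler_norml => lC cl; exists l; split => // A lA.
have [//|uA] := in_ultra_setVsetC (u @^-1` A) UU.
by have [x []] := cl (~` A) A uA lA.
Qed.

End ultralimits.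

Section matrix_facts.
Context {R : realType} (m n : nat).

Lemma mx_norm_leP (x : 'M[R]_(m, n)) (c : R) : 0 <= c ->
  (forall i j, `|x i j| <= c) <-> `|x| <= c.
Proof.
move=> c0; rewrite [X in X <= _]mx_normrE; split => [h|/bigmax_leP[_ h] i j].
  by apply/bigmax_leP; split => // -[i j] _; exact: h.
exact: (h (i, j)).
Qed.

Lemma mx_entry_le (x : 'M[R]_(m, n)) i j : `|x i j| <= `|x|.
Proof. exact: (iffRL (mx_norm_leP _ (normr_ge0 _))). Qed.

(** Along an ultrafilter the entries converge one by one, and a neighbourhood of a matrix constrains
    finitely many entries. *)
Lemma mx_box_compact (C : R) : compact [set x : 'M[R]_(m, n) | forall i j, `|x i j| <= C].
Proof.
rewrite compact_ultra => F FU FC.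
have cF i j : exists l : R, `|l| <= C /\ (fun x : 'M[R]_(m, n) => x i j) @ F --> l.
  apply: (@ultra_bounded_cvg _ _ F).
  by apply: filterS FC => x /= /(_ i j).
pose l i j := sval (cid (cF i j)); have lP i j : `|l i j| <= C /\ (fun x : 'M[R]_(m, n) => x i j) @ F --> l i j := svalP (cid (cF i j)).
exists (\matrix_(i, j) l i j); split; first by move=> i j; rewrite mxE; exact: (lP i j).1.
move=> A [P PM PA]; apply: filterS PA _.
have : \forall x \near F, forall i, forall j, P i j ((x : 'M[R]_(m, n)) i j).
  apply: filter_forall => i; apply: filter_forall => j.
  by apply: (lP i j).2; have := PM i j; rewrite mxE.
by [].
Qed.

Lemma mx_closed_ball_compact (C : R) : compact [set x : 'M[R]_(m, n) | `|x| <= C].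
Proof.
have [C0|C0] := leP 0 C.
  rewrite (_ : [set _ | _] = [set x : 'M[R]_(m, n) | forall i j, `|x i j| <= C]); first exact: mx_box_compact.
  by apply/seteqP; split => x /= /(mx_norm_leP _ C0).
rewrite (_ : [set _ | _] = set0); first exact: compact0.
by apply/seteqP; split => // x /= /le_lt_trans/(_ C0); rewrite normr_lt0.
Qed.

Lemma continuous_mx_entrywise (T : topologicalType) (f : T -> 'M[R]_(m, n)) :
  (forall i j, continuous (fun t => f t i j)) -> continuous f.
Proof.
move=> cf t A [P PM PA].
have : \forall x \near t, forall i, forall j, P i j (f x i j).
  by apply: filter_forall => i; apply: filter_forall => j; apply: cf; exact: PM.
by apply: filterS => x; exact: PA.
Qed.

End matrix_facts.

(** * Image and product measures *)

Section image_measure.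
Context {R : realType} {d1 d2 : measure_display} {S1 : measurableType d1} {S2 : measurableType d2}.
Variables (m : subprobability S1 R) (f : S1 -> S2) (mf : measurable_fun setT f).

(** The proof of measurability is an argument so that the measure structures below can be attached
    to this name. *)
Definition image_measure (_ : measurable_fun setT f) : set S2 -> \bar R := pushforward m f.

HB.instance Definition _ := isMeasure.Build _ _ _ (image_measure mf)
  (measure0 (measure_function_pushforward__canonical__measure_function_Measure m mf))
  (measure_ge0 (measure_function_pushforward__canonical__measure_function_Measure m mf))
  (@measure_semi_sigma_additive _ _ _ (measure_function_pushforward__canonical__measure_function_Measure m mf)).

Let image_measure_setT : (image_measure mf setT <= 1)%E.
Proof. by rewrite /image_measure /pushforward preimage_setT; exact: sprobability_setT. Qed.

HB.instance Definition _ := Measure_isSubProbability.Build _ _ _ (image_measure mf) image_measure_setT.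

Definition image_sub : subprobability S2 R := image_measure mf.

Lemma E_image g : bm g -> E image_sub g = E m (g \o f).
Proof.
move=> [mg [M gM]]; rewrite /E /Rintegral integral_pushforward//.
- exact/measurable_EFinP.
- apply: bm_integrable; split; first exact: measurableT_comp.
  by exists M => x; exact: gM.
Qed.

End image_measure.

Section product_measure.
Context {R : realType} {d1 d2 : measure_display} {S1 : measurableType d1} {S2 : measurableType d2}.
Variables (m1 : subprobability S1 R) (m2 : subprobability S2 R).

Lemma bm_section (F : S1 * S2 -> R) x : bm F -> bm (fun y => F (x, y)).
Proof.
move=> [mF [M FM]]; split; last by exists M => y; exact: FM.
exact: measurableT_comp.
Qed.

Lemma bm_Esection (F : S1 * S2 -> R) : bm F -> bm (fun x => E m2 (fun y => F (x, y))).
Proof.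
move=> bF; split; last first.
  have [_ [M FM]] := bF; exists M => x; apply: norm_E_le1; first exact: bm_section.
  by move=> y; exact: FM.
have ibF : (m1 \x m2)%E.-integrable setT (EFin \o F).
  exact: (bm_integrable (product_subprobability (m1, m2)) bF).
have := measurable_fubini_F ibF.
rewrite /fubini_F (_ : (fun x => _) = EFin \o (fun x => E m2 (fun y => F (x, y)))).
  by move/measurable_EFinP.
by apply/funext => x /=; rewrite EE//; exact: bm_section.
Qed.

Lemma E_prod (F : S1 * S2 -> R) : bm F ->
  E (product_subprobability (m1, m2)) F = E m1 (fun x => E m2 (fun y => F (x, y))).
Proof.
move=> bF.
have ibF : (m1 \x m2)%E.-integrable setT (EFin \o F).
  exact: (bm_integrable (product_subprobability (m1, m2)) bF).
rewrite {1}/E /Rintegral -(integral12_prod_meas1 ibF) /fubini_F.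
rewrite [RHS]/E /Rintegral; congr fine; apply: eq_integral => x _ /=.
by rewrite EE//; exact: bm_section.
Qed.

End product_measure.

(** * Continuity of real functions and limits along filters *)

Section continuous_real_functions.
Context {R : realType} {X : topologicalType}.
Implicit Types f g : X -> R.

Lemma contD f g : continuous f -> continuous g -> continuous (fun x => f x + g x).
Proof. by move=> cf cg x; apply: cvgD; [exact: cf|exact: cg]. Qed.

Lemma contM f g : continuous f -> continuous g -> continuous (fun x => f x * g x).
Proof. by move=> cf cg x; apply: cvgM; [exact: cf|exact: cg]. Qed.

Lemma cont_cst (c : R) : continuous ((fun=> c) : X -> R).
Proof. by move=> x; exact: cvg_cst. Qed.

Lemma contZ (c : R) f : continuous f -> continuous (fun x => c * f x).
Proof. exact/contM/cont_cst. Qed.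

Lemma cont_norm f : continuous f -> continuous (fun x => `|f x|).
Proof. by move=> cf x; apply: cvg_norm; exact: cf. Qed.

Lemma cont_comp (Y : topologicalType) (h : X -> Y) (g : Y -> R) :
  continuous h -> continuous g -> continuous (fun x => g (h x)).
Proof. by move=> ch cg x; apply: continuous_comp; [exact: ch|exact: cg]. Qed.

Lemma open_gt_preimage f c : continuous f -> open [set x | c < f x].
Proof. by move=> cf; apply: (open_comp (D := [set y | c < y])) (@open_gt R c) => x _; exact: cf. Qed.

Lemma open_lt_preimage f c : continuous f -> open [set x | f x < c].
Proof. by move=> cf; apply: (open_comp (D := [set y | y < c])) (@open_lt R c) => x _; exact: cf. Qed.

Lemma closed_ge_preimage f c : continuous f -> closed [set x | c <= f x].
Proof. by move=> cf; apply: (preimage_closed (D := [set y | c <= y])) (@closed_ge R c) => x _; exact: cf. Qed.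

Lemma closed_le_preimage f c : continuous f -> closed [set x | f x <= c].
Proof. by move=> cf; apply: (preimage_closed (D := [set y | y <= c])) (@closed_le R c) => x _; exact: cf. Qed.

End continuous_real_functions.

Lemma filter_forall_if (T : Type) (F : set_system T) (FF : Filter F) (I : finType) (p : pred I)
    (Q : I -> T -> Prop) :
  (forall i, p i -> \forall x \near F, Q i x) -> \forall x \near F, forall i, p i -> Q i x.
Proof.
move=> h; apply: filter_forall => i; case: (boolP (p i)) => [/h|_]; last exact: nearW.
by apply: filterS.
Qed.

Lemma near_infty_invS_lt {R : realType} (e : R) : 0 < e -> \forall n \near \oo, n.+1%:R^-1 < e.
Proof. by move=> e0; exact: (near_infty_natSinv_lt (PosNum e0)). Qed.

Lemma lipschitz_cont {R : realType} (m n : nat) (f : 'M[R]_(m, n) -> R) (L : R) :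
  (forall x y, `|f x - f y| <= L * `|x - y|) -> continuous f.
Proof.
move=> lf x; apply/(@cvgrPdist_le _ _ _ (nbhs x)) => /= e e0.
have L0 : 0 < `|L| + 1 by rewrite ltr_wpDl.
have : nbhs x (ball (x : 'M[R]_(m, n)) (e / (`|L| + 1))) by apply: nbhsx_ballx; exact: divr_gt0.
apply: filterS => y; rewrite mx_norm_ball => /ltW h; rewrite (le_trans (lf _ _))//.
move: h; rewrite ler_pdivlMr// => h; rewrite (le_trans _ h)// mulrC ler_wpM2l//.
by rewrite (le_trans (ler_norm _))// lerDl.
Qed.

Lemma continuous_compact_bounded {R : realType} (X : topologicalType) (f : X -> R) (K : set X) :
  compact K -> continuous f -> exists M : R, forall x, K x -> `|f x| <= M.
Proof.
move=> cK cf.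
have cfK : compact (f @` K) by apply: continuous_compact => //; exact: continuous_subspaceT.
have [M [_ hM]] := compact_bounded cfK.
exists (M + 1) => x Kx; apply: (hM (M + 1)); first by rewrite ltrDl.
by exists x.
Qed.

Lemma continuous_near_ge {R : realType} {X : topologicalType} (f : X -> R) (x : X) (c : R) :
  continuous f -> c < f x -> \forall y \near x, c <= f y.
Proof. by move=> cf; exact: (@cvgr_ge _ _ (nbhs x) _ f (f x) (cf x) c). Qed.

Lemma cvg_le_bound {R : realType} (u : nat -> R) (L c : R) : u @ \oo --> L -> (\forall n \near \oo, u n <= c) -> L <= c.
Proof. by move=> cu uc; apply: (@closed_cvg _ _ \oo _ u [set x | x <= c]) cu; [exact: closed_le|exact: uc]. Qed.

Lemma ultra_not {U : set_system nat} {UU : UltraFilter U} (A : set nat) : ~ U A -> U (~` A).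
Proof. by have [] := in_ultra_setVsetC A UU. Qed.

(** * Consequences of compactness in a metric space *)

Section compact_metric.
Context {R : realType}.
Variables (X : metricType R).
Hypothesis cX : compact [set: X].

Lemma metric_cluster (F : set_system X) : ProperFilter F ->
  exists l : X, forall A e, F A -> 0 < e -> exists y, A y /\ mdist l y < e.
Proof.
move=> PF; have [l [_ cl]] := cX PF filterT; exists l => A e FA e0.
have [|y []] := cl A [set y | mdist l y < e] FA; last by exists y.
by rewrite -metricType_numDomainType.filter_from_mdist_nbhs; exists e.
Qed.

Lemma compact_subsequence (x : nat -> X) : exists phi : nat -> nat,
  {homo phi : m n / (m < n)%N} /\ exists l : X, x (phi n) @[n --> \oo] --> l.
Proof.
have [l hl] := @metric_cluster (x @ \oo) _.
have pick n N : exists m, (N < m)%N /\ mdist l (x m) < n.+1%:R^-1.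
  have h : (x @ \oo) [set x m | m in [set m | (N < m)%N]].
    by exists N.+1 => // m /= Nm; exists m.
  by have [|_ [[m Nm <-] hm]] := hl _ n.+1%:R^-1 h; [rewrite invr_gt0|exists m].
pose next n N := sval (cid (pick n N)).
have nextP n N : (N < next n N)%N /\ mdist l (x (next n N)) < n.+1%:R^-1 := svalP (cid (pick n N)).
pose phi := fix phi n := if n is m.+1 then next n (phi m) else next 0%N 0%N.
have phiS n : (phi n < phi n.+1)%N by have [] := nextP n.+1 (phi n).
have phid n : mdist l (x (phi n)) < n.+1%:R^-1 by case: n => [|n]; [have [] := nextP 0%N 0%N|have [] := nextP n.+1 (phi n)].
exists phi; split; first exact: homo_ltn ltn_trans phiS.
exists l; apply/metricType_numDomainType.cvgrPdist_lt => e e0.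
near=> n; apply: (lt_trans (phid n)).
by near: n; exact: near_infty_invS_lt.
Unshelve. all: by end_near.
Qed.

Lemma compact_complete : complete_space X.
Proof.
move=> F PF /cauchyP cF.
have [l hl] := metric_cluster PF.
exists l; apply/metricType_numDomainType.fcvgrPdist_lt => e e0.
have e3 : 0 < e / 3 by rewrite divr_gt0.
have [z Fz] := cF _ e3; have [y []] := hl _ _ Fz e3.
rewrite ballEmdist/= => zy ly; apply: filterS Fz => w; rewrite ballEmdist/= => zw.
have := metric_triangle l y w; have := metric_triangle y z w; rewrite (metric_sym y z); lra.
Qed.

Lemma isometric_totally_bounded (M : metricType R) (i : M -> X) :
  (forall x y, mdist (i x) (i y) = mdist x y) -> totally_bounded M.
Proof.
move=> iso e e0; apply: contrapT => no.
(* If no finite union of balls covers [M], the complements of these unions generate a proper filter,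
   whose image clusters in the compact space. *)
pose F := filter_from (@finite_set M) (fun A => ~` \bigcup_(x in A) ball x e).
have PF : ProperFilter F.
  apply: filter_from_proper; first apply: filter_from_filter.
  - by exists set0; exact: finite_set0.
  - move=> A B fA fB; exists (A `|` B); first by rewrite /= finite_setU.
    by rewrite bigcup_setU setCU.
  - move=> A fA; apply: contrapT => h; apply: no; exists A => //.
    by apply/seteqP; split => // y _; apply: contrapT => hy; apply: h; exists y.
have [l hl] := @metric_cluster (i @ F) _.
have e2 : 0 < e / 2 by rewrite divr_gt0.
have hG (A : set M) : F A -> exists m, A m /\ mdist l (i m) < e / 2.
  move=> FA; have h : (i @ F) [set i m | m in A] by apply: filterS FA => m Am; exists m.
  by have [_ [[m Am <-] hm]] := hl _ _ h e2; exists m.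
(* A point [m] near the cluster point is taken first; removing its ball from the filter yields a
   second point near the cluster point, too close to [m]. *)
have [m [_ lm]] := hG setT filterT.
have Fc : F (~` ball m e) by exists [set m]; [exact: finite_set1|rewrite bigcup_set1].
have [m' [mm' lm']] := hG _ Fc; apply: mm'.
rewrite ballEmdist/= -iso.
have := metric_triangle (i m) l (i m'); rewrite (metric_sym (i m) l); lra.
Qed.

End compact_metric.

(** * Distances given by weighted series *)

Section weighted_distance.
Context {R : realType} (X : Type).
Variables (L : nat -> X -> R) (w : nat -> R).
Hypothesis w0 : forall r, 0 < w r.
Hypothesis wL : forall r x y, w r * `|L r x - L r y| <= 2^-1 ^+ r.

(** With [L r] the multiset integral of the r-th function and [w r] its weight, this is [Dmetric] by
    conversion. *)
Definition wdist (x y : X) : R := limn (series (fun r => w r * `|L r x - L r y|)).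

Lemma half_tail N n : \sum_(N <= r < n) 2^-1 ^+ r <= 2 * 2^-1 ^+ N :> R.
Proof.
have [nN|Nn] := leqP n N; first by rewrite big_geq// mulr_ge0// exprn_ge0.
rewrite -(subnKC (ltnW Nn)); set k := (n - N)%N.
suff -> : \sum_(N <= r < N + k) 2^-1 ^+ r = 2 * 2^-1 ^+ N - 2 * 2^-1 ^+ (N + k) :> R.
  by rewrite gerBl mulr_ge0// exprn_ge0.
elim: k => [|k IH]; first by rewrite addn0 big_geq// subrr.
by rewrite addnS big_nat_recr ?leq_addr//= IH [in RHS]exprS; field.
Qed.

Lemma wterm_ge0 x y r : 0 <= w r * `|L r x - L r y|.
Proof. by rewrite mulr_ge0// ltW. Qed.

Lemma wseries_le x y N n :
  series (fun r => w r * `|L r x - L r y|) n <=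
  \sum_(0 <= r < N) w r * `|L r x - L r y| + 2 * 2^-1 ^+ N.
Proof.
rewrite /series/=; apply: (@le_trans _ _ (\sum_(0 <= r < N + n) w r * `|L r x - L r y|)).
  rewrite (@big_cat_nat _ _ _ n 0 (N + n))//= ?leq_addl// lerDl.
  by apply: sumr_ge0 => r _; exact: wterm_ge0.
rewrite (@big_cat_nat _ _ _ N 0 (N + n))//= ?leq_addr// lerD2l.
by apply: le_trans (half_tail N (N + n)); apply: ler_sum => r _; exact: wL.
Qed.

Lemma wseries_nd x y : nondecreasing_seq (series (fun r => w r * `|L r x - L r y|)).
Proof. by apply: nondecreasing_series => r _ _; exact: wterm_ge0. Qed.

Lemma wdist_cvg x y : series (fun r => w r * `|L r x - L r y|) @ \oo --> wdist x y.
Proof.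
apply: nondecreasing_is_cvgn; first exact: wseries_nd.
by exists (\sum_(0 <= r < 0) w r * `|L r x - L r y| + 2 * 2^-1 ^+ 0) => _ [n _ <-]; exact: wseries_le.
Qed.

Lemma wdist_le x y N : wdist x y <= \sum_(0 <= r < N) w r * `|L r x - L r y| + 2 * 2^-1 ^+ N.
Proof. by apply: (@cvg_le_bound _ _ (wdist x y) _ (@wdist_cvg x y)); apply: nearW => n; exact: wseries_le. Qed.

Lemma wseries_le_wdist x y n : series (fun r => w r * `|L r x - L r y|) n <= wdist x y.
Proof. by apply: (nondecreasing_cvgn_le (wseries_nd x y)); apply/cvg_ex; eexists; exact: wdist_cvg. Qed.

Lemma term_le_wdist x y r : w r * `|L r x - L r y| <= wdist x y.
Proof.
apply: le_trans (wseries_le_wdist x y r.+1).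
rewrite /series/= big_nat_recr//= lerDr; apply: sumr_ge0 => i _; exact: wterm_ge0.
Qed.

Lemma wdist_eq0 x y : wdist x y = 0 -> forall r, L r x = L r y.
Proof.
move=> xy r; apply/eqP; rewrite -subr_eq0 -normr_le0 -(pmulr_rle0 _ (w0 r)) -xy.
exact: term_le_wdist.
Qed.

Lemma wdist_is_metric : (forall x y, (forall r, L r x = L r y) -> x = y) -> is_metric wdist.
Proof.
move=> sep; split => [x|x y /wdist_eq0/sep//|x y|y x z].
- rewrite /wdist; apply: cvg_lim => //; apply: cvg_near_cst; apply: nearW => n.
  by rewrite /series/= big1// => r _; rewrite subrr normr0 mulr0.
- by rewrite /wdist; under eq_fun do rewrite distrC.
- apply: (@cvg_le_bound _ _ (wdist x z) _ (@wdist_cvg x z)); apply: nearW => n.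
  apply: le_trans (lerD (wseries_le_wdist x y n) (wseries_le_wdist y z n)).
  rewrite /series/= -big_split/=; apply: ler_sum => r _.
  by rewrite -mulrDr ler_wpM2l ?(ltW (w0 r))// ler_distD.
Qed.

Lemma wdist_small (e : R) : 0 < e -> exists N (dl : R), 0 < dl /\
  forall x y, (forall r, (r < N)%N -> `|L r x - L r y| <= dl) -> wdist x y < e.
Proof.
move=> e0; have hlim : (fun n => (2^-1 : R) ^+ n) @ \oo --> (0 : R).
  by apply: cvg_expr; rewrite ger0_norm// invf_lt1// ltr1n.
have e4 : 0 < e / 4 by rewrite divr_gt0.
have [N _ /(_ N (leqnn N))/= hN] := @cvgr_lt _ _ _ _ _ _ hlim _ e4.
pose W := \sum_(0 <= r < N) w r; have W0 : 0 <= W by apply: sumr_ge0 => r _; exact: ltW.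
(* The first [N] terms cost at most [e / 4] and the tail less than [e / 2]; [W + 1] avoids a
   division by zero. *)
exists N, (e / (4 * (W + 1))); split; first by rewrite divr_gt0// mulr_gt0// ltr_wpDl.
move=> x y h; apply: le_lt_trans (wdist_le x y N) _.
have : \sum_(0 <= r < N) w r * `|L r x - L r y| <= W * (e / (4 * (W + 1))).
  rewrite /W mulr_suml; apply: ler_sum_nat => r /andP[_ rN].
  by rewrite ler_wpM2l ?(ltW (w0 r))// h.
have : W * (e / (4 * (W + 1))) <= e / 4.
  have W1 : 0 < W + 1 by rewrite ltr_wpDl.
  rewrite (_ : W * _ = (e / 4) * (W / (W + 1))); last by field; rewrite gt_eqF.
  by rewrite ler_piMr ?(ltW e4)// ler_pdivrMr// mul1r lerDl.
lra.
Qed.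

End weighted_distance.

(** * Ramps, tents and a partition of unity on the line *)

Section clamp.
Context {R : realType}.
Implicit Types u v : R.

Definition clamp u : R := Num.max 0 (Num.min 1 u).

Lemma clamp_01 u : 0 <= clamp u <= 1.
Proof. by rewrite /clamp le_max lexx ge_max ler01 ge_min lexx. Qed.

Lemma clamp_id1 u : 1 <= u -> clamp u = 1.
Proof. by move=> u1; rewrite /clamp min_l// max_r. Qed.

Lemma clamp_id0 u : u <= 0 -> clamp u = 0.
Proof. by move=> u0; rewrite /clamp max_l// ge_min u0 orbT. Qed.

Lemma clamp_lip u v : `|clamp u - clamp v| <= `|u - v|.
Proof.
have := ler_norm (u - v); have := ler_norm (v - u); rewrite (distrC v u) /clamp ler_norml.
by case: (lerP 1 u) => ?; case: (lerP 1 v) => ?; rewrite ?(max_r ler01);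
  try case: (lerP 0 u) => ?; try case: (lerP 0 v) => ?; lra.
Qed.

Definition tent u : R := Num.max 0 (1 - `|u|).

Lemma tent_ge0 u : 0 <= tent u.
Proof. by rewrite /tent le_max lexx. Qed.

Lemma tent_le1 u : tent u <= 1.
Proof. by rewrite /tent ge_max ler01 lerBlDr lerDl normr_ge0. Qed.

Lemma tent_neq0 u : tent u != 0 -> `|u| < 1.
Proof.
by apply: contraNT; rewrite -leNgt /tent => u1; apply/eqP/max_idPl; rewrite subr_le0.
Qed.

Lemma tent_lip u v : `|tent u - tent v| <= `|u - v|.
Proof.
have : `| `|u| - `|v| | <= `|u - v| by exact: ler_dist_dist.
rewrite /tent; move: (`|u - v|) => w; rewrite !ler_norml => /andP[h1 h2].
by have [?|?] := leP 0 (1 - `|u|); have [?|?] := leP 0 (1 - `|v|); lra.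
Qed.

(** A tent is the increment of a ramp, so sums of tents over consecutive integers telescope. *)
Lemma tent_clamp u : tent u = clamp (u + 1) - clamp u.
Proof.
rewrite /tent /clamp; case: (ger0P u) => u0; case: (lerP 1 (u + 1)) => ?; case: (lerP 1 u) => ?;
  rewrite ?(max_r ler01); do ?[case: lerP => ?]; lra.
Qed.

Lemma sum_tent N u : \sum_(i < (2 * N).+1) tent (u - (i%:R - N%:R)) =
  clamp (u + N%:R + 1) - clamp (u - N%:R).
Proof.
rewrite -(big_mkord xpredT (fun i => tent (u - (i%:R - N%:R)))).
rewrite (eq_bigr (fun i => - clamp (u - (i.+1%:R - N%:R) + 1) - - clamp (u - (i%:R - N%:R) + 1))).
  by rewrite telescope_sumr// opprK addrC -natr1 natrM; congr (clamp _ - clamp _); ring.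
by move=> i _; rewrite tent_clamp opprK addrC; congr (- clamp _ + _); rewrite -natr1; ring.
Qed.

Lemma sum_tent_le1 N u : \sum_(i < (2 * N).+1) tent (u - (i%:R - N%:R)) <= 1.
Proof.
by rewrite sum_tent; have := clamp_01 (u + N%:R + 1); have := clamp_01 (u - N%:R); lra.
Qed.

Lemma sum_tent_eq1 N u : `|u| <= N%:R -> \sum_(i < (2 * N).+1) tent (u - (i%:R - N%:R)) = 1.
Proof. by rewrite ler_norml => /andP[? ?]; rewrite sum_tent clamp_id1 ?clamp_id0 ?subr0//; lra. Qed.

End clamp.

(** * Classes of functions closed under damping factors *)

Section damping.
Context {R : realType} (A : Type) (C : (A -> R) -> Prop) (u : nat -> A -> R) (c : nat -> R).
Hypothesis C1 : C (fun=> 1).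
Hypothesis C_lin : forall x y f g, C f -> C g -> C (fun a => x * f a + y * g a).
Hypothesis CM : forall j f, C f -> C (fun a => u j a * f a).

(** Expanded, each factor is [(1 - c^2) + 2 c u - u^2], so linear combinations and multiplication by
    the [u j] suffice; [C] need not be closed under products. *)
Lemma damping_closed m p : C (fun a => (\prod_(j < m) (1 - (u j a - c j) ^+ 2)) ^+ p).
Proof.
elim: p => [|p IH]; first by under eq_fun do rewrite expr0.
suff key n f : C f -> C (fun a => \prod_(j < n) (1 - (u j a - c j) ^+ 2) * f a).
  by have := key m _ IH; congr C; apply/funext => a; rewrite exprS.
elim: n => [|n IHn] Cf; first by under eq_fun do rewrite big_ord0 mul1r.
have F1 := CM n (IHn Cf); have F2 := CM n F1.
have := C_lin (1 - c n ^+ 2) 1 (IHn Cf) (C_lin (2 * c n) (-1) F1 F2).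
by congr C; apply/funext => a; rewrite big_ord_recr/=; ring.
Qed.

End damping.

Lemma onem_sqr_01 {R : realType} (s : R) : `|s| <= 1 -> 0 <= 1 - s ^+ 2 <= 1.
Proof. by move=> s1; rewrite subr_ge0 lerBlDr lerDl sqr_ge0 andbT -real_normK ?num_real// exprn_ile1. Qed.

(** * Borel measurability for points and tuples of points *)

Section euclidean_measures.
Context {R : realType} {d : nat}.
Notation V := 'rV[R]_d.
Notation T := (Rvec R d).
Notation P := (subprobability T R).
Notation nzo := (nz_orbit R d).
Notation pts k := 'M[R]_(k, d).
Notation fn k := (pts k -> R).

Lemma open_Rvec (A : set V) : open A -> measurable (A : set T).
Proof. by move=> oA; exact: sub_sigma_algebra. Qed.

Lemma closed_Rvec (A : set V) : closed A -> measurable (A : set T).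
Proof. by move=> cA; rewrite -(setCK A); apply: (@measurableC _ T); apply: open_Rvec; exact: closed_openC. Qed.

Lemma continuous_Rvec_measurable (g : V -> R) :
  continuous g -> measurable_fun setT (g : T -> R).
Proof.
move=> cg; apply: (measurability _ (RGenOpens.measurableE R)).
move=> _ [_ [a [b ->] <-]]; rewrite setTI; apply: open_Rvec.
by apply: open_comp; [move=> + _; exact: cg|exact: interval_open].
Qed.

Lemma continuous_Rvec_Rvec (g : V -> V) :
  continuous g -> measurable_fun setT (g : T -> T).
Proof.
move=> cg; apply: (@measurability _ _ T T setT g (@open V) erefl).
move=> _ [A oA <-]; rewrite setTI; apply: open_Rvec.
by apply: open_comp => // + _; exact: cg.
Qed.

(** Power measures live on tuples, test functions on matrices; this is the passage between them that
    occurs in [power_integral]. *)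
Definition mxt k (t : k.-tuple T) : pts k := \matrix_(i < k) (tnth t i : V).

Lemma mxtE k (t : k.-tuple T) i j : mxt t i j = (tnth t i : V) ord0 j.
Proof. by rewrite mxE. Qed.

Lemma measurable_entry k (i : 'I_k) (j : 'I_d) :
  measurable_fun setT (fun t : k.-tuple T => mxt t i j).
Proof.
under eq_fun do rewrite mxtE.
apply: (measurableT_comp (f := fun x : T => (x : V) ord0 j)).
  by apply: continuous_Rvec_measurable; exact: coord_continuous.
exact: measurable_tnth.
Qed.

(* Rounding the entries down to multiples of 1/(n+1) factors through a
   countable type, so a continuous function is a pointwise limit of
   countably-valued measurable ones. *)
Lemma continuous_mx_measurable k (g : fn k) :
  continuous g -> measurable_fun setT (fun t : k.-tuple T => g (mxt t)).
Proof.
move=> cg.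
pose c n (x : pts k) : 'M[int]_(k, d) := \matrix_(i, j) Num.floor (x i j * n.+1%:R).
pose b n (z : 'M[int]_(k, d)) : pts k := \matrix_(i, j) ((z i j)%:~R / n.+1%:R).
apply: (@measurable_fun_cvg _ _ _ _ (fun n t => g (b n (c n (mxt t))))) => [n|t _].
  move=> _ Y mY; rewrite setTI.
  rewrite (_ : _ @^-1` _ = \bigcup_(z in [set: 'M[int]_(k, d)])
      [set t : k.-tuple T | (forall i j, Num.floor (mxt t i j * n.+1%:R) = z i j) /\ Y (g (b n z))]); last first.
    apply/seteqP; split => t /=.
      by move=> h; exists (c n (mxt t)) => //; split => // i j; rewrite [RHS]mxE.
    move=> [z _ [h Yz]]; suff -> : c n (mxt t) = z by [].
    by apply/matrixP => i j; rewrite [LHS]mxE; exact: h.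
  apply: countable_bigcupT_measurable => [|z]; first exact: countableP.
  have [Yz|nYz] := pselect (Y (g (b n z))); last first.
    by rewrite (_ : [set _ | _] = set0)//; apply/seteqP; split => t // [].
  rewrite (_ : [set _ | _] = \big[setI/setT]_(i < k) \big[setI/setT]_(j < d)
     [set t : k.-tuple T | Num.floor (mxt t i j * n.+1%:R) = z i j]); last first.
    apply/seteqP; split => t /=.
      move=> [h _]; rewrite -bigcap_seq => i _; rewrite -bigcap_seq => j _; exact: h.
    rewrite -bigcap_seq => h; split => // i j; move: (h i (mem_index_enum _)).
    by rewrite -bigcap_seq => /(_ j (mem_index_enum _)).
  apply: bigsetI_measurable => i _; apply: bigsetI_measurable => j _.
  rewrite (_ : [set _ | _] = (fun t : k.-tuple T => mxt t i j) @^-1`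
     `[(z i j)%:~R / n.+1%:R, (z i j + 1)%:~R / n.+1%:R[%classic); last first.
    apply/seteqP; split => t /=; rewrite in_itv/= ler_pdivrMr// ltr_pdivlMr//.
      by move=> <-; rewrite floor_le floorD1_gt.
    by move=> ?; apply/floor_def.
  by rewrite -[X in measurable X]setTI; apply: measurable_entry.
apply: continuous_cvg; first exact: cg.
move=> A [P PM PA].
have : \forall n \near \oo, forall i, forall j, P i j (b n (c n (mxt t)) i j).
  apply: filter_forall => i; apply: filter_forall => j.
  suff : (fun n => b n (c n (mxt t)) i j) @ \oo --> mxt t i j by apply; exact: PM.
  under eq_fun do rewrite !mxE.
  set x := (tnth t i : V) 0 j.
  apply: (@squeeze_cvgr _ _ _ _ (fun n => x - n.+1%:R^-1) (cst x)).
  - apply: nearW => n; have n0 : (0 : R) < n.+1%:R by [].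
    rewrite ler_pdivlMr// ler_pdivrMr// mulrBl mulVf ?lt0r_neq0//.
    by rewrite floor_le andbT; have := floorD1_gt (x * n.+1%:R); rewrite intrD; lra.
  - rewrite mxE -/x -[X in _ --> X]subr0; apply: cvgB; first exact: cvg_cst.
    exact: cvg_harmonic.
  - by rewrite mxE; exact: cvg_cst.
by apply: filterS => n; exact: PA.
Qed.

(** * Power measures *)

Lemma measurable_tuple_cons k :
  measurable_fun setT (fun z : T * k.-tuple T => [tuple of z.1 :: z.2]).
Proof. by apply: measurable_cons; [exact: measurable_fst|exact: measurable_snd]. Qed.

(** [power_measure] again, bundled as a subprobability so that the rules for [E] apply to it. *)
Fixpoint pw (a : P) (k : nat) : subprobability (k.-tuple T) R :=
  match k with
  | 0 => \d_([tuple] : 0.-tuple T)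
  | k'.+1 => image_sub (product_subprobability (a, pw a k')) (@measurable_tuple_cons k')
  end.

Lemma pwE (a : P) k : pw a k = power_measure a (k := k) :> (set (k.-tuple T) -> \bar R).
Proof.
elim: k => //= k IH; apply/funext => A.
by rewrite /pushforward/= /image_measure /pushforward/= IH.
Qed.

Lemma bm_cons k (F : k.+1.-tuple T -> R) : bm F ->
  bm (fun z : T * k.-tuple T => F [tuple of z.1 :: z.2]).
Proof.
move=> [mF [M FM]]; split; last by exists M => y; exact: FM.
by apply: measurableT_comp => //; exact: measurable_tuple_cons.
Qed.

Lemma E_pw0 (a : P) (F : 0.-tuple T -> R) : measurable_fun setT F -> E (pw a 0) F = F [tuple].
Proof.
move=> mF; rewrite /E /Rintegral integral_dirac//=.
  by rewrite indicE in_setT mul1r.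
exact/measurable_EFinP.
Qed.

Lemma E_pwS (a : P) k (F : k.+1.-tuple T -> R) : bm F ->
  E (pw a k.+1) F = E a (fun x => E (pw a k) (fun t => F [tuple of x :: t])).
Proof.
move=> bF; rewrite E_image// E_prod//; exact: bm_cons.
Qed.

Lemma bm_cons1 k (F : k.+1.-tuple T -> R) x : bm F -> bm (fun t : k.-tuple T => F [tuple of x :: t]).
Proof. move=> bF; exact: (bm_section x (bm_cons bF)). Qed.

Lemma bm_Econs (a : P) k (F : k.+1.-tuple T -> R) : bm F ->
  bm (fun x => E (pw a k) (fun t => F [tuple of x :: t])).
Proof. move=> bF; exact: (bm_Esection a (pw a k) (bm_cons bF)). Qed.

Lemma bm_tnth k (i : 'I_k) (h : T -> R) : bm h -> bm (fun t : k.-tuple T => h (tnth t i)).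
Proof.
move=> [mh [M hM]]; split; last by exists M => t; exact: hM.
by apply: measurableT_comp => //; exact: measurable_tnth.
Qed.

Lemma E_pw_prod (a : P) k (h : 'I_k -> T -> R) : (forall i, bm (h i)) ->
  E (pw a k) (fun t => \prod_(i < k) h i (tnth t i)) = \prod_(i < k) E a (h i).
Proof.
elim: k h => [|k IH] h bh.
  rewrite E_pw0 ?big_ord0// (_ : (fun t => _) = cst 1) //.
  by apply/funext => t; rewrite big_ord0.
rewrite E_pwS; last by apply: bm_prod => i _; exact: bm_tnth.
rewrite big_ord_recl -IH// mulrC -EZ//; congr E; apply/funext => x.
rewrite mulrC -EZ; last by apply: bm_prod => i _; exact: bm_tnth.
congr E; apply/funext => t; rewrite big_ord_recl; congr *%R.
by apply: eq_bigr => i _; rewrite tnthS.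
Qed.

Lemma mass_pw (a : P) k : fine (pw a k setT) = fine (a setT) ^+ k.
Proof.
have := @E_pw_prod a k (fun _ _ => 1) (fun _ => bm_cst _).
by rewrite big1_eq E_cst mul1r => ->; rewrite big_const_ord iter_mulr_1 E_cst mul1r.
Qed.

(** That [b] is the image of [a] is expressed through integrals, because a member of an orbit agrees
    with a translate on Borel sets only. *)
Lemma E_pw_image (a b : P) (s : T -> T) k (F : k.-tuple T -> R) :
  measurable_fun setT s -> (forall g, bm g -> E b g = E a (g \o s)) -> bm F ->
  E (pw b k) F = E (pw a k) (fun t => F [tuple of map s t]).
Proof.
move=> ms ab; elim: k F => [|k IH] F bF.
  have [mF _] := bF; rewrite !E_pw0//; first by congr F; exact/val_inj.
  suff -> : (fun t : 0.-tuple T => F [tuple of map s t]) = F by [].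
  by apply/funext => t; congr F; rewrite [t]tuple0; exact/val_inj.
have mmap n : measurable_fun setT (fun t : n.-tuple T => [tuple of map s t]).
  apply/measurable_fun_tnthP => i.
  rewrite (_ : _ \o _ = s \o (fun t : n.-tuple T => tnth t i)); last first.
    by apply/funext => t /=; rewrite tnth_map.
  by apply: measurableT_comp => //; exact: measurable_tnth.
rewrite !E_pwS//; last first.
  have [mF [M FM]] := bF; split; last by exists M => t; exact: FM.
  by apply: measurableT_comp => //; exact: mmap.
rewrite ab; last exact: bm_Econs.
congr E; apply/funext => x /=; rewrite IH; last exact: bm_cons1.
by congr E; apply/funext => t; congr F; exact/val_inj.
Qed.

(** * Translations and orbits *)

Definition trans (s : V) (z : T) : T := (z : V) + s.

Lemma measurable_trans s : measurable_fun setT (trans s).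
Proof.
apply: continuous_Rvec_Rvec => z.
apply: (@cvgD _ _ _ (nbhs (z : V)) _ id (cst s) z s); [exact: cvg_id|exact: cvg_cst].
Qed.

Definition shift (a : P) (s : V) : P := image_sub a (measurable_trans s).

Lemma shiftE a s A : shift a s A = a (trans s @^-1` A). Proof. by []. Qed.

Lemma E_shift a s g : bm g -> E (shift a s) g = E a (g \o trans s).
Proof. exact: E_image. Qed.

Lemma shiftK a s A : shift a s (trans (- s) @^-1` A) = a A.
Proof. by rewrite shiftE; congr (a _); apply/seteqP; split => x /=; rewrite /trans addrK. Qed.

(** The Dirac mass of the section at [x] is 1 exactly when [x + s] lies in [A], so the product
    measure integrates an indicator. *)
Lemma convolution_dirac (a : P) (s : T) (A : set T) : measurable A ->
  convolution a (\d_s) A = shift a s A.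
Proof.
move=> mA; rewrite /convolution /pushforward /product_measure1 shiftE.
have mtA : measurable (trans s @^-1` A).
  by rewrite -[X in measurable X]setTI; exact: measurable_trans.
rewrite -[X in a X](setIT) -integral_indic//.
apply: eq_integral => x _ /=; rewrite /dirac !indicE.
congr (_%:R%:E); congr nat_of_bool; apply/idP/idP; rewrite !inE.
  by rewrite /xsection/= inE.
by rewrite /xsection/= inE.
Qed.

Definition sim (a b : P) := exists s : V, forall A, measurable A -> b A = shift a s A.

Lemma orbit_ofP a b : orbit_of a b <-> sim a b.
Proof.
split=> -[s h]; exists s => A mA; rewrite h//; first exact: convolution_dirac.
by rewrite convolution_dirac.
Qed.

Lemma sim_refl a : sim a a.
Proof.
exists 0 => A mA; rewrite shiftE; congr (a _); apply/seteqP.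
by split => z /=; rewrite /trans addr0.
Qed.

Lemma mtrans_preimage s (A : set T) : measurable A -> measurable (trans s @^-1` A).
Proof. by move=> mA; rewrite -[X in measurable X]setTI; exact: measurable_trans. Qed.

Lemma sim_sym a b : sim a b -> sim b a.
Proof.
move=> [s h]; exists (- s) => A mA; rewrite shiftE h ?shiftE; last exact: mtrans_preimage.
by congr (a _); apply/seteqP; split => z /=; rewrite /trans addrK.
Qed.

Lemma sim_trans a b c : sim a b -> sim b c -> sim a c.
Proof.
move=> [s h] [r h']; exists (s + r) => A mA.
rewrite h'// shiftE h ?shiftE; last exact: mtrans_preimage.
by congr (a _); apply/seteqP; split => z /=; rewrite /trans addrA.
Qed.

Lemma orbit_eqP a b : orbit_of a = orbit_of b <-> sim a b.
Proof.
split=> [ab|ab].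
  by apply/orbit_ofP; rewrite ab; apply/orbit_ofP; exact: sim_refl.
apply/seteqP; split => c /orbit_ofP ac; apply/orbit_ofP.
  exact: sim_trans (sim_sym ab) ac.
exact: sim_trans ab ac.
Qed.

Lemma eq_on_measurable_E (a b : P) g :
  (forall A, measurable A -> a A = b A) -> E a g = E b g.
Proof.
move=> ab; rewrite /E /Rintegral; congr fine.
by apply: eq_measure_integral => A mA _; exact: ab.
Qed.

Lemma sim_mass a b : sim a b -> a setT = b setT.
Proof. by move=> [s ->]. Qed.

Lemma sim_E_pw a b k (F : k.-tuple T -> R) : sim a b -> bm F ->
  (forall s (t : k.-tuple T), F [tuple of map (trans s) t] = F t) -> E (pw a k) F = E (pw b k) F.
Proof.
move=> [s h] bF Finv.
rewrite (@E_pw_image a b (trans s) k F)//.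
- by congr E; apply/funext => t.
- exact: measurable_trans.
- by move=> g bg; rewrite (eq_on_measurable_E _ h) E_shift.
Qed.

(** * Test functions and their power integrals *)

Lemma spread_ge k (x : pts k) i j : `|row i x - row j x| <= spread x.
Proof.
have [->|ij] := eqVneq j i.
  by rewrite subrr normr0 /spread; exact: bigmax_ge_id.
rewrite /spread (bigD1 i)//= le_max; apply/orP; left.
by rewrite (bigD1 j)//= le_max lexx.
Qed.

Lemma spread_leP k (x : pts k) (c : R) : 0 <= c ->
  (forall i j, `|row i x - row j x| <= c) -> spread x <= c.
Proof.
move=> c0 h; rewrite /spread; apply/bigmax_leP; split => // i _.
by apply/bigmax_leP; split => // j _; exact: h.
Qed.

(** Translation puts the first point at the origin; a configuration of spread below [C] then lies in
    a compact box, and the others have value below 1. *)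
Lemma test_bounded k (f : fn k) : (0 < k)%N -> test_function f ->
  exists M : R, forall x, `|f x| <= M.
Proof.
move=> k0 [cf finv fdec]; pose i0 := Ordinal k0.
have [C hC] := fdec 1 ltr01.
have [M hM] := continuous_compact_bounded (@mx_box_compact R k d C) cf.
exists (Num.max M 1) => x; rewrite le_max.
have [Cx|xC] := leP C (spread x); first by rewrite [X in _ || X]ltW ?orbT// hC.
apply/orP; left; rewrite -(finv x (- row i0 x)); apply: hM => i j.
rewrite !mxE; apply: le_trans (ltW xC).
apply: le_trans (spread_ge x i i0); apply: le_trans (mx_entry_le _ 0 j).
by rewrite !mxE.
Qed.

Lemma test_bm k (f : fn k) : (0 < k)%N -> test_function f ->
  bm (fun t : k.-tuple T => f (mxt t)).
Proof.
move=> k0 tf; have [cf _ _] := tf; split; first exact: continuous_mx_measurable.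
by have [M hM] := test_bounded k0 tf; exists M => t.
Qed.

Lemma mxt_trans k (s : V) (t : k.-tuple T) :
  mxt [tuple of map (trans s) t] = \matrix_(i < k) (row i (mxt t) + s).
Proof. by apply/matrixP => i j; rewrite mxtE !mxE tnth_map /trans !mxE. Qed.

Definition pint k (f : fn k) (a : P) : R := E (pw a k) (fun t => f (mxt t)).

Lemma power_integralE k (f : fn k) (a : P) : (0 < k)%N -> test_function f ->
  power_integral f a = (pint f a)%:E.
Proof.
by move=> k0 tf; rewrite /power_integral -pwE /pint -EE//; exact: test_bm.
Qed.

Lemma pint_sim k (f : fn k) (a b : P) : (0 < k)%N -> test_function f ->
  sim a b -> pint f a = pint f b.
Proof.
move=> k0 tf ab; apply: sim_E_pw => //; first exact: test_bm.
by move=> s t; rewrite mxt_trans; have [_ -> _] := tf.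
Qed.

Lemma test_functionD k (f g : fn k) :
  test_function f -> test_function g -> test_function (fun x => f x + g x).
Proof.
move=> [cf fi fd] [cg gi gd]; split.
- exact: contD.
- by move=> x y; rewrite fi gi.
- move=> e e0; have e20 : 0 < e / 2 by rewrite divr_gt0.
  have [C hC] := fd _ e20; have [D hD] := gd _ e20.
  exists (Num.max C D) => x; rewrite ge_max => /andP[Cx Dx].
  by rewrite (le_lt_trans (ler_normD _ _))// [ltRHS](splitr e) ltrD ?hC ?hD.
Qed.

Lemma test_functionZ k (c : R) (f : fn k) :
  test_function f -> test_function (fun x => c * f x).
Proof.
move=> [cf fi fd]; split.
- exact: contZ.
- by move=> x y; rewrite fi.
- move=> e e0; have [C hC] := fd (e / (`|c| + 1)) (divr_gt0 e0 (ltr_wpDl (normr_ge0 _) ltr01)).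
  exists C => x /hC; rewrite ltr_pdivlMr ?ltr_wpDl// => h.
  rewrite normrM (le_lt_trans _ h)// mulrC ler_wpM2l// lerDl//.
Qed.

Lemma test_function_norm k (f : fn k) :
  test_function f -> test_function (fun x => `|f x|).
Proof.
move=> [cf fi fd]; split.
- exact: cont_norm.
- by move=> x y; rewrite fi.
- by move=> e e0; have [C hC] := fd _ e0; exists C => x /hC; rewrite normr_id.
Qed.

(** Positive and negative parts are written as combinations of [f] and its absolute value, so that
    closure of test functions under sums, multiples and absolute values applies. *)
Definition fpos k (f : fn k) x := 2^-1 * (`|f x| + f x).
Definition fneg k (f : fn k) x := 2^-1 * (`|f x| + (-1) * f x).

Lemma test_fpos k (f : fn k) : test_function f -> test_function (fpos f).
Proof.
move=> tf; apply: test_functionZ; apply: test_functionD => //; exact: test_function_norm.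
Qed.

Lemma test_fneg k (f : fn k) : test_function f -> test_function (fneg f).
Proof.
move=> tf; apply: test_functionZ; apply: test_functionD; first exact: test_function_norm.
exact: test_functionZ.
Qed.

Lemma fpos_ge0 k (f : fn k) x : 0 <= fpos f x.
Proof. by rewrite mulr_ge0//; have := lerNnormlW (lexx `|f x|); lra. Qed.

Lemma fneg_ge0 k (f : fn k) x : 0 <= fneg f x.
Proof. by rewrite mulr_ge0// mulN1r subr_ge0 ler_norm. Qed.

Lemma fposBneg k (f : fn k) x : fpos f x - fneg f x = f x.
Proof. by rewrite /fpos /fneg; lra. Qed.

Lemma pint_split k (f : fn k) a : (0 < k)%N -> test_function f ->
  pint f a = pint (fpos f) a - pint (fneg f) a.
Proof.
move=> k0 tf; rewrite /pint -EB; last 2 first.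
- by apply: (test_bm k0); exact: test_fpos.
- by apply: (test_bm k0); exact: test_fneg.
by congr E; apply/funext => t; rewrite fposBneg.
Qed.

(** * Multisets of orbits as sequences of measures *)

Lemma esum_nat_cst (A : set nat) (c : R) : 0 <= c ->
  \esum_(i in A) c%:E = (c%:E * \esum_(i in A) 1)%E.
Proof.
move=> c0; have AE : A = [set x | x \in A] by apply/seteqP; split => x /=; rewrite inE.
rewrite AE -!nneseries_esum// -nneseriesZl//.
by apply: eq_eseriesr => i _; rewrite mule1.
Qed.

Lemma esum_card (A : set nat) : finite_set A ->
  \esum_(i in A) 1%E = (size (finmap.enum_fset (fset_set A)))%:R%:E :> \bar R.
Proof.
move=> fA; rewrite esum_fset// fsbig_finite//=.
elim: (finmap.enum_fset _) => [|x s IH]; first by rewrite big_nil.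
by rewrite big_cons IH/= -EFinD -natr1 addrC.
Qed.

Lemma repr_nz (o : nzo) : Defs.repr o setT != 0%E.
Proof. exact: s2valP (cid2 (svalP o)). Qed.

Lemma repr_orbit (o : nzo) : sval o = orbit_of (Defs.repr o).
Proof. exact: s2valP' (cid2 (svalP o)). Qed.

Lemma nzo_eqP (o o' : nzo) : o = o' <-> sval o = sval o'.
Proof. by split => [->//|]; exact: eq_sig_hprop. Qed.

Definition orb (a : P) (a0 : a setT != 0%E) : nzo :=
  exist _ (orbit_of a) (ex_intro2 _ _ a a0 erefl).

Definition fibre (al : nat -> P) (o : nzo) : set nat :=
  [set i | al i setT != 0%E /\ sval o = orbit_of (al i)].

Lemma fibre_sim al o i : fibre al o i -> sim (al i) (Defs.repr o).
Proof. by move=> [_]; rewrite repr_orbit => /esym/orbit_eqP. Qed.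

(** The sequence lists the orbits with multiplicity, zero measures filling the remaining places.
    Counting in the extended reals makes the equation force every fibre to be finite. *)
Definition represents (m : nzo -> nat) (al : nat -> P) :=
  forall o, (m o)%:R%:E = \esum_(i in fibre al o) 1%E :> \bar R.

Lemma represents_esum m al (g : P -> R) : represents m al ->
  (forall a : P, 0 <= g a) -> (forall a b, sim a b -> g a = g b) ->
  (forall a : P, a setT = 0%E -> g a = 0) ->
  \esum_(o in [set: nzo]) ((m o)%:R%:E * (g (Defs.repr o))%:E)%E =
  (\sum_(i <oo) (g (al i))%:E)%E.
Proof.
move=> ma g0 gsim gz.
transitivity (\esum_(o in [set: nzo]) \esum_(i in fibre al o) (g (al i))%:E).
  apply: eq_esum => o _; rewrite (ma o) muleC -esum_nat_cst//.
  by apply: eq_esum => i io; rewrite (gsim _ _ (fibre_sim io)).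
rewrite esum_esum; last by move=> *; rewrite lee_fin.
pose N := [set i | al i setT != 0%E].
rewrite nneseries_esumT; last by move=> *; rewrite lee_fin.
(* An index determines its orbit, so the pairs of an orbit and an index of its fibre correspond to
   the indices of nonzero measures. *)
transitivity (\esum_(i in N) (g (al i))%:E).
  rewrite (@reindex_esum _ _ _ (setT `*`` (fibre al)) N snd)//; split.
  - by move=> [w i] /= [_ []].
  - move=> [w i] [w' i']; rewrite !inE => -[_ [_ /= h]] [_ [_ /= h']] /= ii'.
    by subst i'; congr pair; apply/nzo_eqP; rewrite h.
  - by move=> i /= Ni; exists (orb Ni, i).
rewrite esum_mkcond; apply: eq_esum => i _; case: ifPn => // iN.
by rewrite gz//; apply/eqP; apply: contraNT iN => h; rewrite inE.
Qed.

Definition mass (a : P) : R := fine (a setT).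

Lemma massE (a : P) : a setT = (mass a)%:E.
Proof. by rewrite fineK// fin_num_measure. Qed.

Lemma mass_eq0 (a : P) : a setT = 0%E -> mass a = 0. Proof. by rewrite /mass => ->. Qed.

Notation light al := (\sum_(i <oo) (mass (al i))%:E <= 1)%E.

Lemma mass_fin_num (al : nat -> P) : light al ->
  (\sum_(i <oo) (mass (al i))%:E)%E \is a fin_num.
Proof.
move=> h; rewrite ge0_fin_numE ?(le_lt_trans h) ?ltry//.
by apply: nneseries_ge0 => *; rewrite lee_fin mass_ge0.
Qed.

Lemma represents_mass m al : represents m al ->
  \esum_(o in [set: nzo]) ((m o)%:R%:E * Defs.repr o setT)%E = (\sum_(i <oo) (mass (al i))%:E)%E.
Proof.
move=> ma; rewrite -(represents_esum ma)//.
- by apply: eq_esum => o _; rewrite massE.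
- by move=> a; exact: mass_ge0.
- by move=> a b /sim_mass; rewrite /mass => ->.
- exact: mass_eq0.
Qed.

(** The copies [(o, j)] with [j] below the multiplicity of [o] are countably many; an injection into
    [nat] numbers them, and every other index gets the zero measure. *)
Lemma Xtilde_represented (xi : Xtilde R d) : exists al,
  represents xi al /\ light al.
Proof.
suff [al ral] : exists al, represents xi al.
  exists al; split => //; rewrite -(represents_mass ral).
  by case: xi {al ral}.
pose S := [set p : nzo * nat | (p.2 < xi p.1)%N].
have : countable S.
  apply: (@sub_countable _ _ _ ([set o | xi o != 0%N] `*` [set: nat])).
    by apply: subset_card_le => -[w j]; rewrite /S/=; case: (mult xi w).
  by apply: countableX => //; case: xi {S}.
move=> /countable_injP[h hinj].
pose al i : P := if pselect (exists p, S p /\ h p = i) is left e then Defs.repr (sval (cid e)).1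
  else @mzero _ T R.
have alh p : S p -> al (h p) = Defs.repr p.1.
  move=> Sp; rewrite /al; case: pselect => [e|[]]; last by exists p.
  by congr (Defs.repr _.1); have [Sq hq] := svalP (cid e); apply: hinj; rewrite ?inE.
exists al => o.
have -> : fibre al o = (fun j => h (o, j)) @` `I_(xi o).
  apply/seteqP; split => i.
    move=> [i0 oi]; have [p [Sp hp]] : exists p, S p /\ h p = i.
      by move: i0; rewrite /al; case: pselect => //= _; rewrite eqxx.
    have op : o = p.1 by apply/nzo_eqP; rewrite oi -hp alh// -repr_orbit.
    by exists p.2; rewrite op -?surjective_pairing.
  move=> [j jo <-]; have Sj : S (o, j) by [].
  by split; rewrite alh ?repr_nz// -repr_orbit.
rewrite (@reindex_esum _ _ _ `I_(xi o) _ (fun j => h (o, j))); last first.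
  split; [by move=> j jo; exists j| |by move=> _ [j jo <-]; exists j].
  move=> j j'; rewrite !inE => jo j'o /hinj; rewrite !inE => /(_ jo j'o).
  by move=> [].
rewrite esum_fset; [|exact: finite_II|by []].
rewrite -fsbig_ord; elim: (xi o) => [|n IH]; first by rewrite big_ord0.
by rewrite big_ord_recr/= -IH -EFinD natr1.
Qed.

Lemma sequence_represents (al : nat -> P) : light al ->
  exists xi : Xtilde R d, represents xi al.
Proof.
move=> mal.
(* All members of a fibre share one positive mass, so the bound on the total mass limits their
   number. *)
have fin o : finite_set (fibre al o).
  apply: contrapT => /infinite_set_fset Ainf.
  have mo : 0 < mass (Defs.repr o).
    rewrite lt_neqAle mass_ge0 andbT; apply: contraNneq (repr_nz o) => mo.
    by rewrite massE -mo.
  have [B BA Bn] := Ainf (Num.truncn ((mass (Defs.repr o))^-1)).+1.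
  have : ((mass (Defs.repr o))%:E * (\esum_(i in [set` finmap.enum_fset B]) (1%R : R)%:E) <= 1)%E.
    rewrite -esum_nat_cst ?mass_ge0//; apply: le_trans mal.
    rewrite nneseries_esumT; last by move=> i; rewrite lee_fin mass_ge0.
    apply: (@le_trans _ _ (\esum_(i in [set` finmap.enum_fset B]) (mass (al i))%:E)).
      by apply: le_esum => i /BA/fibre_sim/sim_mass; rewrite /mass => ->.
    rewrite esum_mkcond; apply: le_esum => i _; case: ifPn => // _.
    by rewrite lee_fin mass_ge0.
  rewrite esum_card// set_fsetK.
  rewrite -EFinM lee_fin; apply/negP; rewrite -ltNge.
  rewrite -ltr_pdivrMl// mulr1 (lt_le_trans (truncnS_gt _))//.
  by rewrite ler_nat.
pose m o := size (finmap.enum_fset (fset_set (fibre al o))).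
have ral : represents m al.
  by move=> o; rewrite esum_card.
have cm : countable [set o | m o != 0%N].
  have ex o : m o != 0%N -> exists i, fibre al o i.
    move=> mo; apply: contrapT => h; move: mo; rewrite /m.
    rewrite (_ : fibre al o = set0) ?fset_set0//.
    by apply/seteqP; split => // i io; apply: h; exists i.
  (* Choosing an index in each nonempty fibre is injective, since the index gives the orbit back. *)
  apply/countable_injP; exists (fun o => xget 0%N (fibre al o)) => o o'.
  rewrite !inE => /ex[i io] /ex[j jo] ij; apply/nzo_eqP.
  have [_ ->] : fibre al o (xget 0%N (fibre al o)) by apply: xgetI io.
  have [_ ->] : fibre al o' (xget 0%N (fibre al o')) by apply: xgetI jo.
  by rewrite ij.
have hm : (\esum_(o in [set: nzo]) ((m o)%:R%:E * Defs.repr o setT) <= 1)%E.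
  by rewrite (represents_mass ral).
by exists (MkXtilde cm hm).
Qed.

Lemma Xtilde_eq (xi xi' : Xtilde R d) : (forall o, xi o = xi' o) -> xi = xi'.
Proof.
case: xi => m cm hm; case: xi' => m' cm' hm' /= /funext mm'; subst m'.
by congr MkXtilde; exact: Prop_irrelevance.
Qed.

Lemma pint_mass0 k (f : fn k) (a : P) : (0 < k)%N -> test_function f ->
  a setT = 0%E -> pint f a = 0.
Proof.
move=> k0 tf a0; have [M hM] := test_bounded k0 tf.
have := norm_E_le (pw a k) (test_bm k0 tf) (fun t => hM (mxt t)).
rewrite mass_pw a0/= expr0n (gtn_eqF k0) mulr0 normr_le0 => /eqP; exact.
Qed.

(** The k-th power of the mass, at most 1, is traded for the mass itself, which is what can be
    summed over a [light] sequence. *)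
Lemma norm_pint_le k (f : fn k) (a : P) (M : R) : (0 < k)%N -> test_function f ->
  (forall x, `|f x| <= M) -> `|pint f a| <= M * mass a.
Proof.
move=> k0 tf hM; have M0 : 0 <= M by rewrite (le_trans _ (hM 0)).
rewrite (le_trans (norm_E_le (pw a k) (test_bm k0 tf) (fun t => hM (mxt t))))//.
rewrite ler_wpM2l// mass_pw -(prednK k0) exprS ler_piMr ?mass_ge0//.
by rewrite exprn_ile1 ?mass_ge0 ?mass_le1.
Qed.

Lemma pint_ge0 k (f : fn k) (a : P) : (forall x, 0 <= f x) -> 0 <= pint f a.
Proof. by move=> f0; apply: E_ge0. Qed.

Lemma represents_pint m al k (f : fn k) : (0 < k)%N -> test_function f ->
  (forall x, 0 <= f x) -> represents m al ->
  \esum_(o in [set: nzo]) ((m o)%:R%:E * (pint f (Defs.repr o))%:E)%E =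
  (\sum_(i <oo) (pint f (al i))%:E)%E.
Proof.
move=> k0 tf f0 ral; apply: represents_esum => //.
- by move=> a; exact: pint_ge0.
- by move=> a b; exact: pint_sim.
- by move=> a; exact: pint_mass0.
Qed.

Lemma pint_summable al k (f : fn k) : (0 < k)%N -> test_function f ->
  (forall x, 0 <= f x) -> light al ->
  (\sum_(i <oo) (pint f (al i))%:E)%E \is a fin_num.
Proof.
move=> k0 tf f0 mal; have [M hM] := test_bounded k0 tf.
have M0 : 0 <= M by rewrite (le_trans _ (hM 0)).
rewrite ge0_fin_numE; last by apply: nneseries_ge0 => i _; rewrite lee_fin pint_ge0.
apply: (@le_lt_trans _ _ (M%:E * \sum_(i <oo) (mass (al i))%:E)%E).
  rewrite -nneseriesZl; last by move=> i _; rewrite lee_fin mass_ge0.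
  apply: lee_nneseries => i _; first by rewrite lee_fin pint_ge0.
  rewrite -EFinM lee_fin (le_trans (ler_norm _))//; exact: norm_pint_le.
apply: (@le_lt_trans _ _ (M%:E * 1)%E); last by rewrite mule1 ltry.
by rewrite lee_wpmul2l// lee_fin.
Qed.

Lemma nneseries_series (u : nat -> R) : (forall i, 0 <= u i) ->
  (\sum_(i <oo) (u i)%:E)%E \is a fin_num ->
  series u @ \oo --> fine (\sum_(i <oo) (u i)%:E)%E.
Proof.
move=> u0 fu.
have : (fun n => \sum_(0 <= i < n) (u i)%:E)%E @ \oo --> (fine (\sum_(i <oo) (u i)%:E))%:E.
  by rewrite fineK//; apply: is_cvg_nneseries => i _; rewrite lee_fin.
by move/fine_cvg; under eq_fun do rewrite /= sumEFin/=.
Qed.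

(** The definition splits the integrals by sign, the proof splits the integrand: sums of nonnegative
    integrals can be regrouped along a representing sequence. *)
Lemma multiset_integral_series (xi : Xtilde R d) al k (f : fn k) :
  (0 < k)%N -> test_function f -> represents xi al ->
  light al ->
  series (fun i => pint f (al i)) @ \oo --> multiset_integral f xi.
Proof.
move=> k0 tf ral mal.
pose G (h : fn k) (o : nzo) : \bar R := ((xi o)%:R%:E * (pint h (Defs.repr o))%:E)%E.
have tp := test_fpos tf; have tn := test_fneg tf.
have fp := pint_summable k0 tp (@fpos_ge0 _ _) mal.
have fn := pint_summable k0 tn (@fneg_ge0 _ _) mal.
have Gp := represents_pint k0 tp (@fpos_ge0 _ _) ral.
have Gn := represents_pint k0 tn (@fneg_ge0 _ _) ral.
have G0 h o : (forall x, 0 <= h x) -> (0 <= G h o)%E.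
  by move=> h0; rewrite /G -EFinM lee_fin mulr_ge0// pint_ge0.
have sG h : (forall x, 0 <= h x) -> \esum_(o in [set: nzo]) G h o \is a fin_num ->
    summable [set: nzo] (G h).
  move=> h0; rewrite summableE => sh.
  by rewrite (eq_esum (b := G h))// => o _; rewrite gee0_abs// G0.
have -> : multiset_integral f xi = fine (\esum_(o in [set: nzo]) G (fpos f) o
    - \esum_(o in [set: nzo]) G (fneg f) o)%E.
  have sp : summable [set: nzo] (G (fpos f)) by apply: sG; [exact: fpos_ge0|rewrite Gp; exact: fp].
  have sn : summable [set: nzo] (G (fneg f)) by apply: sG; [exact: fneg_ge0|rewrite Gn; exact: fn].
  (* [esumB] exchanges the signed parts of the family of integrals for any other difference of
     summable nonnegative families. *)
  have := esumB sp sn (fun o _ => G0 _ o (@fpos_ge0 _ f)) (fun o _ => G0 _ o (@fneg_ge0 _ f)).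
  move=> <-; rewrite /multiset_integral.
  have gE : (fun o => (xi o)%:R%:E * power_integral f (Defs.repr o))%E =
      (fun o => G (fpos f) o - G (fneg f) o)%E.
    by apply/funext => o; rewrite power_integralE// pint_split// /G -!EFinM -EFinB mulrBr.
  by rewrite gE.
rewrite Gp Gn fineB; [|exact: fp|exact: fn].
have -> : series (fun i => pint f (al i)) =
  (fun n => series (fun i => pint (fpos f) (al i)) n - series (fun i => pint (fneg f) (al i)) n).
  apply/funext => n; rewrite /series/= -sumrB; apply: eq_bigr => i _; exact: pint_split.
apply: cvgB.
  by apply: nneseries_series; [move=> i; apply: pint_ge0; exact: fpos_ge0|exact: fp].
by apply: nneseries_series; [move=> i; apply: pint_ge0; exact: fneg_ge0|exact: fn].
Qed.

(** * Vague limits *)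

Section content_regularization.
(* Only finite additivity is available: nu will be a setwise limit of measures
   along an ultrafilter. *)
Variable nu : set T -> R.
Hypothesis nu_ge0 : forall A, 0 <= nu A.
Hypothesis nu_le1 : nu setT <= 1.
Hypothesis nu0 : nu set0 = 0.
Hypothesis nuD : forall A B, measurable A -> measurable B -> A `&` B = set0 ->
  nu (A `|` B) = nu A + nu B.

Lemma nu_mono A B : measurable A -> measurable B -> A `<=` B -> nu A <= nu B.
Proof.
move=> mA mB AB; rewrite -(setDUK AB) nuD ?lerDl//; first exact: measurableD.
by rewrite setDE setIC -setIA setICl setI0.
Qed.

Lemma nu_bigU n (F : nat -> set T) : (forall i, measurable (F i)) ->
  nu (\big[setU/set0]_(i < n) F i) <= \sum_(i < n) nu (F i).
Proof.
move=> mF; elim: n => [|n IH]; first by rewrite !big_ord0 nu0.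
rewrite !big_ord_recr/=; set A := \big[setU/set0]_(i < n) F i.
have mA : measurable A by apply: bigsetU_measurable.
have -> : A `|` F n = A `|` (F n `\` A).
  by apply/seteqP; split => x /=; have [|] := pselect (A x); tauto.
have mFA : measurable (F n `\` A) by exact: measurableD.
rewrite nuD//; last by apply/seteqP; split => // x [] ? [].
by apply: lerD => //; apply: nu_mono => //; exact: subDsetl.
Qed.

Definition open_cover (A : set V) : set (nat -> set V) :=
  [set F | (forall i, open (F i)) /\ A `<=` \bigcup_i F i].

Definition outer (A : set V) : \bar R :=
  ereal_inf [set (\sum_(i <oo) (nu (F i))%:E)%E | F in open_cover A].

Lemma outer_le (A : set V) F : open_cover A F -> (outer A <= \sum_(i <oo) (nu (F i))%:E)%E.
Proof. by move=> AF; apply: ereal_inf_lbound; exists F. Qed.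

Lemma series_nu_ge0 (F : nat -> set V) : (0 <= \sum_(i <oo) (nu (F i))%:E)%E.
Proof. by apply: nneseries_ge0 => *; rewrite lee_fin. Qed.

Lemma outer_ge0 A : (0 <= outer A)%E.
Proof. by apply: le_ereal_inf_tmp => _ [F _ <-]; exact: series_nu_ge0. Qed.

Lemma outer_open (O : set V) : open O -> (outer O <= (nu O)%:E)%E.
Proof.
move=> oO; pose F (i : nat) : set V := if i is 0%N then O else set0.
have OF : open_cover O F.
  by split; [case => //= n; exact: open0|move=> x Ox; exists 0%N].
apply: le_trans (outer_le OF) _.
rewrite (nneseries_split _ 1); last by move=> *; rewrite lee_fin.
by rewrite add0n big_nat1/= eseries0 ?adde0// => -[|i]//= _ _; rewrite nu0.
Qed.

Lemma outer0 : outer set0 = 0%E.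
Proof.
apply/eqP; rewrite eq_le outer_ge0 andbT; apply: le_trans (outer_open open0) _.
by rewrite nu0.
Qed.

Lemma outer_mono : {homo outer : A B / A `<=` B >-> (A <= B)%E}.
Proof.
move=> A B AB; apply: le_ereal_inf_tmp => _ [F [oF BF] <-].
by apply: outer_le; split => //; exact: subset_trans BF.
Qed.

Lemma outer_le1 A : (outer A <= 1)%E.
Proof.
apply: le_trans (outer_mono (@subsetT _ A)) _.
by apply: le_trans (outer_open openT) _; rewrite lee_fin.
Qed.

Lemma outer_fin A : outer A \is a fin_num.
Proof. by rewrite ge0_fin_numE ?outer_ge0// (le_lt_trans (outer_le1 A))// ltry. Qed.

Lemma outer_sigma_subadditive : sigma_subadditive outer.
Proof.
move=> A; apply/lee_addgt0Pr => e e0.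
have ex n : exists F, open_cover (A n) F /\
    (\sum_(i <oo) (nu (F i))%:E <= outer (A n) + (e / (2 ^ n.+1)%:R)%:E)%E.
  have e'0 : 0 < e / (2 ^ n.+1)%:R by rewrite divr_gt0// ltr0n expn_gt0.
  have [_ [F AF <-] /ltW] := lb_ereal_inf_adherent e'0 (outer_fin (A n)).
  by exists F.
pose F n := sval (cid (ex n)); have FP n := svalP (cid (ex n)).
have /card_set_bijP[p pb] : ([set: nat] #= [set: nat * nat])%card by rewrite card_eq_sym card_nat2.
have AF : open_cover (\bigcup_n A n) (fun m => F (p m).1 (p m).2).
  split=> [m|x [n _ Anx]]; first exact: (FP _).1.1.
  have [i _ Fx] := (FP n).1.2 x Anx.
  have [_ _ /(_ (n, i) I)[m _ pm]] := pb.
  by exists m => //; rewrite pm.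
apply: le_trans (outer_le AF) _.
apply: (@le_trans _ _ (\sum_(n <oo) (outer (A n) + (e / (2 ^ n.+1)%:R)%:E))%E); last first.
  by apply: epsilon_trick; [move=> *; exact: outer_ge0|exact: ltW].
rewrite nneseries_esumT; last by move=> *; rewrite lee_fin.
rewrite -(@reindex_esum _ _ _ setT setT p (fun q => (nu (F q.1 q.2))%:E))//.
rewrite (_ : setT = setT `*`` (fun=> setT)); last by apply/seteqP; split.
rewrite -(@esum_esum _ _ _ setT (fun=> setT) (fun n i => (nu (F n i))%:E)); last by move=> *; rewrite lee_fin.
rewrite nneseries_esumT; last first.
  by move=> n; rewrite adde_ge0 ?outer_ge0// lee_fin divr_ge0// ltW.
apply: le_esum => n _; rewrite -nneseries_esumT; last by move=> *; rewrite lee_fin.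
exact: (FP n).2.
Qed.

HB.instance Definition _ := isOuterMeasure.Build R V outer outer0 outer_ge0 outer_mono outer_sigma_subadditive.

Section depth.
Variable (W : set V).

(* The distance to the complement of W, capped at 1 so that it also makes
   sense for W = setT. *)
Definition depth (x : V) : R := inf ([set 1] `|` [set `|x - y| | y in ~` W]).

Lemma depth_has_inf x : has_inf ([set 1] `|` [set `|x - y| | y in ~` W]).
Proof.
split; first by exists 1; left.
by exists 0 => _ [->//|[y _ <-]].
Qed.

Lemma depth_ge0 x : 0 <= depth x.
Proof. by apply: lb_le_inf; [exists 1; left|move=> _ [->//|[y _ <-]]]. Qed.

Lemma depth_le_dist x y : ~ W y -> depth x <= `|x - y|.
Proof. by move=> Wy; apply: ge_inf; [exact: (depth_has_inf x).2|right; exists y]. Qed.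

Lemma depth_lip x y : `|depth x - depth y| <= 1 * `|x - y|.
Proof.
rewrite mul1r; have H a b : depth a <= depth b + `|a - b|.
  rewrite -lerBlDr; apply: lb_le_inf; first by exists 1; left.
  move=> _ [->|[z Wz <-]]; rewrite lerBlDr.
    apply: (@le_trans _ _ 1); last by rewrite lerDl.
    by apply: ge_inf; [exact: (depth_has_inf a).2|left].
  apply: le_trans (depth_le_dist a Wz) _.
  by rewrite [leRHS]addrC; exact: ler_distD.
by have := H x y; have := H y x; rewrite (distrC y x) ler_norml; lra.
Qed.

Lemma depth_cont : continuous depth.
Proof. exact: lipschitz_cont depth_lip. Qed.

Lemma depth_out x : ~ W x -> depth x = 0.
Proof.
move=> Wx; apply/eqP; rewrite eq_le depth_ge0 andbT.
by rewrite (le_trans (depth_le_dist x Wx))// subrr normr0.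
Qed.

Lemma depth_gt0 x : open W -> W x -> 0 < depth x.
Proof.
move=> oW Wx; have : nbhs x W by apply: open_nbhs_nbhs.
move=> /nbhs_ballP[e /= e0 eW].
apply: (@lt_le_trans _ _ (Num.min 1 e)); first by rewrite lt_min ltr01.
apply: lb_le_inf; first by exists 1; left.
move=> _ [->|[y Wy <-]]; first by rewrite ge_min lexx.
rewrite leNgt; apply/negP => h; apply: Wy; apply: eW.
by rewrite mx_norm_ball /ball_/=; rewrite lt_min in h; case/andP: h.
Qed.

Lemma open_depth_gt c : open [set x | c < depth x].
Proof. exact/open_gt_preimage/depth_cont. Qed.

Lemma open_depth_lt c : open [set x | depth x < c].
Proof. exact/open_lt_preimage/depth_cont. Qed.

End depth.

(* Besides an inner part, W is covered by the shells t_(j+2) < depth < t_j; a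
   point lies in at most two of them, so their nu-masses are summable and those
   close to the boundary are negligible. *)
Lemma outer_inner_approx (W : set V) (e : R) : open W -> 0 < e ->
  exists c : R, 0 < c /\ (outer W <= (nu [set x | (c < depth W x)%R])%:E + e%:E)%E.
Proof.
move=> oW e0; pose t (j : nat) : R := j.+1%:R^-1.
have t0 j : 0 < t j by rewrite invr_gt0.
have tS i j : (i <= j)%N -> t j <= t i by move=> ij; rewrite lef_pV2 ?posrE// ler_nat.
have tS' i j : (i < j)%N -> t j < t i by move=> ij; rewrite ltf_pV2 ?posrE// ltr_nat.
pose c j := nu [set x | t j < depth W x].
have mc j : measurable ([set x | t j < depth W x] : set T).
  by apply: open_Rvec; exact: open_depth_gt.
have cS i j : (i <= j)%N -> c i <= c j.
  by move=> ij; apply: nu_mono => //= x /=; apply: le_lt_trans; exact: tS.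
have c1 j : c j <= 1 by apply: le_trans nu_le1; apply: nu_mono.
have [m mP] : exists m, forall j, c j <= c m + e / 2.
  have hs : has_sup (range c) by split; [exists (c 0%N); exists 0%N|exists 1 => _ [j _ <-]].
  have e20 : 0 < e / 2 by rewrite divr_gt0.
  have [_ [m _ <-] hm] := sup_adherent e20 hs.
  exists m => j; rewrite -lerBlDr.
  apply: le_trans (ltW hm); rewrite lerD2r; apply: ub_le_sup; first exact: hs.2.
  by exists j.
pose S j := [set x | t j.+2 < depth W x] `&` [set x | depth W x < t j].
pose F (i : nat) : set V := if i is i'.+1 then S (m + i')%N else [set x | t m.+1 < depth W x].
exists (t m.+1); split => //.
have WF : open_cover W F.
  split=> [[|i]|x Wx] /=.
  - exact: open_depth_gt.
  - by apply: openI; [exact: open_depth_gt|exact: open_depth_lt].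
  - have [h|h] := ltP (t m.+1) (depth W x); first by exists 0%N.
    have [j jP] : exists j, t j.+1 < depth W x.
      have dx := depth_gt0 oW Wx.
      exists (Num.truncn (depth W x)^-1); rewrite /t invf_plt ?posrE//.
      by apply: lt_trans (truncnS_gt _) _; rewrite ltr_nat.
    have [j0 j0P jmin] := ex_minnP (ex_intro (fun j => t j.+1 < depth W x) j jP).
    have mj : (m < j0)%N.
      rewrite ltnNge; apply/negP => j0m.
      by move: (lt_le_trans j0P h); rewrite ltNge tS.
    have hj0 : depth W x <= t j0.
      rewrite leNgt; apply/negP => th; have := jmin j0.-1.
      by rewrite prednK ?(leq_ltn_trans _ mj)// => /(_ th); rewrite -ltnS prednK ?ltnn// (leq_ltn_trans _ mj).
    exists (j0.-1 - m).+1 => //=; rewrite subnKC; last by rewrite -ltnS prednK// (leq_ltn_trans _ mj).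
    have j00 : (0 < j0)%N by apply: leq_ltn_trans mj.
    split => /=; first by rewrite prednK.
    by apply: le_lt_trans hj0 _; apply: tS'; rewrite prednK.
apply: le_trans (outer_le WF) _.
rewrite (nneseries_split _ 1); last by move=> *; rewrite lee_fin.
rewrite add0n big_nat1/=; apply: leeD => //.
have SF j : nu (S j) <= c j.+2 - c j.
  rewrite lerBrDl -nuD//; last 2 first.
  - by apply: open_Rvec; apply: openI; [exact: open_depth_gt|exact: open_depth_lt].
  - by apply/seteqP; split => // y [/= h1 [_ /= h2]]; move: (lt_trans h1 h2); rewrite ltxx.
  apply: nu_mono => //.
    apply: measurableU => //; apply: open_Rvec; apply: openI; [exact: open_depth_gt|exact: open_depth_lt].
  by move=> y [/= h|[] //]; apply: le_lt_trans h; apply: tS; rewrite leqW.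
have bound N : \sum_(1 <= i < N) nu (F i) <= e.
  apply: (@le_trans _ _ (\sum_(0 <= i < N) (c (m + i).+2 - c (m + i)%N))).
    case: N => [|N]; first by rewrite !big_geq.
    rewrite big_add1/= [leRHS]big_nat_recr//=; apply: ler_wpDr; first by rewrite subr_ge0 cS// leqW// leqW.
    by apply: ler_sum => i _; exact: SF.
  (* Increments over two indices telescope to two differences, each at most [e / 2] by the choice of
     [m]. *)
  rewrite (_ : \sum_(0 <= i < N) _ = (c (m + N)%N - c m) + (c (m + N).+1 - c m.+1)).
    have := mP (m + N)%N; have := mP (m + N).+1; have := cS _ _ (leqnSn m); lra.
  elim: N => [|N IH]; first by rewrite big_geq// addn0; lra.
  by rewrite big_nat_recr//= IH !addnS; lra.
apply: lime_le.
  by apply: is_cvg_nneseries => *; rewrite lee_fin.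
by apply: nearW => N; rewrite sumEFin lee_fin.
Qed.

(** Inside an open [O], the points deep in [O] and [G] and those of smaller depth form disjoint open
    sets, where finite additivity of [nu] applies; almost no mass is lost between them. *)
Lemma outer_caratheodory_open (G : set V) : open G -> caratheodory_measurable outer G.
Proof.
move=> oG; apply: le_caratheodory_measurable => X.
have key (O : set V) : open O -> (outer (O `&` G) + outer (O `&` ~` G) <= (nu O)%:E)%E.
  move=> oO; apply/lee_addgt0Pr => e e0.
  have oW : open (O `&` G) by exact: openI.
  have [c [c0 hc]] := outer_inner_approx oW e0.
  pose A := [set x | c < depth (O `&` G) x].
  pose B := O `&` [set x | depth (O `&` G) x < c].
  have oA : open A by exact: open_depth_gt.
  have oB : open B by apply: openI => //; exact: open_depth_lt.
  have BO : (outer (O `&` ~` G) <= (nu B)%:E)%E.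
    apply: le_trans (outer_open oB); apply: outer_mono => x [Ox Gx]; split => //=.
    by rewrite depth_out// => -[].
  apply: (@le_trans _ _ ((nu A)%:E + e%:E + (nu B)%:E)%E); first by apply: leeD.
  rewrite addeAC leeD2r// -EFinD lee_fin -nuD; [|exact: open_Rvec|exact: open_Rvec|].
    apply: nu_mono; [|exact: open_Rvec|].
      by apply: open_Rvec; exact: openU.
    move=> x [/= h|[]//]; have [[]//|Wx] := pselect ((O `&` G) x).
    by move: h; rewrite /A/= depth_out// ltNge (ltW c0).
  by apply/seteqP; split => // x [/= h1 [_ /= h2]]; move: (lt_trans h1 h2); rewrite ltxx.
(* An arbitrary set is reduced to the open sets of a cover, each of which is cut by [key]. *)
apply: le_ereal_inf_tmp => _ [F [oF XF] <-].
apply: (@le_trans _ _ (\sum_(i <oo) outer (F i `&` G) + \sum_(i <oo) outer (F i `&` ~` G))%E).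
  apply: leeD.
    apply: le_trans (outer_sigma_subadditive _); apply: outer_mono.
    by rewrite -setI_bigcupl; exact: setSI.
  apply: le_trans (outer_sigma_subadditive _); apply: outer_mono.
  by rewrite -setI_bigcupl; exact: setSI.
rewrite -nneseriesD; [|by move=> *; exact: outer_ge0|by move=> *; exact: outer_ge0].
apply: lee_nneseries => i; first by move=> _ _; rewrite adde_ge0 ?outer_ge0.
by move=> _; exact: key.
Qed.

Lemma outer_caratheodory (A : set T) : measurable A -> caratheodory_measurable outer A.
Proof.
suff : (@open V).-sigma.-measurable `<=` (measurable : set (set (caratheodory_type outer))) by apply.
apply: smallest_sub; first exact: sigma_algebra_measurable.
exact: outer_caratheodory_open.
Qed.

(** A second name for [outer], on the Borel space, that carries the measure structure. *)
Definition regularization (A : set T) : \bar R := outer A.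

Let regularization0 : regularization set0 = 0%E. Proof. exact: outer0. Qed.

Let regularization_ge0 A : (0 <= regularization A)%E. Proof. exact: outer_ge0. Qed.

Let regularization_sigma_additive : semi_sigma_additive regularization.
Proof.
move=> F mF tF mUF.
have := @caratheodory_measure_sigma_additive R V outer F.
by apply => // [i|]; exact: outer_caratheodory.
Qed.

HB.instance Definition _ := isMeasure.Build _ _ _ regularization
  regularization0 regularization_ge0 regularization_sigma_additive.

Let regularization_setT : (regularization setT <= 1)%E. Proof. exact: outer_le1. Qed.

HB.instance Definition _ := Measure_isSubProbability.Build _ _ _ regularization regularization_setT.

(** Compactness makes the cover finite, where finite additivity of [nu] is enough. *)
Lemma outer_compact (K : set V) : compact K -> closed K -> ((nu K)%:E <= outer K)%E.
Proof.
move=> cK clK; apply: le_ereal_inf_tmp => _ [F [oF KF] <-].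
move: cK; rewrite compact_cover => /(_ _ setT F (fun i _ => oF i) KF)[D _ KD].
pose N := (\max_(i <- finmap.enum_fset D) i).+1.
have DN i : i \in finmap.enum_fset D -> (i < N)%N.
  by move=> iD; rewrite ltnS; exact: leq_bigmax_seq.
have mF i : measurable (F i : set T) by exact: open_Rvec.
apply: (@le_trans _ _ (\sum_(0 <= i < N) (nu (F i))%:E)%E); last first.
  by apply: nneseries_lim_ge => *; rewrite lee_fin.
rewrite sumEFin lee_fin big_mkord; apply: le_trans (nu_bigU _ _) => //.
apply: nu_mono; [exact: closed_Rvec|exact: bigsetU_measurable|].
move=> x /KD[i /= iD Fx]; rewrite -bigcup_mkord; exists i => //=; exact: DN.
Qed.

(** The two inequalities turn setwise limits into the bounds on closed and open sets that define
    [vague]; nothing else about [a] is kept. *)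
Lemma content_regularization : exists a : subprobability T R,
  (forall K : set V, compact K -> closed K -> nu K <= fine (a K)) /\
  (forall O : set V, open O -> fine (a O) <= nu O).
Proof.
exists regularization; split => [K cK clK|O oO].
  by rewrite -lee_fin fineK ?outer_fin//; exact: outer_compact.
by rewrite -lee_fin fineK ?outer_fin//; exact: outer_open.
Qed.

End content_regularization.

Definition bounded_in (A : set V) (r : R) := forall x, A x -> `|x| <= r.

(* Testing on bounded sets only allows mass to escape to infinity. *)
Definition vague (U : set_system nat) (nu : nat -> P) (a : P) :=
  (forall (K : set V) r e, closed K -> bounded_in K r -> 0 < e ->
     \forall n \near U, fine (nu n K) <= fine (a K) + e) /\
  (forall (O : set V) r e, open O -> bounded_in O r -> 0 < e ->
     \forall n \near U, fine (a O) - e <= fine (nu n O)).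

Lemma fine_mono (a : P) (A B : set T) : measurable A -> measurable B -> A `<=` B ->
  fine (a A) <= fine (a B).
Proof.
by move=> mA mB AB; apply: fine_le; rewrite ?fin_num_measure//; apply: le_measure; rewrite ?inE.
Qed.

Lemma fine_le1 (a : P) (A : set T) : measurable A -> fine (a A) <= 1.
Proof. by move=> mA; apply: le_trans (mass_le1 a); exact: fine_mono. Qed.

Lemma fine_measureU (a : P) (A B : set T) : measurable A -> measurable B -> A `&` B = set0 ->
  fine (a (A `|` B)) = fine (a A) + fine (a B).
Proof. by move=> mA mB AB; rewrite measureU// fineD// fin_num_measure. Qed.

Lemma vague_exists (U : set_system nat) (UU : UltraFilter U) (nu : nat -> P) :
  exists a, vague U nu a.
Proof.
(* Off the Borel sets the content takes the value 0, because [content_regularization] asks for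
   nonnegativity on all sets. *)
have ex (A : set T) : exists l : R, 0 <= l /\ (measurable A -> (fun n => fine (nu n A)) @ U --> l).
  have [mA|nA] := pselect (measurable A); last by exists 0.
  have [|l [_ cl]] := @ultra_bounded_cvg R nat U UU (fun n => fine (nu n A)) 1.
    by apply: nearW => n /=; rewrite ger0_norm ?fine_ge0// fine_le1.
  by exists l; split=> //; apply: (cvgr_to_ge cl); apply: nearW => n; exact: fine_ge0.
pose ul A := sval (cid (ex A)).
have ul_ge0 A : 0 <= ul A := (svalP (cid (ex A))).1.
have ul_cvg A : measurable A -> (fun n => fine (nu n A)) @ U --> ul A := (svalP (cid (ex A))).2.
have ulE A l : measurable A -> (fun n => fine (nu n A)) @ U --> l -> ul A = l.
  by move=> mA cl; apply: (cvg_unique _ (ul_cvg A mA) cl).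
have ul0 : ul set0 = 0.
  apply: ulE => //; rewrite (_ : (fun n => _) = cst 0); first exact: cvg_cst.
  by apply/funext => n; rewrite measure0.
have ul1 : ul setT <= 1.
  apply: (cvgr_to_le (ul_cvg _ measurableT)); apply: nearW => n; exact: mass_le1.
have ulD A B : measurable A -> measurable B -> A `&` B = set0 -> ul (A `|` B) = ul A + ul B.
  move=> mA mB AB; apply: ulE; first exact: measurableU.
  rewrite (_ : (fun n => _) = (fun n => fine (nu n A) + fine (nu n B))).
    by apply: cvgD; exact: ul_cvg.
  by apply/funext => n; exact: fine_measureU.
have [a [aK aO]] := content_regularization ul_ge0 ul1 ul0 ulD.
exists a; split=> [K r e cK bK e0|O r e oO _ e0].
  have compK : compact K.
    by apply: subclosed_compact (@mx_closed_ball_compact R 1 d r) _ => // x /bK.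
  apply: (cvgr_le _ (ul_cvg K (closed_Rvec cK))).
  by rewrite ltr_pwDr// aK.
apply: (cvgr_ge _ (ul_cvg O (open_Rvec oO))).
by rewrite ltrBlDr ltr_pwDr// aO.
Qed.

(** Together with [count_lt], applied to [N * phi x], this gives a discrete layer-cake formula. *)
Lemma count_le (N : nat) (z : R) : 0 <= z -> \sum_(i < N) (i.+1%:R <= z)%R%:R <= z.
Proof.
move=> z0; elim: N => [|N IH]; first by rewrite big_ord0.
have [h|h] := leP N.+1%:R z; last by rewrite big_ord_recr/= [N.+1%:R <= _]leNgt h addr0.
apply: le_trans h; rewrite -[N.+1 in leRHS]card_ord -sumr_const; apply: ler_sum => i _.
by rewrite -[leRHS]/(1%:R) ler_nat leq_b1.
Qed.

Lemma count_lt (N : nat) (z : R) : z <= N%:R -> z <= 1 + \sum_(i < N) (i.+1%:R < z)%R%:R.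
Proof.
elim: N => [|N IH] zN; first by rewrite big_ord0 addr0 (le_trans zN)// ler01.
have [h|h] := leP z N%:R.
  by rewrite (le_trans (IH h))// lerD2l big_ord_recr/= lerDl.
rewrite (le_trans zN)// -natr1 addrC lerD2l big_ord_recr/=.
rewrite (eq_bigr (fun=> 1)); first by rewrite sumr_const card_ord lerDl.
by move=> i _; rewrite (le_lt_trans _ h)// ler_nat.
Qed.

Lemma E_sum_indic (a : P) N (A : 'I_N -> set T) : (forall i, measurable (A i)) ->
  E a (fun x => \sum_(i < N) \1_(A i) x) = \sum_(i < N) fine (a (A i)).
Proof.
move=> mA; rewrite E_sum; last by move=> i _; exact: bm_indic.
by apply: eq_bigr => i _; rewrite E_indic.
Qed.

Lemma bm_sum_indic N (A : 'I_N -> set T) : (forall i, measurable (A i)) ->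
  bm (fun x => \sum_(i < N) (\1_(A i) x : R)).
Proof. by move=> mA; apply: bm_sum => i _; exact: bm_indic. Qed.

Definition superlevel (N : nat) (phi : T -> R) (i : nat) : set T := [set x | i.+1%:R <= N%:R * phi x].

Definition strict_superlevel (N : nat) (phi : T -> R) (i : nat) : set T :=
  [set x | i.+1%:R < N%:R * phi x].

Lemma E_layers_le (a : P) (phi : T -> R) (N : nat) : bm phi -> (forall x, 0 <= phi x) ->
  (forall i : 'I_N, measurable (superlevel N phi i)) ->
  \sum_(i < N) fine (a (superlevel N phi i)) <= N%:R * E a phi.
Proof.
move=> bphi phi0 mA; rewrite -E_sum_indic// -EZ//; apply: le_E; [exact: bm_sum_indic|exact: bmZ|].
move=> x; have := @count_le N (N%:R * phi x) (mulr_ge0 (ler0n _ _) (phi0 x)).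
by congr (_ <= _); apply: eq_bigr => i _; rewrite indicE; congr (_%:R); congr nat_of_bool; apply/idP/idP; rewrite inE.
Qed.

Lemma E_layers_lt (a : P) (phi : T -> R) (N : nat) : bm phi -> (forall x, phi x <= 1) ->
  (forall i : 'I_N, measurable (strict_superlevel N phi i)) ->
  N%:R * E a phi <= 1 + \sum_(i < N) fine (a (strict_superlevel N phi i)).
Proof.
move=> bphi phi1 mA; rewrite -E_sum_indic// -EZ//.
apply: (@le_trans _ _ (E a (fun x => 1 + \sum_(i < N) \1_(strict_superlevel N phi i) x))).
  apply: le_E; [exact: bmZ|by apply: bmD; [exact: bm_cst|exact: bm_sum_indic]|].
  move=> x; have : N%:R * phi x <= N%:R by rewrite ler_piMr.
  move/count_lt; congr (_ <= _ + _); apply: eq_bigr => i _.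
  by rewrite indicE; congr (_%:R); congr nat_of_bool; apply/idP/idP; rewrite inE.
rewrite ED; [|exact: bm_cst|exact: bm_sum_indic].
by rewrite E_cst mul1r lerD2r mass_le1.
Qed.

(** The integral is compared with the masses of [N] levels, closed ones for upper bounds and open
    ones for lower bounds; all levels are positive, so these sets stay in the bounded support of
    [phi]. *)
Lemma vague_E (U : set_system nat) (FU : ProperFilter U) nu a (phi : V -> R) r :
  vague U nu a -> continuous phi -> (forall x, 0 <= phi x <= 1) ->
  (forall x, phi x != 0 -> `|x| <= r) ->
  (fun n => E (nu n) (phi : T -> R)) @ U --> E a (phi : T -> R).
Proof.
move=> [vK vO] cphi phi01 supp.
have bphi : bm (phi : T -> R).
  split; first exact: continuous_Rvec_measurable.
  by exists 1 => x; have /andP[? ?] := phi01 x; rewrite ger0_norm.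
have phi0 x : 0 <= phi x by have /andP[] := phi01 x.
have phi1 x : phi x <= 1 by have /andP[] := phi01 x.
have cNphi (N : nat) : continuous (fun x => N%:R * phi x) by exact: contZ.
have clA N (i : 'I_N) : closed (superlevel N phi i).
  exact/closed_ge_preimage/cNphi.
have oA N (i : 'I_N) : open (strict_superlevel N phi i).
  exact/open_gt_preimage/cNphi.
have bA N (i : 'I_N) : bounded_in (superlevel N phi i) r.
  move=> x /= h; apply: supp; apply: contraTneq h => ->.
  by rewrite mulr0 -ltNge.
have bA' N (i : 'I_N) : bounded_in (strict_superlevel N phi i) r.
  by move=> x /ltW; exact: bA.
apply/cvgrPdist_le => /= e e0.
(* After scaling by [N], rounding to levels costs 1 and the [N] comparisons, each with error
   [1 / N], cost another 1. *)
pose N := (Num.truncn (2 / e)).+1.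
have N0 : 0 < (N%:R : R) by [].
have Ne : 2 <= N%:R * e.
  by rewrite -ler_pdivrMr// ltW// truncnS_gt.
have hK : \forall n \near U, forall i : 'I_N,
    fine (nu n (superlevel N phi i)) <= fine (a (superlevel N phi i)) + N%:R^-1.
  by apply: filter_forall => i; apply: (vK _ r); [exact: clA|exact: bA|rewrite invr_gt0].
have hO : \forall n \near U, forall i : 'I_N,
    fine (a (strict_superlevel N phi i)) - N%:R^-1 <= fine (nu n (strict_superlevel N phi i)).
  by apply: filter_forall => i; apply: (vO _ r); [exact: oA|exact: bA'|rewrite invr_gt0].
have mcl (i : 'I_N) : measurable (superlevel N phi i : set T) := closed_Rvec (clA N i).
have mop (i : 'I_N) : measurable (strict_superlevel N phi i : set T) := open_Rvec (oA N i).
have sumN : \sum_(i < N) (N%:R^-1 : R) = 1.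
  by rewrite sumr_const card_ord -(mulr_natl N%:R^-1) divff// gt_eqF.
have lelt (b : P) : \sum_(i < N) fine (b (strict_superlevel N phi i)) <=
    \sum_(i < N) fine (b (superlevel N phi i)).
  apply: ler_sum => i _; apply: fine_mono; [exact: mop|exact: mcl|by move=> x /ltW].
apply: filterS2 hK hO => n hK hO.
have U1 := E_layers_lt (nu n) bphi phi1 mop.
have U2 := lelt (nu n).
have U3 : \sum_(i < N) fine (nu n (superlevel N phi i)) <=
   \sum_(i < N) fine (a (superlevel N phi i)) + 1.
  by rewrite -[X in _ <= _ + X]sumN -big_split/=; apply: ler_sum => i _; exact: hK.
have U4 := E_layers_le a bphi phi0 mcl.
have L1 := E_layers_lt a bphi phi1 mop.
have L3 : \sum_(i < N) fine (a (strict_superlevel N phi i)) - 1 <=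
   \sum_(i < N) fine (nu n (strict_superlevel N phi i)).
  by rewrite -[X in _ - X <= _]sumN -sumrB; apply: ler_sum => i _; exact: hO.
have L4 := E_layers_le (nu n) bphi phi0 mcl.
have L2 := lelt (nu n).
have H1 : N%:R * (E a (phi : T -> R) - E (nu n) (phi : T -> R)) <= N%:R * e.
  by apply: le_trans Ne; rewrite mulrBr; lra.
have H2 : N%:R * (E (nu n) (phi : T -> R) - E a (phi : T -> R)) <= N%:R * e.
  by apply: le_trans Ne; rewrite mulrBr; lra.
rewrite ler_pM2l// in H1; rewrite ler_pM2l// in H2.
have : `|E a (phi : T -> R) - E (nu n) (phi : T -> R)| <= e by rewrite ler_norml; lra.
exact.
Qed.

Section interpolation.
Variable k : nat.
Notation M := (pts k).
Notation grid N := 'M['I_(2 * N).+1]_(k, d).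

Lemma compact_support_unif_cont (g : M -> R) (r : R) : continuous g ->
  (forall x, g x != 0 -> `|x| <= r) -> forall e : R, 0 < e ->
  exists m : nat, forall x y : M, `|x - y| <= m.+1%:R^-1 -> `|g x - g y| <= e.
Proof.
move=> cg supp e e0; pose K := [set x : M | `|x| <= r].
have e20 : 0 < e / 2 by rewrite divr_gt0.
have /compact_near_coveringP : compact K by exact: mx_closed_ball_compact.
move=> /(_ nat \oo (fun m x => forall y : M, `|x - y| <= m.+1%:R^-1 -> `|g x - g y| <= e) _)[].
  move=> x Kx.
  have := cg x; move/(@cvgrPdist_lt _ _ _ (nbhs x)) => /(_ _ e20)/nbhs_ballP[t /= t0 ht].
  have t20 : 0 < t / 2 by rewrite divr_gt0.
  exists (ball (x : M) (t / 2), [set m : nat | m.+1%:R^-1 < t / 2]).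
    split; first exact: nbhsx_ballx.
    exact: near_infty_natSinv_lt (PosNum t20).
  move=> [x' m] [/= xx' mt] y xy.
  rewrite mx_norm_ball /ball_/= in xx'.
  have h1 : `|g x - g x'| < e / 2.
    by apply: ht; rewrite mx_norm_ball /ball_/=; lra.
  have h2 : `|g x - g y| < e / 2.
    apply: ht; rewrite mx_norm_ball /ball_/=.
    by rewrite (le_lt_trans (ler_distD x' _ _))// [ltRHS](splitr t) ltrD// (le_lt_trans xy).
  by rewrite (le_trans (ler_distD (g x) _ _))// [leRHS](splitr e) lerD// ?ltW// distrC.
move=> m _ /(_ m (leqnn m)) hm; exists m => x y xy.
(* The covering argument needs its first point in the support, whence the exchange of [x] and
   [y]. *)
have [gx|/supp xr] := eqVneq (g x) 0; last exact: hm.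
have [gy|/supp yr] := eqVneq (g y) 0; first by rewrite gx gy subrr normr0 ltW.
by rewrite distrC; apply: hm => //; rewrite distrC.
Qed.

Definition node (m N : nat) (c : grid N) : M :=
  \matrix_(i, j) (((c i j)%:R - N%:R) / m.+1%:R).

Definition hat (m N : nat) (c : grid N) (i : 'I_k) (v : 'rV[R]_d) : R :=
  \prod_(j < d) tent (m.+1%:R * v ord0 j - ((c i j)%:R - N%:R)).

(** Multilinear interpolation on a grid of mesh [1 / (m + 1)]. Each term is a product of functions
    of single points, so its power integral is a product of ordinary integrals. *)
Definition interp (m N : nat) (g : M -> R) (x : M) : R :=
  \sum_(c : grid N) g (node m c) * \prod_(i < k) hat m c i (row i x).

Lemma hat_ge0 m N (c : grid N) i v : 0 <= hat m c i v.
Proof. by apply: prodr_ge0 => j _; exact: tent_ge0. Qed.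

Lemma sum_hat (m N : nat) (x : M) :
  \sum_(c : grid N) \prod_(i < k) hat m c i (row i x) =
  \prod_(p : 'I_k * 'I_d) \sum_(z < (2 * N).+1) tent (m.+1%:R * x p.1 p.2 - (z%:R - N%:R)).
Proof.
rewrite bigA_distr_bigA/= (reindex (fun f : {ffun 'I_k * 'I_d -> 'I_(2 * N).+1} => \matrix_(i, j) f (i, j)))/=; last first.
  exists (fun c : (grid N) => [ffun p => c p.1 p.2]) => f _.
    by apply/ffunP => -[i j]; rewrite ffunE mxE.
  by apply/matrixP => i j; rewrite mxE ffunE.
apply: eq_bigr => f _.
transitivity (\prod_(i < k) \prod_(j < d) tent (m.+1%:R * x i j - ((f (i, j))%:R - N%:R))).
  by apply: eq_bigr => i _; apply: eq_bigr => j _; rewrite !mxE.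
by rewrite pair_bigA/=; apply: eq_bigr => -[i j] _.
Qed.

Lemma prod_hat_neq0 (m N : nat) (c : grid N) (x : M) :
  \prod_(i < k) hat m c i (row i x) != 0 -> `|x - node m c| <= m.+1%:R^-1.
Proof.
move=> h; apply/mx_norm_leP; first by rewrite invr_ge0.
move=> i j; rewrite !mxE.
have hi : hat m c i (row i x) != 0 by apply: contraNneq h => hi; rewrite (bigD1 i)//= hi mul0r.
have : tent (m.+1%:R * (row i x) ord0 j - ((c i j)%:R - N%:R)) != 0.
  by apply: contraNneq hi => hj; rewrite /hat (bigD1 j)//= hj mul0r.
rewrite mxE => /tent_neq0/ltW.
have -> : x i j - ((c i j)%:R - N%:R) / m.+1%:R =
  m.+1%:R^-1 * (m.+1%:R * x i j - ((c i j)%:R - N%:R))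
    by rewrite mulrBr mulKf ?pnatr_eq0// [_ / _]mulrC.
by rewrite normrM ger0_norm ?invr_ge0// => h1; rewrite ler_piMr ?invr_ge0.
Qed.

Lemma interp_dist (g : M -> R) (m N : nat) (r e : R) :
  (forall x, g x != 0 -> `|x| <= r) -> r * m.+1%:R <= N%:R -> 0 <= e ->
  (forall x y : M, `|x - y| <= m.+1%:R^-1 -> `|g x - g y| <= e) ->
  forall x, `|g x - interp m N g x| <= e.
Proof.
move=> supp rN e0 ug x.
have S1 : \sum_(c : grid N) \prod_(i < k) hat m c i (row i x) <= 1.
  rewrite sum_hat; apply: prodr_ile1 => p _; rewrite sum_tent_le1 andbT.
  by apply: sumr_ge0 => z _; exact: tent_ge0.
have -> : g x = \sum_(c : grid N) g x * \prod_(i < k) hat m c i (row i x).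
  have [->|gx] := eqVneq (g x) 0; first by rewrite big1// => c _; rewrite mul0r.
  rewrite -mulr_sumr sum_hat big1 ?mulr1// => p _; apply: sum_tent_eq1.
  rewrite normrM ger0_norm// mulrC; apply: le_trans rN; rewrite ler_pM2r//.
  by apply: le_trans (supp _ gx); exact: mx_entry_le.
rewrite /interp -sumrB; apply: le_trans (ler_norm_sum _ _ _) _.
apply: (@le_trans _ _ (\sum_(c : grid N) e * \prod_(i < k) hat m c i (row i x))); last first.
  by rewrite -mulr_sumr ler_piMr.
apply: ler_sum => c _; rewrite -mulrBl normrM.
have h0 : 0 <= \prod_(i < k) hat m c i (row i x) by apply: prodr_ge0 => i _; exact: hat_ge0.
rewrite (ger0_norm h0); have [->|h] := eqVneq (\prod_(i < k) hat m c i (row i x)) 0.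
  by rewrite !mulr0.
by rewrite ler_wpM2r// ug//; exact: prod_hat_neq0.
Qed.

Lemma hat_cont m N (c : grid N) i : continuous (hat m c i).
Proof.
apply: (continuous_big (@mul_continuous R)) => j _; apply: (@lipschitz_cont _ _ _ _ m.+1%:R) => x y.
apply: le_trans (tent_lip _ _) _.
rewrite (_ : _ - _ = m.+1%:R * (x - y) ord0 j); last by rewrite !mxE; ring.
by rewrite normrM ger0_norm// ler_wpM2l// mx_entry_le.
Qed.

End interpolation.

Lemma vague_pw (U : set_system nat) (FU : ProperFilter U) (nu : nat -> P) (a : P) k
    (g : fn k) r :
  vague U nu a -> continuous g -> (forall x, g x != 0 -> `|x| <= r) ->
  (fun n => pint g (nu n)) @ U --> pint g a.
Proof.
move=> va cg supp.
have bg : bm (fun t : k.-tuple T => g (mxt t)).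
  split; first exact: continuous_mx_measurable.
  have [M hM] := continuous_compact_bounded (@mx_closed_ball_compact R k d r) cg.
  exists `|M| => t; have [->|h] := eqVneq (g (mxt t)) 0; first by rewrite normr0.
  by rewrite (le_trans (hM _ (supp _ h)))// ler_norm.
apply/cvgrPdist_le => /= e e0.
have e30 : 0 < e / 3 by rewrite divr_gt0.
have [m hm] := compact_support_unif_cont cg supp e30.
(* Along each coordinate the nodes run from [- N / (m + 1)] to [N / (m + 1)] and so cover the
   support. *)
pose N := (Num.truncn (r * m.+1%:R)).+1.
have rN : r * m.+1%:R <= N%:R by rewrite ltW// truncnS_gt.
have dist := interp_dist supp rN (ltW e30) hm.
have bhat (c : 'M['I_(2 * N).+1]_(k, d)) i : bm (hat m c i : T -> R).
  split; first by apply: continuous_Rvec_measurable; exact: hat_cont.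
  exists 1 => v; rewrite ger0_norm ?hat_ge0// prodr_ile1// => j _.
  by rewrite tent_ge0 tent_le1.
have rowE (c : 'M['I_(2 * N).+1]_(k, d)) (t : k.-tuple T) i :
    hat m c i (row i (mxt t)) = hat m c i (tnth t i).
  by congr hat; apply/rowP => j; rewrite !mxE.
have pE (b : P) : pint (interp m N g) b =
    \sum_(c : 'M['I_(2 * N).+1]_(k, d)) g (node m c) * \prod_(i < k) E b (hat m c i).
  rewrite /pint /interp E_sum.
    apply: eq_bigr => c _; rewrite EZ.
      by rewrite -E_pw_prod//; congr (_ * E _ _); apply/funext => t; apply: eq_bigr => i _.
    by apply: bm_prod => i _; under eq_fun do rewrite rowE; apply: bm_tnth.
  move=> c _; apply: bmZ; apply: bm_prod => i _.
  by under eq_fun do rewrite rowE; apply: bm_tnth.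
have bi : bm (fun t : k.-tuple T => interp m N g (mxt t)).
  apply: bm_sum => c _; apply: bmZ; apply: bm_prod => i _.
  by under eq_fun do rewrite rowE; apply: bm_tnth.
have near_b (b : P) : `|pint g b - pint (interp m N g) b| <= e / 3.
  rewrite /pint -EB//; apply: norm_E_le1; first exact: bmB.
  by move=> t; exact: dist.
have : (fun n => pint (interp m N g) (nu n)) @ U --> pint (interp m N g) a.
  rewrite pE; under eq_fun do rewrite pE.
  apply: (cvg_big add_continuous) => c _; apply: cvgM; first exact: cvg_cst.
  apply: (cvg_big (@mul_continuous R)) => i _.
  apply: (@vague_E _ FU nu a (hat m c i) (N%:R + 1) va) => [|x|x].
  - exact: hat_cont.
  - rewrite hat_ge0/= prodr_ile1// => j _; by rewrite tent_ge0 tent_le1.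
  - move=> h; apply/mx_norm_leP => [|i0 j]; first exact: addr_ge0.
    rewrite ord1.
    have : tent (m.+1%:R * x ord0 j - ((c i j)%:R - N%:R)) != 0.
      by apply: contraNneq h => hj; rewrite /hat (bigD1 j)//= hj mul0r.
    move=> /tent_neq0.
    have c0 : 0 <= ((c i j)%:R : R) by [].
    have c2 : ((c i j)%:R : R) <= N%:R + N%:R.
      by rewrite -natrD ler_nat addnn -mul2n -ltnS.
    rewrite ltr_norml => /andP[h1 h2].
    have h3 : `|m.+1%:R * x ord0 j| <= N%:R + 1 by rewrite ler_norml; lra.
    apply: le_trans h3; rewrite normrM ger0_norm// ler_peMl// ler1n//.
move/cvgrPdist_le => /(_ _ e30); apply: filterS => n /= h.
have := near_b a; have := near_b (nu n).
have -> : pint g a - pint g (nu n) = (pint g a - pint (interp m N g) a)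
  + (pint (interp m N g) a - pint (interp m N g) (nu n))
  - (pint g (nu n) - pint (interp m N g) (nu n)) by lra.
move=> h1 h2; rewrite (le_trans (ler_normB _ _))//.
rewrite (le_trans (lerD (ler_normD _ _) (lexx _)))//.
have -> : e = e / 3 + e / 3 + e / 3 by lra.
by rewrite !lerD.
Qed.

(** * Concentration and convergence *)

Definition cball (v : V) (C : R) : set V := [set x | `|x - v| <= C].

Lemma dist_cont (v : V) : continuous (fun x : V => `|x - v|).
Proof.
apply: (@lipschitz_cont _ _ _ _ 1) => x y; rewrite mul1r.
apply: le_trans (ler_dist_dist _ _) _.
by rewrite opprB addrA subrK.
Qed.

Lemma closed_cball v C : closed (cball v C).
Proof. exact/closed_le_preimage/dist_cont. Qed.

Lemma open_far v C : open [set x : V | C < `|x - v|].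
Proof. exact/open_gt_preimage/dist_cont. Qed.

Lemma mcball v C : measurable (cball v C : set T).
Proof. by apply: closed_Rvec; exact: closed_cball. Qed.

Definition oball (v : V) (r : R) : set V := [set x | `|x - v| < r].

Lemma open_oball v r : open (oball v r).
Proof. exact/open_lt_preimage/dist_cont. Qed.

Lemma moball v r : measurable (oball v r : set T).
Proof. by apply: open_Rvec; exact: open_oball. Qed.

Definition exterior (r : R) : set V := [set x | r <= `|x|].

Lemma closed_exterior r : closed (exterior r).
Proof.
by apply: closed_ge_preimage; have := @dist_cont 0; under eq_fun do rewrite subr0.
Qed.

Lemma exteriorS r r' : r <= r' -> exterior r' `<=` exterior r.
Proof. by move=> rr' x; exact: le_trans. Qed.

Lemma mexterior r : measurable (exterior r : set T).
Proof. by apply: closed_Rvec; exact: closed_exterior. Qed.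

#[local] Hint Resolve mcball moball mexterior : core.

Lemma tail_mass (a : P) (e : R) : 0 < e -> exists r : R, fine (a (exterior r)) <= e.
Proof.
move=> e0; pose h (n : nat) (x : T) : R := \1_(exterior n%:R : set T) x.
have hcvg : (fun n => E a (h n)) @ \oo --> E a (fun=> 0).
  apply: (@E_dct _ _ _ a _ _ 1) => [n|n x|x].
  - exact: bm_indic.
  - by rewrite /h indicE ger0_norm// -[leRHS]/(1%:R) ler_nat leq_b1.
  - apply: cvg_near_cst; near=> n; rewrite /h indicE memNset//= => /le_lt_trans.
    move=> /(_ n%:R); rewrite ltxx => H; suff : false by []; apply: H.
    by near: n; exact: nbhs_infty_gtr.
have E0 : E a (fun=> 0 : R) = 0 by rewrite E_cst mul0r.
rewrite E0 in hcvg.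
have := @cvgr_le _ _ _ _ _ _ hcvg e e0; move=> [n _ /(_ n (leqnn n))] /=.
by rewrite /h E_indic// => hn; exists n%:R.
Unshelve. all: by end_near. Qed.

Definition cutoff (rho : R) (v : V) : R := clamp (rho + 1 - `|v|).

Lemma cutoff_ge0 rho v : 0 <= cutoff rho v. Proof. by case/andP: (clamp_01 (rho + 1 - `|v|)). Qed.

Lemma cutoff_le1 rho v : cutoff rho v <= 1. Proof. by case/andP: (clamp_01 (rho + 1 - `|v|)). Qed.

Lemma cutoff_eq1 rho v : `|v| <= rho -> cutoff rho v = 1.
Proof. by move=> h; apply: clamp_id1; lra. Qed.

Lemma cutoff_neq0 rho v : cutoff rho v != 0 -> `|v| <= rho + 1.
Proof. by apply: contraNT; rewrite -ltNge => h; apply/eqP/clamp_id0; lra. Qed.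

Lemma cutoff_lip rho u v : `|cutoff rho u - cutoff rho v| <= 1 * `|u - v|.
Proof.
rewrite mul1r (le_trans (clamp_lip _ _))// opprB addrC addrA subrK distrC.
exact: ler_dist_dist.
Qed.

Section cut.
Variables (k : nat) (k0 : (0 < k)%N) (f : fn k) (tf : test_function f).

Definition mxadd (x : pts k) (s : V) : pts k := \matrix_(i < k) (row i x + s).

Lemma row_mxadd x s i : row i (mxadd x s) = row i x + s.
Proof. by apply/rowP => j; rewrite !mxE. Qed.

Definition window (rho : R) (x : pts k) : R := \prod_(i < k) cutoff rho (row i x).

(** A test function does not decay under common translations, whereas [vague_pw] needs bounded
    support. *)
Definition cut (rho : R) (x : pts k) : R := f x * window rho x.

Lemma window_ge0 rho x : 0 <= window rho x.
Proof. by apply: prodr_ge0 => i _; exact: cutoff_ge0. Qed.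

Lemma window_le1 rho x : window rho x <= 1.
Proof. by apply: prodr_ile1 => i _; rewrite cutoff_ge0 cutoff_le1. Qed.

Lemma window_neq0 rho x i : window rho x != 0 -> `|row i x| <= rho + 1.
Proof.
move=> h; apply: cutoff_neq0; apply: contraNneq h => hi.
by rewrite /window (bigD1 i)//= hi mul0r.
Qed.

Lemma window_eq1 rho x : (forall i, `|row i x| <= rho) -> window rho x = 1.
Proof. by move=> h; apply: big1 => i _; exact: cutoff_eq1. Qed.

Lemma row_lip (x y : pts k) i : `|row i x - row i y| <= `|x - y|.
Proof.
apply/mx_norm_leP => // i0 j; have := mx_entry_le (x - y) i j.
by rewrite !mxE.
Qed.

Lemma row_diff_lip (x y : pts k) i j :
  `|row i x - row j x - (row i y - row j y)| <= 2 * `|x - y|.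
Proof.
have -> : row i x - row j x - (row i y - row j y) = (row i x - row i y) - (row j x - row j y).
  by apply/rowP => l; rewrite !mxE; ring.
by rewrite (le_trans (ler_normB _ _))// mulr_natl mulr2n lerD// row_lip.
Qed.

Lemma window_cont rho : continuous (window rho).
Proof.
apply: (continuous_big (@mul_continuous R)) => i _; apply: (@lipschitz_cont _ _ _ _ 1) => x y.
by apply: le_trans (cutoff_lip _ _ _) _; rewrite !mul1r row_lip.
Qed.

Lemma cut_cont rho : continuous (cut rho).
Proof. by apply: contM; [case: tf|exact: window_cont]. Qed.

Lemma cut_supp rho x : cut rho x != 0 -> `|x| <= rho + 1.
Proof.
move=> h; have w : window rho x != 0 by apply: contraNneq h => w; rewrite /cut w mulr0.
have wi := window_neq0 _ w.
apply/mx_norm_leP; first by rewrite (le_trans _ (wi (Ordinal k0))).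
move=> i j; apply: le_trans (wi i); apply: le_trans (mx_entry_le _ ord0 j).
by rewrite mxE.
Qed.

Lemma bm_cut rho : bm (fun t : k.-tuple T => cut rho (mxt t)).
Proof.
split; first by apply: continuous_mx_measurable; exact: cut_cont.
have [M hM] := test_bounded k0 tf; exists M => t.
rewrite /cut normrM (le_trans _ (hM (mxt t)))// ler_piMr//.
by rewrite ger0_norm ?window_ge0// window_le1.
Qed.

Lemma pint_cut_cvg (a : P) : (fun n : nat => pint (cut n%:R) a) @ \oo --> pint f a.
Proof.
have [M hM] := test_bounded k0 tf.
apply: (@E_dct _ _ _ (pw a k) _ _ M) => [n|n t|t].
- exact: bm_cut.
- rewrite /cut normrM (le_trans _ (hM (mxt t)))// ler_piMr//.
  by rewrite ger0_norm ?window_ge0// window_le1.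
- apply: cvg_near_cst; near=> n; rewrite /cut window_eq1 ?mulr1// => i.
  apply: (@le_trans _ _ `|mxt t|).
    apply/mx_norm_leP => // i0 j; have := mx_entry_le (mxt t) i j.
    by rewrite !mxE.
  by near: n; exact: nbhs_infty_ger.
Unshelve. all: by end_near. Qed.

(** By invariance [f] ignores the translation and only the window moves; the cut integrals in all
    frames thus become integrals against one measure. *)
Lemma pint_cut_shift rho (b : P) s :
  pint (cut rho) (shift b s) = E (pw b k) (fun t => f (mxt t) * window rho (mxadd (mxt t) s)).
Proof.
rewrite /pint (@E_pw_image b (shift b s) (trans s))//.
- by congr E; apply/funext => t; rewrite mxt_trans /cut; have [_ -> _] := tf.
- exact: measurable_trans.
- by move=> g bg; exact: E_shift.
- exact: bm_cut.
Qed.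

End cut.

Lemma near_pairwise_far {U : set_system nat} {UU : UltraFilter U} m (p : pred nat) (b : nat -> nat -> V) (C : R) :
  (forall i j, p i -> p j -> i != j -> \forall n \near U, C < `|b i n - b j n|) ->
  \forall n \near U, forall i j : 'I_m, p i -> p j -> i != j -> C < `|b i n - b j n|.
Proof.
move=> h; have : \forall n \near U, forall ij : 'I_m * 'I_m,
    [&& p ij.1, p ij.2 & ij.1 != ij.2] -> C < `|b ij.1 n - b ij.2 n|.
  by apply: filter_forall_if => -[i j] /= /and3P[]; exact: h.
by apply: filterS => n hn i j pi pj ij; apply: (hn (i, j)); rewrite /= pi pj.
Qed.

Section core.
Lemma fine_shift_le (b : P) (s : V) (A B : set T) : measurable A -> measurable B ->
  (forall x : V, A x -> B (x + s)) -> fine (b A) <= fine (shift b s B).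
Proof.
move=> mA mB AB; rewrite shiftE; apply: fine_mono => //.
exact: mtrans_preimage.
Qed.

(** Two points are enough to watch: a configuration on which [f] is not small has all its points
    close together. *)
Definition close_pair k (C : R) : set (k.+2.-tuple T) :=
  [set t | `|(tnth t (lift ord0 ord0) : V) - (tnth t ord0 : V)| <= C].
Arguments close_pair : clear implicits.

Lemma measurable_close_pair k (C : R) : measurable (close_pair k C).
Proof.
have c : continuous (fun x : pts k.+2 => `|row (lift ord0 ord0) x - row ord0 x|).
  apply: (@lipschitz_cont _ _ _ _ 2) => x y; apply: le_trans (ler_dist_dist _ _) _.
  exact: row_diff_lip.
have := continuous_mx_measurable c.
move=> /(_ measurableT [set y : R | y <= C]).
rewrite setTI (_ : _ @^-1` _ = close_pair k C).
  by apply; rewrite (_ : mkset _ = `]-oo, C]%classic)//; apply/seteqP; split => y /=; rewrite in_itv.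
have rowE (t : k.+2.-tuple T) i : row i (mxt t) = tnth t i by apply/rowP => j; rewrite !mxE.
by apply/seteqP; split => t; rewrite /close_pair/= !rowE.
Qed.

(** Once the first point is fixed in [S], the second must fall in a ball of mass at most [dl]; the
    other points contribute a factor at most 1. *)
Lemma close_pair_le (b : P) k (S : set T) (C dl : R) : measurable S -> 0 <= dl ->
  (forall v, S v -> fine (b (cball v C)) <= dl) ->
  E (pw b k.+2) (fun t => \1_S (tnth t ord0) *
    \1_(close_pair k C) t) <= dl.
Proof.
move=> mS dl0 hS.
set A := close_pair k C; have mA : measurable A by exact: measurable_close_pair.
have bF : bm (fun t : k.+2.-tuple T => \1_S (tnth t ord0) * \1_A t : R).
  by apply: bmM; [apply: (bm_tnth ord0 (bm_indic mS))|exact: bm_indic].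
rewrite E_pwS//; apply: le_trans (ler_norm _) _; apply: norm_E_le1; first exact: (bm_Econs b bF).
move=> u; rewrite ger0_norm; last by apply: E_ge0 => t; rewrite mulr_ge0// indicE.
have [Su|nSu] := pselect (S u); last first.
  rewrite (_ : (fun t => _) = fun=> 0) ?E_cst ?mul0r//.
  by apply/funext => t; rewrite tnth0 [X in X * _]indicE memNset// mul0r.
apply: le_trans (hS u Su).
rewrite -E_indic//.
have -> : (fun t : k.+1.-tuple T => \1_S (tnth [tuple of u :: t] ord0) * \1_A [tuple of u :: t]) =
    (fun t => \1_(cball u C : set T) (tnth t ord0)) :> (_ -> R).
  apply/funext => t; rewrite tnth0 [X in X * _]indicE mem_set// mul1r !indicE.
  congr (_%:R); congr nat_of_bool; apply/idP/idP => /set_mem h; apply/mem_set; move: h.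
    by rewrite /A /close_pair/= tnthS tnth0.
  by rewrite /A /close_pair/= tnthS tnth0.
rewrite E_pwS; last by apply: (bm_tnth ord0 (bm_indic (mcball u C))).
have bB : bm (\1_(cball u C : set T) : T -> R) by exact: bm_indic.
apply: le_E => // [|v].
  exact: (bm_Econs b (bm_tnth ord0 bB)).
rewrite (_ : (fun t => _) = fun=> \1_(cball u C : set T) v); last by apply/funext => t; rewrite tnth0.
by rewrite E_cst ler_piMr ?mass_le1// indicE.
Qed.

Variables (U : set_system nat) (UU : UltraFilter U).
Variables (mu : nat -> P) (al : nat -> P) (pos : nat -> nat -> V).
Let nz i := al i setT != 0%E.
(* pos i n is where the piece al i sits inside mu n; it is meaningless when
   al i = 0. *)
Hypothesis Hvague : forall i, nz i -> vague U (fun n => shift (mu n) (- pos i n)) (al i).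
Hypothesis Hsep : forall i j, nz i -> nz j -> i != j ->
  forall C : R, \forall n \near U, C < `|pos i n - pos j n|.
Hypothesis Hdust : forall b : nat -> V,
  (forall i, nz i -> forall C : R, \forall n \near U, C < `|b n - pos i n|) ->
  forall C e : R, 0 < e -> \forall n \near U, fine (mu n (cball (b n) C)) <= e.
Hypothesis Hmass : light al.

Lemma mass_tail (e : R) : 0 < e -> exists m, forall N, \sum_(m <= i < N) mass (al i) <= e.
Proof.
move=> e0; have m0 i : 0 <= mass (al i) by exact: mass_ge0.
have := nneseries_series m0 (mass_fin_num Hmass); set L := fine _ => cL.
have [m _ hm] := @cvgr_ge _ _ _ _ _ _ cL (L - e) (ltac:(by rewrite ltrBlDr ltrDl)).
exists m => N; have [mN|/ltnW Nm] := leqP m N; last by rewrite big_geq// ltW.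
have h1 : series (fun i => mass (al i)) N <= L.
  have <- : limn (series (fun i => mass (al i))) = L by apply: cvg_lim.
  apply: nondecreasing_cvgn_le; last by apply/cvg_ex; exists L.
  exact: nondecreasing_series.
have := hm m (leqnn m) => /= h2.
by move: h1; rewrite /series/= (big_cat_nat (leq0n m) mN)/=; rewrite /series/= in h2; lra.
Qed.

(** [Hdust] speaks of one sequence of centres, here the bound is uniform in [v]: a failure would
    provide a sequence of bad centres. One [e] bounds the mass of the limit, the other the vague
    error. *)
Lemma sparse_outside (C e r : R) (m : nat) : 0 < e ->
  (forall i, (i < m)%N -> fine (al i (exterior r)) <= e) ->
  (forall i, (m <= i)%N -> mass (al i) <= e) ->
  \forall n \near U, forall v : V,
    (forall i, (i < m)%N -> nz i -> r + C < `|v - pos i n|) -> fine (mu n (cball v C)) <= 2 * e.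
Proof.
move=> e0 hr hm; apply: contrapT => /ultra_not bad.
pose far n (v : V) := forall i, (i < m)%N -> nz i -> r + C < `|v - pos i n|.
have ex n : exists v : V, (~ forall v : V, far n v -> fine (mu n (cball v C)) <= 2 * e) ->
    far n v /\ 2 * e < fine (mu n (cball v C)).
  have [h|/existsNP[v /not_implyP[fv /negP]]] := pselect (forall v : V, far n v -> fine (mu n (cball v C)) <= 2 * e).
    by exists 0 => /(_ h).
  by rewrite -ltNge => hv; exists v.
pose b n := sval (cid (ex n)).
have bP : \forall n \near U, far n (b n) /\ 2 * e < fine (mu n (cball (b n) C)).
  by apply: filterS bad => n; exact: (svalP (cid (ex n))).
have nodust : ~ (\forall n \near U, fine (mu n (cball (b n) C)) <= 2 * e).
  move=> h; have [n [h1 [_ h2]]] := @filter_ex _ U _ _ (@filterI _ U _ _ _ h bP).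
  by move: (le_lt_trans h1 h2); rewrite ltxx.
(* By [Hdust] the bad centres cannot drift away from all pieces; along an ultrafilter, failing to
   drift away from one means staying at bounded distance from it. *)
have [i [nzi [M hM]]] : exists i, nz i /\ exists M : R, \forall n \near U, `|b n - pos i n| <= M.
  apply: contrapT => h; apply: nodust; apply: Hdust; last by rewrite mulr_gt0.
  move=> i nzi M; apply: contrapT => /ultra_not hM; apply: h; exists i; split => //; exists M.
  by apply: filterS hM => n /negP; rewrite -leNgt.
have [vK _] := Hvague nzi.
(* Seen from [pos i], the bad ball lies in [K]. For [i < m] it is out in the tail of [al i]; for
   larger [i] the whole of [al i] is small. *)
pose K : set V := if (i < m)%N then exterior r `&` cball 0 (M + C) else cball 0 (M + C).
have cK : closed K.
  rewrite /K; case: ifP => _; last exact: closed_cball.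
  by apply: closedI; [exact: closed_exterior|exact: closed_cball].
have bK : bounded_in K (M + C).
  by move=> x; rewrite /K; case: ifP => _ [] //; rewrite /cball/= subr0.
have Ke : fine (al i K) <= e.
  have [im|mi] := ltnP i m.
    apply: le_trans (hr i im); apply: fine_mono => //; first exact: closed_Rvec.
    by move=> x; rewrite /K im => -[].
  by apply: le_trans (hm i mi); apply: fine_mono => //; exact: closed_Rvec.
apply: nodust; have := vK K _ _ cK bK e0.
apply: filterS3 bP hM => n [fb _] Mb hK.
apply: (@le_trans _ _ (fine (shift (mu n) (- pos i n) K))); last by lra.
apply: fine_shift_le => [//||x xb]; first exact: closed_Rvec.
have h1 : `|x - pos i n - 0| <= M + C.
  by rewrite subr0 [leRHS]addrC (le_trans (ler_distD (b n) _ _))// lerD.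
rewrite /K; case: ifP => // im; split => //=.
have := fb i im nzi; rewrite /exterior/=.
have := ler_distD x (b n) (pos i n); rewrite (distrC (b n) x); move: xb; rewrite /cball/=; lra.
Qed.

(** The support of [cutoff r] has radius at most [r + 1], so windows of different pieces cannot both
    be nonzero. *)
Definition separated m (r : R) n :=
  forall i j : 'I_m, nz i -> nz j -> i != j -> 2 * (r + 1) < `|pos i n - pos j n|.

Section pointwise.
Variables (k : nat) (C rho : R) (m : nat).

Definition windows n (x : pts k) : R :=
  \sum_(i < m | nz i) window rho (mxadd x (- pos i n)).

Lemma windows_unique n x (i0 : 'I_m) : (0 < k)%N ->
  separated m rho n ->
  nz i0 -> window rho (mxadd x (- pos i0 n)) != 0 ->
  windows n x = window rho (mxadd x (- pos i0 n)).
Proof.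
move=> k0 sep nz0 w0; rewrite /windows (bigD1 i0)//= big1 ?addr0// => i /andP[nzi ii0].
apply/eqP; apply: contraTT (sep i i0 nzi nz0 ii0) => wi.
have := window_neq0 (Ordinal k0) wi; have := window_neq0 (Ordinal k0) w0.
rewrite !row_mxadd -leNgt => h1 h2.
have := ler_distD (row (Ordinal k0) x) (pos i n) (pos i0 n).
rewrite (distrC (pos i n) (row _ x)); lra.
Qed.

Lemma windows_01 n x : (0 < k)%N ->
  separated m rho n ->
  0 <= windows n x <= 1.
Proof.
move=> k0 sep.
have [[i0 [nz0 w0]]|h] := pselect (exists i0 : 'I_m, nz i0 /\ window rho (mxadd x (- pos i0 n)) != 0).
  by rewrite (windows_unique k0 sep nz0 w0) window_ge0 window_le1.
rewrite /windows big1 ?lexx ?ler01// => i nzi.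
by apply/eqP; apply: contrapT => wi; apply: h; exists i; split => //; apply/negP.
Qed.

(** When the first point is not in this set and the others are within [C] of it, all points are
    within [rho] of one position, where the window is 1. *)
Definition outside n : set T :=
  [set v : T | forall i : 'I_m, nz i -> rho - C < `|(v : V) - pos i n|].

End pointwise.

Lemma measurable_outside (C rho : R) m n : measurable (outside C rho m n).
Proof.
rewrite (_ : outside C rho m n = \bigcap_(i in [set i : 'I_m | nz i])
    ([set v : V | rho - C < `|v - pos i n|] : set T)).
  by apply: fin_bigcap_measurable => // i _; apply: open_Rvec; exact: open_far.
by apply/seteqP; split => v /= h i; [move=> nzi; exact: h|exact: h].
Qed.

(** A large spread makes [f] small. Otherwise either some window is 1 and there is no error, or the
    first point is outside with the second close to it, which the indicators record. *)
Lemma windows_approx k (f : fn k.+2) (B C rho e : R) m n x :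
  (forall x, `|f x| <= B) -> (forall x, C <= spread x -> `|f x| <= e) -> 0 <= B -> 0 <= e ->
  separated m rho n ->
  `|f x - f x * windows rho m n x| <=
    e + B * (\1_(outside C rho m n) (row ord0 x : T) *
             (`|row (lift ord0 ord0) x - row ord0 x| <= C)%R%:R).
Proof.
move=> fB fC B0 e0 sep.
have k0 : (0 < k.+2)%N by [].
have /andP[w0 w1] := windows_01 x k0 sep.
have fw : `|f x - f x * windows rho m n x| <= `|f x|.
  rewrite -[X in `|X - _|]mulr1 -mulrBr normrM ler_piMr// ger0_norm ?subr_ge0//.
  by rewrite lerBlDr lerDl.
have rhs0 : 0 <= B * (\1_(outside C rho m n) (row ord0 x : T) *
             (`|row (lift ord0 ord0) x - row ord0 x| <= C)%R%:R) by rewrite mulr_ge0// mulr_ge0// indicE.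
have [Cx|xC] := leP C (spread x).
  by rewrite (le_trans fw)// (le_trans (fC x Cx))// lerDl.
have dC i j : `|row i x - row j x| <= C by rewrite (le_trans (spread_ge _ _ _))// ltW.
have [h|h] := pselect (outside C rho m n (row ord0 x)).
  rewrite indicE mem_set// mul1r dC mulr1 (le_trans fw)// (le_trans (fB x))//.
  by rewrite lerDr.
move: h => /existsNP[i /not_implyP[nzi /negP]]; rewrite -leNgt => hi.
have wi : window rho (mxadd x (- pos i n)) = 1.
  apply: window_eq1 => j; rewrite row_mxadd.
  have := ler_distD (row ord0 x) (row j x) (pos i n); have := dC j ord0; lra.
rewrite (windows_unique k0 sep nzi); last by rewrite wi oner_neq0.
by rewrite wi mulr1 subrr normr0 addr_ge0.
Qed.

Lemma small_mass (e : R) : 0 < e -> exists m, forall i, (m <= i)%N -> mass (al i) <= e.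
Proof.
move=> e0; have [m hm] := mass_tail e0; exists m => i mi.
apply: le_trans (hm i.+1); rewrite big_nat_recr//= lerDr.
by apply: sumr_ge0 => j _; exact: mass_ge0.
Qed.

Lemma uniform_tail_mass (m : nat) (e : R) : 0 < e ->
  exists r : R, forall i, (i < m)%N -> fine (al i (exterior r)) <= e.
Proof.
move=> e0; elim: m => [|m [r hr]]; first by exists 0.
have [r' hr'] := tail_mass (al m) e0.
exists (Num.max r r') => i; rewrite ltnS leq_eqVlt => /orP[/eqP ->|im].
  by apply: le_trans hr'; apply: fine_mono => //; apply: exteriorS; rewrite le_max lexx orbT.
by apply: le_trans (hr i im); apply: fine_mono => //; apply: exteriorS; rewrite le_max lexx.
Qed.

Lemma windows_error k (f : fn k.+2) (B C rho e : R) m n :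
  test_function f ->
  (forall x, `|f x| <= B) -> (forall x, C <= spread x -> `|f x| <= e) -> 0 <= B -> 0 <= e ->
  separated m rho n ->
  (forall v, outside C rho m n v -> fine (mu n (cball v C)) <= 2 * e) ->
  `|pint f (mu n) - \sum_(i < m | nz i) pint (cut f rho) (shift (mu n) (- pos i n))| <=
    e + B * (2 * e).
Proof.
move=> tf fB fC B0 e0 sep sparse.
have k0 : (0 < k.+2)%N by [].
have bf := test_bm k0 tf.
have bw (i : 'I_m) : bm (fun t : k.+2.-tuple T => f (mxt t) * window rho (mxadd (mxt t) (- pos i n))).
  split; last first.
    exists B => t; rewrite normrM (le_trans _ (fB (mxt t)))// ler_piMr//.
    by rewrite ger0_norm ?window_ge0// window_le1.
  apply: measurable_funM; first by case: bf.
  apply: (@continuous_mx_measurable _ (fun x => window rho (mxadd x (- pos i n)))).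
  apply: cont_comp; last exact: window_cont.
  move=> x; apply: continuous_mx_entrywise => i0 j.
  apply: (@lipschitz_cont _ _ _ _ 1) => y z; rewrite !mxE mul1r.
  by rewrite opprD addrACA subrr addr0; have := mx_entry_le (y - z) i0 j; rewrite !mxE.
have -> : \sum_(i < m | nz i) pint (cut f rho) (shift (mu n) (- pos i n)) =
    E (pw (mu n) k.+2) (fun t => f (mxt t) * windows rho m n (mxt t)).
  under [in RHS]eq_fun do rewrite /windows mulr_sumr.
  rewrite E_sum; last by move=> i _; exact: bw.
  by apply: eq_bigr => i _; rewrite pint_cut_shift.
have bfw : bm (fun t : k.+2.-tuple T => f (mxt t) * windows rho m n (mxt t)).
  by under eq_fun do rewrite /windows mulr_sumr; apply: bm_sum => i _; exact: bw.
have bd := bmB bf bfw.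
rewrite /pint -EB//; apply: le_trans (norm_E _ bd) _.
set S := outside C rho m n; have mS : measurable S by exact: measurable_outside.
pose H (t : k.+2.-tuple T) : R := \1_S (tnth t ord0) *
    \1_(close_pair k C) t.
have bH : bm H.
  apply: bmM; first exact: (bm_tnth ord0 (bm_indic mS)).
  by apply: bm_indic; exact: measurable_close_pair.
have H2 := close_pair_le k mS (mulr_ge0 (ler0n _ 2) e0) sparse.
apply: (@le_trans _ _ (E (pw (mu n) k.+2) (fun t => e + B * H t))).
  apply: le_E; [exact: bm_norm|by apply: bmD; [exact: bm_cst|exact: bmZ]|move=> t].
  apply: le_trans (@windows_approx k f B C rho e m n (mxt t) fB fC B0 e0 sep) _.
  rewrite lerD2l ler_wpM2l//.
  have rowE i : row i (mxt t) = tnth t i by apply/rowP => j; rewrite !mxE.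
  rewrite /H !rowE; rewrite ler_wpM2l ?indicE//.
  case: (boolP (_ <= C)) => h; last by [].
  by rewrite mem_set.
rewrite ED; [|exact: bm_cst|exact: bmZ].
rewrite EZ// E_cst; apply: lerD; first by rewrite ler_piMr ?mass_le1.
by rewrite ler_wpM2l//; exact: H2.
Qed.

Theorem core_cvg k (f : fn k.+2) (L : R) : test_function f ->
  series (fun i => pint f (al i)) @ \oo --> L -> (fun n => pint f (mu n)) @ U --> L.
Proof.
move=> tf cL; have k0 : (0 < k.+2)%N by [].
have [B0 hB0] := test_bounded k0 tf.
pose B := `|B0| + 1; have Bgt : 0 < B by rewrite ltr_wpDl.
have fB x : `|f x| <= B by rewrite (le_trans (hB0 x))// (le_trans (ler_norm _))// lerDl.
apply/cvgrPdist_le => /= e' e'0.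
(* [windows_error] costs [e + 2 B e]; the vague limit, the removal of the cutoffs and the tail of
   the series cost [e] each. *)
pose e := e' / (4 + 2 * B).
have D0 : 0 < 4 + 2 * B by rewrite addr_gt0// mulr_gt0.
have e0 : 0 < e by rewrite divr_gt0.
have [C hC] : exists C : R, forall x, C <= spread x -> `|f x| <= e.
  by have [_ _ /(_ e e0)[C hC]] := tf; exists C => x /hC/ltW.
have [m1 hm1] := small_mass e0.
move/cvgrPdist_le : (cL) => /(_ e e0)[m2 _ hm2].
pose m := maxn m1 m2.
have hm i : (m <= i)%N -> mass (al i) <= e by move=> mi; apply: hm1; rewrite (leq_trans _ mi)// leq_maxl.
have hL : `|L - series (fun i => pint f (al i)) m| <= e by apply: hm2; rewrite /= leq_maxr.
have [r hr] := uniform_tail_mass m e0.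
have em0 : 0 < e / m.+1%:R by rewrite divr_gt0.
have : \forall N \near \oo, forall i : 'I_m, `|pint f (al i) - pint (cut f N%:R) (al i)| <= e / m.+1%:R.
  apply: filter_forall => i; have := @pint_cut_cvg _ k0 f tf (al i).
  by move/cvgrPdist_le => /(_ _ em0).
(* With [rho >= r + 2 C], the points of [outside] are far enough, [rho - C >= r + C], for
   [sparse_outside]. *)
move=> /(filterI (nbhs_infty_ger (r + 2 * C)))/filter_ex[N [/= rN hN]].
set rho : R := N%:R.
have near1 := sparse_outside C e0 hr hm.
have near2 : \forall n \near U, separated m rho n.
  by apply: near_pairwise_far => i j nzi nzj ij; exact: Hsep.
have near3 : \forall n \near U, forall i : 'I_m, nz i ->
    `|pint (cut f rho) (al i) - pint (cut f rho) (shift (mu n) (- pos i n))| <= e / m.+1%:R.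
  apply: filter_forall_if => i nzi.
  have := @vague_pw _ _ _ _ _ (cut f rho) (rho + 1) (Hvague nzi) (@cut_cont _ f tf rho) (@cut_supp _ k0 f rho).
  by move=> /(_ _)/cvgrPdist_le/(_ _ em0).
apply: filterS3 near1 near2 near3 => n h1 h2 h3.
have sparse v : outside C rho m n v -> fine (mu n (cball v C)) <= 2 * e.
  move=> hv; apply: h1 => i im nzi; apply: (@le_lt_trans _ _ (rho - C)); first by rewrite /rho; lra.
  exact: (hv (Ordinal im)).
have W := windows_error tf fB hC (ltW Bgt) (ltW e0) h2 sparse.
set S1 := \sum_(i < m | nz i) pint (cut f rho) (shift (mu n) (- pos i n)) in W.
have split_sum (F : nat -> R) : (forall i, ~~ nz i -> F i = 0) ->
    \sum_(i < m | nz i) F i = \sum_(i < m) F i.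
  by move=> F0; rewrite [LHS]big_mkcond; apply: eq_bigr => i _; case: ifPn => // /F0.
have sum_em : \sum_(i < m) (e / m.+1%:R) <= e.
  by rewrite sumr_const card_ord -[X in X <= _]mulr_natr -mulrA ler_piMr ?(ltW e0)// mulrC ler_pdivrMr// mul1r ler_nat.
have W2 : `|S1 - \sum_(i < m | nz i) pint (cut f rho) (al i)| <= e.
  rewrite /S1 -sumrB; apply: le_trans (ler_norm_sum _ _ _) _.
  apply: le_trans sum_em; rewrite big_mkcond; apply: ler_sum => i _.
  by case: ifPn => nzi; [rewrite distrC h3|rewrite ltW].
have W3 : `|\sum_(i < m | nz i) pint (cut f rho) (al i) - series (fun i => pint f (al i)) m| <= e.
  rewrite /series/= big_mkord -(split_sum (fun i => pint f (al i))); last first.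
    by move=> i; rewrite negbK => /eqP h; exact: pint_mass0.
  rewrite -sumrB; apply: le_trans (ler_norm_sum _ _ _) _.
  apply: le_trans sum_em; rewrite big_mkcond; apply: ler_sum => i _.
  by case: ifPn => nzi; [rewrite distrC hN|rewrite ltW].
have e'E : e' = (e + B * (2 * e)) + e + e + e by rewrite /e; field; rewrite gt_eqF.
set X := pint f (mu n) in W *; set S2 := \sum_(i < m | nz i) pint (cut f rho) (al i) in W2 W3 *.
set S3 := series _ m in W3 hL.
have -> : L - X = (S1 - X) + (S2 - S1) + (S3 - S2) + (L - S3) by lra.
rewrite e'E (le_trans (ler_normD _ _))// lerD//.
rewrite (le_trans (ler_normD _ _))// lerD//; last by rewrite distrC.
rewrite (le_trans (ler_normD _ _))// lerD// distrC//.
Qed.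

End core.

(** * Decomposition of a sequence of measures along an ultrafilter *)

Section galaxies.
Variables (U : set_system nat) (UU : UltraFilter U) (mu : nat -> P).

(** What remains of [mu n] in the limit for an observer moving with [b]. *)
Definition galaxy (b : nat -> V) : P :=
  sval (cid (vague_exists UU (fun n => shift (mu n) (- b n)))).

Lemma galaxyP b : vague U (fun n => shift (mu n) (- b n)) (galaxy b).
Proof. exact: svalP (cid (vague_exists UU (fun n => shift (mu n) (- b n)))). Qed.

Lemma galaxy_cball b r e : 0 < e ->
  \forall n \near U, fine (shift (mu n) (- b n) (cball 0 r)) <= fine (galaxy b (cball 0 r)) + e.
Proof.
have [vK _] := galaxyP b; apply: (vK _ r); first exact: closed_cball.
by move=> x; rewrite /cball/= subr0.
Qed.

Lemma galaxy_oball b r e : 0 < e ->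
  \forall n \near U, fine (galaxy b (oball 0 r)) - e <= fine (shift (mu n) (- b n) (oball 0 r)).
Proof.
have [_ vO] := galaxyP b; apply: (vO _ r); first exact: open_oball.
by move=> x; rewrite /oball/= subr0 => /ltW.
Qed.

Definition near_seq (b c : nat -> V) := exists M : R, \forall n \near U, `|b n - c n| <= M.

Lemma near_seq_refl b : near_seq b b.
Proof. by exists 0; apply: nearW => n; rewrite subrr normr0. Qed.

Lemma near_seq_sym b c : near_seq b c -> near_seq c b.
Proof. by move=> [M hM]; exists M; apply: filterS hM => n; rewrite distrC. Qed.

Lemma near_seq_trans b c e : near_seq b c -> near_seq c e -> near_seq b e.
Proof.
move=> [M hM] [N hN]; exists (M + N); apply: filterS2 hM hN => n h1 h2.
by rewrite (le_trans (ler_distD (c n) _ _))// lerD.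
Qed.

Lemma not_near_seq b c (C : R) : ~ near_seq b c -> \forall n \near U, C < `|b n - c n|.
Proof.
move=> h; apply: contrapT => /ultra_not hC; apply: h; exists C.
by apply: filterS hC => n /negP; rewrite -leNgt.
Qed.

Lemma mass_split (a : P) (r : R) : mass a = fine (a (oball 0 r)) + fine (a (exterior r)).
Proof.
rewrite -fine_measureU//; first congr (fine (a _)).
  by apply/seteqP; split => // x _; have [h|h] := ltP `|(x : V)| r; [left; rewrite /oball/= subr0|right].
by apply/seteqP; split => // x []; rewrite /oball/= subr0 => h /(lt_le_trans h); rewrite ltxx.
Qed.

Lemma mass_oball (a : P) (e : R) : 0 < e -> exists r : R, mass a <= fine (a (oball 0 r)) + e.
Proof. by move=> /(tail_mass a)[r hr]; exists r; rewrite (mass_split a r) lerD2l. Qed.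

Lemma uniform_mass_oball (N : nat) (F : nat -> P) (e : R) : 0 < e ->
  exists r : R, forall i, (i < N)%N -> mass (F i) <= fine (F i (oball 0 r)) + e.
Proof.
move=> /(uniform_tail_mass F N)[r hr]; exists r => i iN.
by rewrite (mass_split _ r) lerD2l hr.
Qed.

Lemma sum_disjoint_le1 (a : P) N (A : 'I_N -> set T) (p : pred 'I_N) :
  (forall i, measurable (A i)) ->
  (forall i j x, p i -> p j -> A i x -> A j x -> i = j) ->
  \sum_(i < N | p i) fine (a (A i)) <= 1.
Proof.
move=> mA dA.
rewrite (eq_bigr (fun i => E a (\1_(A i)))); last by move=> i _; rewrite E_indic.
rewrite -E_sum; last by move=> i _; exact: bm_indic.
have b : bm (fun x => \sum_(i < N | p i) (\1_(A i) x : R)) by apply: bm_sum => i _; exact: bm_indic.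
apply: le_trans (ler_norm _) _; apply: norm_E_le1 => // x.
rewrite ger0_norm; last by apply: sumr_ge0 => i _; rewrite indicE.
have [[i0 [p0 A0]]|h] := pselect (exists i, p i /\ A i x).
  rewrite (bigD1 i0)//= big1 ?addr0 ?indicE ?mem_set// => i /andP[pi ii0].
  rewrite indicE memNset// => Ai; move/negP : ii0; apply; apply/eqP; exact: (dA _ _ x).
rewrite big1 ?ler01// => i pi; rewrite indicE memNset// => Ai.
by apply: h; exists i.
Qed.

Lemma trans_opp_oball (v x : V) r : oball 0 r (x - v) <-> oball v r x.
Proof. by rewrite /oball/= subr0. Qed.

(** Balls of one fixed radius hold nearly all of each galaxy and become disjoint along [U], so their
    masses add up inside a single [mu n]. Each galaxy loses a share of [e] twice, by truncation and
    by passing to [mu n]. *)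
Lemma galaxy_masses N (c : nat -> nat -> V) (p : pred nat) :
  (forall i j, p i -> p j -> i != j -> ~ near_seq (c i) (c j)) ->
  \sum_(i < N | p i) mass (galaxy (c i)) <= 1.
Proof.
move=> sep; apply/ler_addgt0Pr => e e0.
have e'0 : 0 < e / (2 * N.+1%:R) by rewrite divr_gt0.
set e' := e / _ in e'0.
have [r hr] := uniform_mass_oball N (fun i => galaxy (c i)) e'0.
have near1 : \forall n \near U, forall i : 'I_N,
    fine (galaxy (c i) (oball 0 r)) - e' <= fine (mu n (oball (c i n) r)).
  apply: filter_forall => i; apply: filterS (galaxy_oball (c i) r e'0) => n h.
  apply: le_trans h _; rewrite shiftE; apply: fine_mono => //; first exact: mtrans_preimage.
  by move=> x /=; rewrite /trans => /trans_opp_oball.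
have near2 : \forall n \near U, forall i j : 'I_N, p i -> p j -> i != j -> 2 * r < `|c i n - c j n|.
  by apply: near_pairwise_far => i j pi pj ij; exact/not_near_seq/sep.
have [n [h1 h2]] : exists n, (forall i : 'I_N,
    fine (galaxy (c i) (oball 0 r)) - e' <= fine (mu n (oball (c i n) r))) /\
    (forall i j : 'I_N, p i -> p j -> i != j -> 2 * r < `|c i n - c j n|).
  by apply: (@filter_ex _ U); exact: (@filterI _ U _ _ _ near1 near2).
have := @sum_disjoint_le1 (mu n) N (fun i => oball (c i n) r) (fun i => p i) (fun i => @moball _ _).
move=> /(_ _)/le_trans H.
apply: (@le_trans _ _ (\sum_(i < N | p i) (fine (mu n (oball (c i n) r)) + 2 * e'))).
  by apply: ler_sum => i _; have := hr i (ltn_ord i); have := h1 i; lra.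
rewrite big_split/=; apply: lerD.
  apply: H => // i j x pi pj; rewrite /oball/= => xi xj; apply/eqP; apply: contraT => ij.
  have := h2 i j pi pj ij; have := ler_distD x (c i n) (c j n); rewrite (distrC (c i n) x); lra.
apply: (@le_trans _ _ (\sum_(i < N) 2 * e')).
  by rewrite big_mkcond; apply: ler_sum => i _; case: ifPn => // _; rewrite mulr_ge0// ltW.
rewrite sumr_const card_ord -[X in X <= _]mulr_natr /e'.
have -> : 2 * (e / (2 * N.+1%:R)) = e / N.+1%:R by field; rewrite gt_eqF.
by rewrite mulrAC ler_pdivrMr// ler_wpM2l ?ler_nat// ltW.
Qed.

(** A ball around [b n] lies in a ball around [c n] with radius larger by the bound on their
    distance. *)
Lemma near_seq_mass_le b c : near_seq b c -> mass (galaxy b) <= mass (galaxy c).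
Proof.
move=> [M hM]; apply/ler_addgt0Pr => e e0.
have e3 : 0 < e / 3 by rewrite divr_gt0.
have [r hr] := mass_oball (galaxy b) e3.
have nO := galaxy_oball b r e3; have nK := galaxy_cball c (r + M) e3.
have [n [[h1 h2] h3]] : exists n, (`|b n - c n| <= M /\
    fine (galaxy b (oball 0 r)) - e / 3 <= fine (shift (mu n) (- b n) (oball 0 r))) /\
    fine (shift (mu n) (- c n) (cball 0 (r + M))) <= fine (galaxy c (cball 0 (r + M))) + e / 3.
  apply: (@filter_ex _ U); apply: (@filterI _ U) => //.
  exact: (@filterI _ U _ _ _ hM nO).
have h4 : fine (galaxy c (cball 0 (r + M))) <= mass (galaxy c) by exact: fine_mono.
have h5 : fine (shift (mu n) (- b n) (oball 0 r)) <= fine (shift (mu n) (- c n) (cball 0 (r + M))).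
  rewrite !shiftE; apply: fine_mono; [exact: mtrans_preimage|exact: mtrans_preimage|].
  move=> x; rewrite /trans/= /oball /cball/= !subr0 => /ltW h.
  by rewrite (le_trans (ler_distD (b n) _ _))// lerD.
have := hr; lra.
Qed.

(* xget picks the same element from equal sets, whence rep_eq. *)
Definition rep (b : nat -> V) : nat -> V := xget (fun=> 0) [set c | near_seq b c].

Lemma near_rep b : near_seq b (rep b).
Proof. by rewrite /rep; case: xgetP => [c _|/(_ b)]//; case; exact: near_seq_refl. Qed.

Lemma rep_eq b c : near_seq b c -> rep b = rep c.
Proof.
move=> bc; rewrite /rep; congr xget; apply/seteqP; split => e /=.
  by apply: near_seq_trans; exact: near_seq_sym.
exact: near_seq_trans.
Qed.

(** The equation [rep b = b] keeps one frame from each class of frames at bounded distance. *)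
Definition centres : set (nat -> V) := [set b | rep b = b /\ mass (galaxy b) != 0].

Lemma centres_sep b c : centres b -> centres c -> b != c -> ~ near_seq b c.
Proof. by move=> [rb _] [rc _] /negP bc /rep_eq; rewrite rb rc => h; apply: bc; rewrite h. Qed.

(** For each [p], having [p + 2] centres of mass at least [1 / (p + 1)] would exceed the total mass
    1. *)
Lemma countable_centres : countable centres.
Proof.
pose I p := [set b | centres b /\ p.+1%:R^-1 <= mass (galaxy b)].
have -> : centres = \bigcup_p I p.
  apply/seteqP; split => b; last by move=> [p _ []].
  move=> cb; have [_ mb] := cb.
  have m0 : 0 < mass (galaxy b) by rewrite lt_neqAle eq_sym mb mass_ge0.
  exists (Num.truncn (mass (galaxy b))^-1) => //; split => //.
  by rewrite invf_ple ?posrE// ltW// truncnS_gt.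
apply: bigcup_countable => // p _; apply: finite_set_countable; apply: contrapT => /infinite_set_fset.
move=> /(_ p.+2)[B BI Bp]; set s := finmap.enum_fset B in BI Bp.
have us : uniq s by exact: finmap.fset_uniq.
have sI i : (i < size s)%N -> I p (nth (fun=> 0) s i) by move=> iS; apply: BI; exact: mem_nth.
have := @galaxy_masses (size s) (nth (fun=> 0) s) (fun i => i < size s)%N.
move=> /(_ _)/le_trans H.
have : p.+2%:R * p.+1%:R^-1 <= 1 :> R.
  apply: (@le_trans _ _ (\sum_(i < size s) p.+1%:R^-1)).
    by rewrite sumr_const card_ord -[leRHS]mulr_natl ler_wpM2r// ler_nat.
  apply: (@le_trans _ _ (\sum_(i < size s | (i < size s)%N) mass (galaxy (nth (fun=> 0) s i)))).
    by rewrite [leRHS]big_mkcond; apply: ler_sum => i _; rewrite ltn_ord; exact: (sI _ (ltn_ord i)).2.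
  apply: H => // i j iS jS ij; apply: centres_sep; [exact: (sI _ iS).1|exact: (sI _ jS).1|].
  by rewrite nth_uniq.
by rewrite ler_pdivrMr// mul1r ler_nat ltnn.
Qed.

Theorem galaxy_decomposition : exists al : nat -> P,
  light al /\
  forall k (f : fn k.+2) (L : R), test_function f ->
    series (fun i => pint f (al i)) @ \oo --> L -> (fun n => pint f (mu n)) @ U --> L.
Proof.
have /countable_injP[h hinj] := countable_centres.
pose C i := exists b, centres b /\ h b = i.
pose pos i : nat -> V := if pselect (C i) is left e then sval (cid e) else fun=> 0.
pose al i : P := if pselect (C i) is left e then galaxy (sval (cid e)) else @mzero _ T R.
have nzP i : al i setT != 0%E -> [/\ centres (pos i), h (pos i) = i & al i = galaxy (pos i)].
  rewrite /al /pos; case: pselect => [e|]; last by rewrite eqxx.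
  by move=> _; have [? ?] := svalP (cid e).
have hP b : centres b -> al (h b) setT != 0%E /\ pos (h b) = b.
  move=> cb; have Ch : C (h b) by exists b.
  rewrite /al /pos; case: pselect => // e; have [ce he] := svalP (cid e).
  have -> : sval (cid e) = b by apply: hinj; rewrite ?inE.
  by split => //; rewrite massE; have [_] := cb.
have sep i j : al i setT != 0%E -> al j setT != 0%E -> i != j -> ~ near_seq (pos i) (pos j).
  move=> /nzP[ci hi _] /nzP[cj hj _] ij; apply: centres_sep => //.
  by apply: contraNneq ij => pij; rewrite -hi -hj pij.
have mal : light al.
  apply: lime_le; first by apply: is_cvg_nneseries => i _; rewrite lee_fin mass_ge0.
  apply: nearW => N; rewrite sumEFin lee_fin big_mkord.
  apply: le_trans (@galaxy_masses N pos (fun i => al i setT != 0%E) sep).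
  rewrite [leRHS]big_mkcond; apply: ler_sum => i _.
  by case: ifPn => [/nzP[_ _ <-]//|]; rewrite negbK => /eqP/mass_eq0 ->.
exists al; split => // k f L tf.
apply: (@core_cvg U UU mu al pos) => //.
- by move=> i /nzP[_ _ ->]; exact: galaxyP.
- by move=> i j nzi nzj ij c; apply: not_near_seq; exact: sep.
- move=> b far c e e0.
  (* Otherwise [rep b] would be a centre at bounded distance from [b], which [far] excludes. *)
  have m0 : mass (galaxy b) = 0.
    apply/eqP; apply: contrapT => mb.
    have cb : centres (rep b).
      split; first by rewrite -(rep_eq (near_rep b)).
      apply/eqP => mr; apply: mb; rewrite eq_le mass_ge0 andbT -mr.
      exact/near_seq_mass_le/near_rep.
    have [nzh ph] := hP _ cb; have [M hM] := near_rep b.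
    have := far _ nzh M; rewrite ph => hM'.
    have [n [/lt_le_trans h1 h2]] := @filter_ex _ U _ _ (@filterI _ U _ _ _ hM' hM).
    by have := h1 _ h2; rewrite ltxx.
  apply: filterS (galaxy_cball b c e0) => n hn.
  have gK : fine (galaxy b (cball 0 c)) <= 0.
    by rewrite -[leRHS]m0; exact: fine_mono.
  apply: (@le_trans _ _ (fine (shift (mu n) (- b n) (cball 0 c)))); last by lra.
  by apply: fine_shift_le => // x; rewrite /cball/= subr0.
Qed.

End galaxies.

(** * Approximation of multisets by single probability measures *)

Section density.
Variables (al : nat -> P).
Hypothesis Hmass : light al.

Lemma partial_mass_le1 n : \sum_(i < n) mass (al i) <= 1.
Proof.
rewrite -lee_fin; apply: le_trans Hmass; rewrite -sumEFin -(big_mkord xpredT (fun i => (mass (al i))%:E)).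
by apply: nneseries_lim_ge => i _; rewrite lee_fin mass_ge0.
Qed.

(* The missing mass is shared by n + 1 atoms. *)
Definition dust n : R := (1 - \sum_(i < n) mass (al i)) / n.+1%:R.

Lemma dust_ge0 n : 0 <= dust n.
Proof. by rewrite divr_ge0// subr_ge0 partial_mass_le1. Qed.

Lemma dust_le n : dust n <= n.+1%:R^-1.
Proof. by rewrite ler_pdivrMr// mulVf// lerBlDr lerDl sumr_ge0// => i _; exact: mass_ge0. Qed.

Definition pieces (p : nat -> V) n (i : nat) : {measure set T -> \bar R} :=
  if (i < n)%N then (shift (al i) (p i) : {measure set T -> \bar R}) else mscale (NngNum (dust_ge0 n)) (\d_(p i : T)).

(* The pieces already have total mass 1: mnormalize only packages their sum as
   a probability. *)
Definition scattered (p : nat -> V) n : probability T R :=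
  mnormalize (msum (pieces p n) (n + n.+1)) (\d_(0 : T)).

Lemma pieces_sum p n A : measurable A -> msum (pieces p n) (n + n.+1) A =
  (\sum_(i < n) fine (shift (al i) (p i) A) + \sum_(l < n.+1) dust n * \1_A (p (n + l)%N : T))%:E.
Proof.
move=> mA; rewrite /msum big_split_ord/= EFinD -!sumEFin; congr (_ + _)%E.
  by apply: eq_bigr => i _; rewrite /pieces ltn_ord fineK// fin_num_measure.
by apply: eq_bigr => l _; rewrite /pieces ltnNge leq_addr/= /mscale/= diracE -EFinM indicE.
Qed.

Lemma scatteredE p n A : measurable A -> fine (scattered p n A) =
  \sum_(i < n) fine (shift (al i) (p i) A) + \sum_(l < n.+1) dust n * \1_A (p (n + l)%N : T).
Proof.
move=> mA; have total : msum (pieces p n) (n + n.+1) [set: T] = 1%E.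
  rewrite pieces_sum//; congr EFin.
  under [X in _ + X]eq_bigr do rewrite indicT mulr1.
  rewrite sumr_const card_ord -[X in _ + X]mulr_natr /dust divfK ?pnatr_eq0//.
  by rewrite [X in _ + (1 - X)](_ : _ = \sum_(i < n) fine (shift (al i) (p i) setT)) ?subrKC.
transitivity (fine (msum (pieces p n) (n + n.+1) A)); last by rewrite pieces_sum.
by rewrite /scattered /= /mnormalize; move: total => /= ->; rewrite onee_eq0/= invr1 mule1.
Qed.

Lemma sum_indic_le1 N (A : set T) (q : nat -> V) :
  (forall i j, A (q i) -> A (q j) -> i = j) -> \sum_(l < N) (\1_A (q l : T) : R) <= 1.
Proof.
move=> inj; have [[i0 Ai]|h] := pselect (exists i : 'I_N, A (q i)).
  rewrite (bigD1 i0)//= big1 ?addr0 ?indicE ?mem_set// => i ii0.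
  rewrite indicE memNset// => Aq; move/negP : ii0; apply; apply/eqP/val_inj; exact: inj.
rewrite big1 ?ler01// => i _; rewrite indicE memNset// => Aq; apply: h; by exists i.
Qed.

(** Atoms more than the diameter apart meet the ball at most once. *)
Lemma dust_le_ball p n v (C : R) (A : set T) : A `<=` cball v C ->
  (forall i j, i != j -> 2 * C < `|p i - p j|) ->
  \sum_(l < n.+1) dust n * \1_A (p (n + l)%N : T) <= n.+1%:R^-1.
Proof.
move=> AC far; rewrite -mulr_sumr; apply: le_trans (dust_le n).
rewrite ler_piMr ?dust_ge0//; apply: (@sum_indic_le1 _ _ (fun l => p (n + l)%N)) => i j /AC hi /AC hj.
apply/eqP; apply: contraT => ij; have := far (n + i)%N (n + j)%N.
rewrite eqn_add2l => /(_ ij); move: hi hj; rewrite /cball/= => hi hj.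
have := ler_distD v (p (n + i)%N) (p (n + j)%N); rewrite (distrC v); lra.
Qed.

Lemma dust_ge0_sum p n (A : set T) : 0 <= \sum_(l < n.+1) dust n * \1_A (p (n + l)%N : T).
Proof. by apply: sumr_ge0 => l _; rewrite mulr_ge0 ?dust_ge0// indicE. Qed.

Definition tail (a : P) (r : R) := fine (a (exterior r)).

(** One radius serves all pieces: late ones are small in total mass, and the finitely many early
    ones have a common radius. *)
Lemma total_tail (e : R) : 0 < e -> exists r : R, forall N, \sum_(i < N) tail (al i) r <= e.
Proof.
move=> e0; have e2 : 0 < e / 2 by rewrite divr_gt0.
have [m hm] := mass_tail Hmass e2.
have e2m : 0 < e / 2 / m.+1%:R by rewrite divr_gt0.
have [r hr] := uniform_tail_mass al m e2m.
exists r => N; rewrite -(big_mkord xpredT (fun i => tail (al i) r)).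
have tle i : 0 <= tail (al i) r <= mass (al i).
  by rewrite fine_ge0//=; exact: fine_mono.
apply: (@le_trans _ _ (\sum_(0 <= i < m + N) tail (al i) r)).
  rewrite (@big_cat_nat _ _ _ N 0 (m + N))//= ?leq_addl// lerDl.
  by apply: sumr_ge0 => i _; case/andP : (tle i).
rewrite (@big_cat_nat _ _ _ m 0 (m + N))//= ?leq_addr//.
have -> : e = e / 2 + e / 2 by lra.
apply: lerD.
  apply: (@le_trans _ _ (\sum_(0 <= i < m) e / 2 / m.+1%:R)).
    by apply: ler_sum_nat => i /andP[_ im]; exact: hr.
  rewrite sumr_const_nat subn0 -[leLHS]mulr_natr -mulrA ler_piMr ?(ltW e2)//.
  by rewrite mulrC ler_pdivrMr// mul1r ler_nat.
by apply: le_trans (hm (m + N)%N); apply: ler_sum => i _; case/andP : (tle i).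
Qed.

Hypothesis d_gt0 : (0 < d)%N.

(** Places on the diagonal, at mutual distance at least [n]. For [d = 0] they would all coincide. *)
Definition post (i n : nat) : V := const_mx (n * i)%:R.

Lemma nat_dist (i j : nat) : i != j -> 1 <= `|i%:R - j%:R| :> R.
Proof.
wlog ij : i j / (i < j)%N => [h|_].
  rewrite neq_ltn => /orP[ij|ij]; first by rewrite h// neq_ltn ij.
  by rewrite distrC h// neq_ltn ij.
by rewrite distrC -natrB ?(ltnW ij)// normr_nat (_ : 1 = 1%:R)// ler_nat subn_gt0 ij.
Qed.

Lemma post_dist i j n : i != j -> n%:R <= `|post i n - post j n|.
Proof.
move=> ij; apply: le_trans (mx_entry_le _ ord0 (Ordinal d_gt0)).
by rewrite !mxE !natrM -mulrBr normrM normr_nat ler_peMr// nat_dist.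
Qed.

Lemma scattered_cvg (U : set_system nat) (UU : UltraFilter U) k (f : fn k.+2) (L : R) :
  \oo `<=` U -> test_function f ->
  series (fun i => pint f (al i)) @ \oo --> L ->
  (fun n => pint f (scattered (post ^~ n) n)) @ U --> L.
Proof.
move=> oU tf cL.
apply: (@core_cvg U UU (fun n => scattered (post ^~ n) n) al post) => //.
(* In its own frame the piece [i0] is seen exactly, by [shiftK]. The other pieces reach a bounded
   set only with their tails, and at most one atom lies there; for lower bounds both are dropped. *)
- move=> i0 _; split => [K r e cK Kr e0|O r e oO Or e0].
    have e2 : 0 < e / 2 by rewrite divr_gt0.
    have [q hq] := total_tail e2.
    have mK := closed_Rvec cK.
    apply: oU; near=> n.
    have i0n : (i0 < n)%N by near: n; exact: nbhs_infty_gt.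
    rewrite shiftE scatteredE; last exact: mtrans_preimage.
    rewrite (bigD1 (Ordinal i0n))//=.
    rewrite shiftK.
    rewrite -addrA lerD2l (_ : e = e / 2 + e / 2); last by lra.
    have nr : q + `|r| < n%:R by near: n; exact: nbhs_infty_gtr.
    have nr2 : 2 * `|r| < n%:R by near: n; exact: nbhs_infty_gtr.
    apply: lerD.
      apply: le_trans (hq n); rewrite [leRHS](bigD1 (Ordinal i0n))//=.
      apply: ler_wpDl; first exact: fine_ge0.
      apply: ler_sum => i ii0; rewrite shiftE; apply: fine_mono; first do 2 apply: mtrans_preimage => //.
        by [].
      move=> x; rewrite /exterior/= /trans => /Kr hx.
      have := @post_dist i i0 n ii0.
      have {1}-> : post i n - post i0 n = (x : V) + post i n - post i0 n - x.
        by move: (x : V) => y; rewrite -[y + _ - _]addrA [y + _]addrC addrK.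
      have := ler_normB ((x : V) + post i n - post i0 n) x.
      have := ler_norm r; lra.
    apply: le_trans (@dust_le_ball (post ^~ n) n (post i0 n) `|r| _ _ _) _.
    - by move=> x /=; rewrite /trans /cball/= => /Kr/le_trans; apply; exact: ler_norm.
    - by move=> i j ij; apply: lt_le_trans (post_dist _ ij).
    by apply: ltW; near: n; exact: near_infty_invS_lt.
  apply: oU; near=> n.
  have i0n : (i0 < n)%N by near: n; exact: nbhs_infty_gt.
  rewrite shiftE scatteredE; last by apply: mtrans_preimage; exact: open_Rvec.
  rewrite (bigD1 (Ordinal i0n))//=.
  rewrite shiftK.
  rewrite -addrA lerD2l (@le_trans _ _ 0)//; first by rewrite oppr_le0 ltW.
  by apply: addr_ge0; [apply: sumr_ge0 => i _; exact: fine_ge0|exact: (dust_ge0_sum (post ^~ n))].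
- move=> i j _ _ ij C; apply: oU; near=> n.
  apply: lt_le_trans (post_dist _ ij); near: n; exact: nbhs_infty_gtr.
(* Three thirds: early pieces reach the ball only with their tails, late pieces have small total
   mass, and the ball holds at most one atom. *)
- move=> b far C e e0; have e3 : 0 < e / 3 by rewrite divr_gt0.
  have [m hm] := mass_tail Hmass e3.
  have [r hr] := total_tail e3.
  have nearb : \forall n \near U, forall i : 'I_m, al i setT != 0%E -> r + C < `|b n - post i n|.
    by apply: filter_forall_if => i nzi; exact: far.
  have near2 : \forall n \near U, (m <= n)%N /\ 2 * C < n%:R /\ n.+1%:R^-1 <= e / 3.
    apply: oU; near=> n; split; first by near: n; exact: nbhs_infty_ge.
    split; first by near: n; exact: nbhs_infty_gtr.
    by apply: ltW; near: n; exact: near_infty_invS_lt.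
  apply: filterS2 nearb near2 => n hb [mn [Cn ne]].
  rewrite scatteredE//.
  rewrite (_ : e = (e / 3 + e / 3) + e / 3); last by lra.
  apply: lerD; last first.
    apply: le_trans ne; apply: (@dust_le_ball (post ^~ n) n (b n) C) => //.
    by move=> i j ij; apply: lt_le_trans (post_dist _ ij).
  rewrite -(big_mkord xpredT (fun i => fine (shift (al i) (post i n) (cball (b n) C)))).
  rewrite (@big_cat_nat _ _ _ m 0 n)//=; apply: lerD.
    apply: le_trans (hr m); rewrite big_mkord; apply: ler_sum => i _.
    rewrite shiftE; have [nzi|] := boolP (al i setT != 0%E); last first.
      rewrite negbK => /eqP/mass_eq0 m0; apply: (@le_trans _ _ (mass (al i))).
        by apply: fine_mono => //; exact: mtrans_preimage.
      by rewrite m0 fine_ge0.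
    apply: fine_mono => [|//|x]; first exact: mtrans_preimage.
    rewrite /exterior /trans /cball/= => hx.
    have := hb i nzi; have := ler_distD (x + post i n) (b n) (post i n).
    rewrite addrK (distrC (b n) (_ + _)); lra.
  apply: le_trans (hm n); apply: ler_sum => i _; rewrite shiftE.
  by apply: fine_mono => //; exact: mtrans_preimage.
Unshelve. all: by end_near.
Qed.

End density.

(** * Separation of single measures *)

Definition bump (phi : V -> R) : Prop :=
  [/\ exists L, forall u v, `|phi u - phi v| <= L * `|u - v|,
      forall v, 0 <= phi v <= 1 &
      exists C, forall v, phi v != 0 -> `|v| <= C].

Lemma bump_cutoff rho : bump (cutoff rho : V -> R).
Proof.
split; first by exists 1; exact: cutoff_lip.
  by move=> v; rewrite cutoff_ge0 cutoff_le1.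
by exists (rho + 1) => v; exact: cutoff_neq0.
Qed.

Lemma bump_norm_le1 phi v : bump phi -> `|phi v| <= 1.
Proof. by case=> _ h _; have /andP[? ?] := h v; rewrite ger0_norm. Qed.

(** The convolution of [a] with the reflection of [phi]. *)
Definition smear (phi : V -> R) (a : P) (x : V) : R := E a (fun z : T => phi ((z : V) - x)).

Lemma bm_bump phi x : bump phi -> bm (fun z : T => phi ((z : V) - x)).
Proof.
move=> bphi; split; last by exists 1 => z; exact: bump_norm_le1.
apply: continuous_Rvec_measurable; case: bphi => [[L hL] _ _].
by apply: (@lipschitz_cont _ _ _ _ L) => u v; rewrite (le_trans (hL _ _))// opprB addrA subrK.
Qed.

Lemma smear_01 phi a x : bump phi -> 0 <= smear phi a x <= 1.
Proof.
move=> bphi; have [_ p01 _] := bphi; apply/andP; split.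
  by apply: E_ge0 => z; case/andP : (p01 (z - x)).
by rewrite (le_trans (ler_norm _))// norm_E_le1//; [exact: bm_bump|move=> z; exact: bump_norm_le1].
Qed.

Lemma smear_lip phi a : bump phi -> exists L, forall x y, `|smear phi a x - smear phi a y| <= L * `|x - y|.
Proof.
move=> bphi; have [[L hL] _ _] := bphi; exists L => x y.
rewrite /smear -EB; [|exact: bm_bump|exact: bm_bump].
apply: norm_E_le1; first by apply: bmB; exact: bm_bump.
move=> z; rewrite (le_trans (hL _ _))// (_ : _ - x - (_ - y) = - (x - y)) ?normrN//.
by rewrite !opprB addrC addrA subrK.
Qed.

Lemma smear_cont phi a : bump phi -> continuous (smear phi a).
Proof. by move=> /(smear_lip a)[L hL]; exact: lipschitz_cont hL. Qed.

Lemma bm_smear phi a : bump phi -> bm (fun x : T => smear phi a x).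
Proof.
move=> bphi; split; first by apply: continuous_Rvec_measurable; exact: smear_cont.
by exists 1 => x; have /andP[? ?] := smear_01 a x bphi; rewrite ger0_norm.
Qed.

Definition star p (psi : 'I_p.+1 -> V -> R) (x : pts p.+2) : R :=
  \prod_(i < p.+1) psi i (row (lift ord0 i) x - row ord0 x).

Lemma test_star p (psi : 'I_p.+1 -> V -> R) : (forall i, bump (psi i)) -> test_function (star psi).
Proof.
move=> bpsi; split.
- apply: (continuous_big (@mul_continuous R)) => i _; have [[L hL] _ _] := bpsi i.
  apply: (@lipschitz_cont _ _ _ _ (`|L| * 2)) => x y; apply: le_trans (hL _ _) _.
  apply: (@le_trans _ _ (`|L| * `|row (lift ord0 i) x - row ord0 x - (row (lift ord0 i) y - row ord0 y)|)).
    by rewrite ler_wpM2r// ler_norm.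
  by rewrite -mulrA ler_wpM2l// row_diff_lip.
- move=> x y; apply: eq_bigr => i _; congr (psi i _).
  by rewrite !rowK opprD addrACA subrr addr0.
- move=> e e0; have hC i := let: And3 _ _ h := bpsi i in h.
  pose C i := sval (cid (hC i)); have CP i : forall v, psi i v != 0 -> `|v| <= C i := svalP (cid (hC i)).
  pose M := \sum_i `|C i|; have M0 : 0 <= M by apply: sumr_ge0.
  exists (2 * M + 1) => x sx; rewrite (_ : star psi x = 0) ?normr0//.
  apply/eqP; apply: contraTT sx; rewrite -ltNge prodf_seq_neq0 => /allP h.
  apply: (@le_lt_trans _ _ (2 * M)); last by rewrite ltrDl.
  have hrow i : `|row i x - row ord0 x| <= M.
    case: (unliftP ord0 i) => [j ->|->]; last by rewrite subrr normr0.
    apply: le_trans (CP j _ (h j (mem_index_enum j))) _; apply: le_trans (ler_norm _) _.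
    by rewrite /M (bigD1 j)//= lerDl sumr_ge0.
  apply: spread_leP => [|i j]; first by rewrite mulr_ge0.
  rewrite (le_trans (ler_distD (row ord0 x) _ _))// mulr_natl mulr2n lerD//.
  by rewrite distrC.
Qed.

(** Given the centre of the star the other points are independent, so products of local averages
    integrate to power integrals of test functions. *)
Lemma pint_star p (psi : 'I_p.+1 -> V -> R) a : (forall i, bump (psi i)) ->
  pint (star psi) a = E a (fun x => \prod_(i < p.+1) smear (psi i) a x).
Proof.
move=> bpsi; rewrite /pint E_pwS; last exact: (test_bm _ (test_star bpsi)).
congr E; apply/funext => x; rewrite -(E_pw_prod a (h := fun i (z : T) => psi i ((z : V) - x))); last first.
  by move=> i; exact: bm_bump.
congr E; apply/funext => t; apply: eq_bigr => i _; congr (psi i (_ - _)).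
  by apply/rowP => j; rewrite mxE mxtE tnthS.
by apply/rowP => j; rewrite mxE mxtE tnth0.
Qed.

(** The sets of full measure in a ball of positive mass form a filter; an ultrafilter above it
    converges in that ball, and no neighbourhood of its limit is negligible. *)
Lemma support_point (a : P) : a setT != 0%E -> exists x0 : V, forall rho, 0 < rho -> 0 < fine (a (cball x0 rho)).
Proof.
move=> a0; have m0 : 0 < mass a.
  by rewrite lt_neqAle mass_ge0 andbT eq_sym; apply: contra_neq a0 => h; rewrite massE h.
have [r hr] : exists r, 0 < fine (a (cball 0 r)).
  have [|r hr] := @mass_oball a (mass a / 2); first by rewrite divr_gt0.
  exists r; apply: (@lt_le_trans _ _ (fine (a (oball 0 r)))).
    by have := hr; lra.
  by apply: fine_mono => // x /= /ltW.
pose F : set_system V := [set A | a.-negligible ((cball 0 r : set T) `\` A)].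
have FF : ProperFilter F.
  split; last first.
    split; rewrite /F/=.
    - by rewrite setDT; exact: negligible_set0.
    - by move=> A B nA nB /=; rewrite setDIr; exact: negligibleU.
    - by move=> A B AB; apply: negligibleS; apply: setDS.
  rewrite /F/= setD0 => /(measure_negligible (mcball 0 r)) h.
  by move: hr; rewrite h ltxx.
have [G [UG FG]] := ultraFilterLemma FF.
have GK : G (cball 0 r) by apply: FG; rewrite /F/= setDv; exact: negligible_set0.
have cK : compact (cball (0 : V) r).
  rewrite (_ : cball 0 r = [set x : V | `|x| <= r]); first exact: mx_closed_ball_compact.
  by apply/seteqP; split => x; rewrite /cball/= subr0.
move: cK; rewrite compact_ultra => /(_ G UG GK)[x0 [_ Gx0]]; exists x0 => rho rho0.
rewrite lt_neqAle fine_ge0// andbT; apply/negP => /eqP h.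
have GB : G (cball x0 rho).
  apply: Gx0; apply/nbhs_ballP; exists rho => //= y; rewrite /cball/= -ball_normE/= => hy.
  by rewrite distrC ltW.
have GC : G (~` cball x0 rho).
  apply: FG; rewrite /F/=; apply: (@negligibleS _ T _ _ (cball x0 rho)); first by move=> y [_]; apply: contrapT.
  apply/negligibleP => //.
  by rewrite -(fineK (fin_num_measure a _ (mcball x0 rho))) -h.
by have [y [? ]] := filter_ex (filterI GB GC).
Qed.

Lemma smear_vanish phi a e : bump phi -> 0 < e -> exists C, forall y, C <= `|y| -> smear phi a y <= e.
Proof.
move=> bphi e0; have [r hr] := tail_mass a e0; have [_ p01 [C hC]] := bphi.
exists (r + C) => y hy; apply: le_trans hr; rewrite -E_indic; last by [].
apply: le_E; [exact: bm_bump|exact: bm_indic|move=> z].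
rewrite indicE; have [h0|h0] := eqVneq (phi ((z : V) - y)) 0; first by rewrite h0.
rewrite mem_set//=; first by case/andP : (p01 ((z : V) - y)).
by rewrite /exterior/=; have := hC _ h0; have := ler_distD z y 0; rewrite !subr0 distrC; move: hy; lra.
Qed.

(** Indicators of open sets are bounded pointwise limits of bumps built from [depth], and open sets
    form a generating family stable under intersection. *)
Lemma bump_separates (a b : P) : (forall phi, bump phi -> E a (phi : T -> R) = E b (phi : T -> R)) ->
  forall A, measurable A -> a A = b A.
Proof.
move=> ab; have opens (W : set V) : open W -> a W = b W.
  move=> oW; have mW := open_Rvec oW.
  pose h (n : nat) (x : V) : R := clamp (n%:R * depth W x) * cutoff n%:R x.
  have bh n : bump (h n).
    have b1 v : 0 <= clamp (n%:R * depth W v) <= 1 by exact: clamp_01.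
    have l1 u v : `|clamp (n%:R * depth W u) - clamp (n%:R * depth W v)| <= n%:R * `|u - v|.
      by rewrite (le_trans (clamp_lip _ _))// -mulrBr normrM normr_nat ler_wpM2l// (le_trans (depth_lip W u v))// mul1r.
    split.
    - exists (n%:R + 1) => u v; rewrite /h.
      set p := clamp _; set q := cutoff _ u; set p' := clamp _; set q' := cutoff _ v.
      have -> : p * q - p' * q' = (p - p') * q + p' * (q - q') by ring.
      rewrite (le_trans (ler_normD _ _))// !normrM mulrDl lerD//.
        by rewrite (le_trans _ (l1 u v))// ler_piMr// ger0_norm ?cutoff_ge0 ?cutoff_le1.
      rewrite (le_trans _ (cutoff_lip n%:R u v))// ler_piMl//.
      by have /andP[? ?] := b1 v; rewrite ger0_norm.
    - move=> v; have /andP[? ?] := b1 v.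
      by rewrite mulr_ge0 ?cutoff_ge0//= mulr_ile1 ?cutoff_ge0 ?cutoff_le1.
    - by exists (n%:R + 1) => v; rewrite mulf_eq0 negb_or => /andP[_ /cutoff_neq0].
  have hcvg x : h n x @[n --> \oo] --> (\1_(W : set T) (x : T) : R).
    apply: cvg_near_cst; have [Wx|Wx] := pselect (W x).
      have dx := depth_gt0 oW Wx.
      near=> n; rewrite indicE mem_set// /h cutoff_eq1 ?mulr1.
        rewrite clamp_id1// -ler_pdivrMr// mul1r.
        by near: n; exact: nbhs_infty_ger.
      by near: n; exact: nbhs_infty_ger.
    apply: nearW => n; rewrite indicE memNset// /h depth_out// mulr0 clamp_id0// mul0r//.
  have bmh m : bm (h m : T -> R) by have := bm_bump 0 (bh m); under eq_fun do rewrite subr0.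
  have cE c : (fun n => E c (h n : T -> R)) @ \oo --> fine (c W).
    by rewrite -E_indic//; apply: (@E_dct _ _ _ _ _ _ 1) => // n x; exact: bump_norm_le1.
  have fab : fine (a W) = fine (b W).
    apply: (cvg_unique _ (cE a)) => //.
    have -> : (fun n => E a (h n : T -> R)) = (fun n => E b (h n : T -> R)) by apply/funext => n; exact: ab.
    exact: cE.
  by rewrite -(fineK (fin_num_measure a _ mW)) fab fineK// fin_num_measure.
apply: (@measure_unique _ _ T (@open V) (fun=> setT)) => //.
- by move=> A B; exact: openI.
- by move=> _; exact: openT.
- by rewrite bigcup_const//; exists 0%N.
- by move=> _; rewrite ltey_eq fin_num_measure.
Unshelve. all: by end_near.
Qed.

Section translate_recovery.
Variables (al be : P).
Hypothesis Hpint : forall k (f : fn k.+2), test_function f -> pint f al = pint f be.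

Let phi0 : V -> R := cutoff 1.

(* Integrals of products of local averages are integrals of star-shaped test
   functions; the factor phi0 is there because a test function needs at least
   two points. *)
Definition balanced (G : P * T -> R) : Prop :=
  (forall a, bm (fun x => G (a, x))) /\ forall l : seq (V -> R), (forall i, bump (nth phi0 l i)) ->
    E al (fun x => G (al, x) * \prod_(psi <- phi0 :: l) smear psi al x) =
    E be (fun x => G (be, x) * \prod_(psi <- phi0 :: l) smear psi be x).

Lemma bump_phi0 : bump phi0. Proof. exact: bump_cutoff. Qed.

Lemma bump_cons phi l : bump phi -> (forall i, bump (nth phi0 l i)) ->
  forall i, bump (nth phi0 (phi :: l) i).
Proof. by move=> bphi bl [|i]; [exact: bphi|exact: bl]. Qed.

Lemma smear_prodE a l : (forall i, bump (nth phi0 l i)) ->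
  (fun x => \prod_(psi <- phi0 :: l) smear psi a x) =
  (fun x => \prod_(i < (size l).+1) smear (nth phi0 (phi0 :: l) i) a x).
Proof. by move=> bl; apply/funext => x; rewrite (big_nth phi0) big_mkord. Qed.

Lemma bm_smear_prod a l : (forall i, bump (nth phi0 l i)) ->
  bm (fun x : T => \prod_(psi <- phi0 :: l) smear psi a x).
Proof.
move=> bl; rewrite smear_prodE//; apply: bm_prod => i _; apply: bm_smear.
exact: (bump_cons bump_phi0 bl).
Qed.

Lemma balanced1 : balanced (fun=> 1).
Proof.
split => [a|l bl]; first exact: bm_cst.
under [in LHS]eq_fun do rewrite mul1r; under [in RHS]eq_fun do rewrite mul1r.
have bl' i := bump_cons bump_phi0 bl i.
rewrite !smear_prodE//.
rewrite -!(pint_star (psi := fun i : 'I_(size l).+1 => nth phi0 (phi0 :: l) i))//.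
exact/Hpint/test_star.
Qed.

Lemma balanced_lin c c' G H : balanced G -> balanced H -> balanced (fun z => c * G z + c' * H z).
Proof.
move=> [bG eG] [bH eH]; split => [a|l bl]; first by apply: bmD; exact: bmZ.
have key a : E a (fun x => (c * G (a, x) + c' * H (a, x)) * \prod_(psi <- phi0 :: l) smear psi a x) =
    c * E a (fun x => G (a, x) * \prod_(psi <- phi0 :: l) smear psi a x) +
    c' * E a (fun x => H (a, x) * \prod_(psi <- phi0 :: l) smear psi a x).
  have bp := bm_smear_prod a bl.
  rewrite -!EZ -?ED; [|apply: bmZ; exact: bmM|apply: bmZ; exact: bmM|exact: bmM|exact: bmM].
  by congr E; apply/funext => x; ring.
by rewrite !key eG// eH.
Qed.

Lemma balancedM phi G : bump phi -> balanced G -> balanced (fun z => smear phi z.1 z.2 * G z).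
Proof.
move=> bphi [bG eG]; split => [a|l bl]; first by apply: bmM => //; exact: bm_smear.
have key a : (fun x => smear phi a x * G (a, x) * \prod_(psi <- phi0 :: l) smear psi a x) =
    (fun x => G (a, x) * \prod_(psi <- phi0 :: phi :: l) smear psi a x).
  by apply/funext => x; rewrite !big_cons; ring.
by rewrite !key; apply: eG; exact: bump_cons.
Qed.

Section near_translate.
Variables (m : nat) (phi : nat -> V -> R) (t : nat -> R).
Hypothesis bphi : forall i, bump (phi i).

(** For targets in the unit interval it reaches its largest possible value, 1, exactly where every
    average equals its target. *)
Definition agree (a : P) (x : V) : R := \prod_(i < m) (1 - (smear (phi i) a x - t i) ^+ 2).

Lemma balanced_agreeX p : balanced (fun z => agree z.1 z.2 ^+ p).
Proof.
apply: (damping_closed (u := fun i z => smear (phi i) z.1 z.2) t balanced1 balanced_lin) => j G.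
exact: balancedM.
Qed.

Hypothesis t01 : forall i, 0 <= t i <= 1.

Lemma agree_factor_01 a x i : 0 <= 1 - (smear (phi i) a x - t i) ^+ 2 <= 1.
Proof.
have /andP[h1 h2] := smear_01 a x (bphi i); have /andP[h3 h4] := t01 i.
by apply: onem_sqr_01; rewrite ler_norml; apply/andP; split; lra.
Qed.

Lemma agree_ge0 a x : 0 <= agree a x.
Proof. by apply: prodr_ge0 => i _; case/andP: (agree_factor_01 a x i). Qed.

Lemma agree_le a x (i : 'I_m) : agree a x <= 1 - (smear (phi i) a x - t i) ^+ 2.
Proof.
have /andP[h1 h2] := agree_factor_01 a x i.
rewrite /agree (bigD1 i)//= ler_piMr//; apply: prodr_ile1 => j _; exact: agree_factor_01.
Qed.

Lemma agree_cont a : continuous (agree a).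
Proof.
apply: (continuous_big (@mul_continuous R)) => i _; have cs := smear_cont (a := a) (bphi i).
have c1 : continuous (fun x => smear (phi i) a x - t i) by apply: contD => //; exact: cont_cst.
have -> : (fun x => 1 - (smear (phi i) a x - t i) ^+ 2) =
   (fun x => 1 + (-1) * ((smear (phi i) a x - t i) * (smear (phi i) a x - t i))).
  by apply/funext => x; ring.
by apply: contD; [exact: cont_cst|apply: contZ; exact: contM].
Qed.

End near_translate.

Variable x0 : V.
Hypothesis Hx0 : forall rho, 0 < rho -> 0 < fine (al (cball x0 rho)).

Lemma smear_phi0_gt0 : 0 < smear phi0 al x0.
Proof.
apply: (lt_le_trans (Hx0 ltr01)); rewrite -E_indic//.
apply: le_E; [exact: bm_indic|exact: (bm_bump _ bump_phi0)|move=> z].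
rewrite indicE; have [h|h] := pselect (cball x0 1 (z : V)).
  by rewrite mem_set//= /phi0 cutoff_eq1.
by rewrite memNset// cutoff_ge0.
Qed.

(* Otherwise agree stays away from 1 for be, while it is close to 1 for al near
   x0, which contradicts the equality of the integrals of high powers. *)
Lemma near_translate m (phi : nat -> V -> R) (dl : R) : (forall i, bump (phi i)) -> 0 < dl ->
  exists y : V, forall i, (i < m)%N -> `|smear (phi i) be y - smear (phi i) al x0| < dl.
Proof.
move=> bphi dl0; apply: contrapT => no; pose t i := smear (phi i) al x0.
have t01 i : 0 <= t i <= 1 by exact: smear_01.
have bad y : exists i : 'I_m, dl <= `|smear (phi i) be y - t i|.
  apply: contrapT => h; apply: no; exists y => i im; rewrite ltNge; apply/negP => hi.
  by apply: h; exists (Ordinal im).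
have be_le y : agree m phi t be y <= 1 - dl ^+ 2.
  have [i hi] := bad y; apply: (le_trans (agree_le bphi t01 be y i)).
  by rewrite lerB// -[leRHS]real_normK ?num_real// lerXn2r// nnegrE ltW.
have d1 : 0 <= 1 - dl ^+ 2 by rewrite (le_trans (agree_ge0 m bphi t01 be 0) (be_le 0)).
(* A level strictly between the bound [1 - dl ^+ 2] for [be] and the value 1 that [al] takes at
   [x0]. *)
pose kap := 1 - dl ^+ 2 / 2; have dl2 : 0 < dl ^+ 2 by rewrite exprn_gt0.
have k0 : 0 < kap by rewrite /kap; lra.
pose c := smear phi0 al x0 / 2; have c0 : 0 < c by rewrite divr_gt0// smear_phi0_gt0.
have [rho rho0 hrho] : exists2 rho, 0 < rho & forall x, cball x0 rho x ->
    kap <= agree m phi t al x /\ c <= smear phi0 al x.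
  have n1 : \forall x \near (x0 : V), kap <= agree m phi t al x.
    have a1 : agree m phi t al x0 = 1 by rewrite /agree big1// => i _; rewrite subrr expr0n subr0.
    apply: (continuous_near_ge (@agree_cont m phi t bphi al)); rewrite a1 /kap; lra.
  have n2 : \forall x \near (x0 : V), c <= smear phi0 al x.
    apply: (continuous_near_ge (@smear_cont phi0 al bump_phi0)).
    by rewrite /c; have := smear_phi0_gt0; lra.
  have [r /= r0 hr] : nbhs_ball (x0 : V) [set x | kap <= agree m phi t al x /\ c <= smear phi0 al x].
    by apply/nbhs_ballP; exact: filterI n1 n2.
  exists (r / 2); first by rewrite divr_gt0.
  move=> x hx; apply: hr; rewrite -ball_normE/= distrC (le_lt_trans hx)//; lra.
(* The two sides bound the same number, the balanced integral of the p-th power, from below through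
   [al] and from above through [be]; for large [p] this fails. *)
have key p : c * fine (al (cball x0 rho)) * kap ^+ p <= (1 - dl ^+ 2) ^+ p.
  have [bG /(_ [::])] := balanced_agreeX m t bphi p.
  have bn i : bump (nth phi0 [::] i) by rewrite nth_nil; exact: bump_phi0.
  move=> /(_ bn) eG; have bp a := bm_smear_prod a bn.
  apply: (@le_trans _ _ (E al (fun x => agree m phi t al x ^+ p * \prod_(psi <- [:: phi0]) smear psi al x))).
    have bI : bm (fun x : T => (c * kap ^+ p) * \1_(cball x0 rho : set T) x) by exact/bmZ/bm_indic.
    have -> : c * fine (al (cball x0 rho)) * kap ^+ p =
        E al (fun x : T => (c * kap ^+ p) * \1_(cball x0 rho : set T) x).
      by rewrite EZ ?E_indic//; [exact: mulrAC|exact: bm_indic].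
    apply: le_E => [//||x]; first by apply: bmM; [exact: (bG al)|].
    rewrite big_seq1; have s0 : 0 <= smear phi0 al x by case/andP : (smear_01 al x bump_phi0).
    have a0 := agree_ge0 m bphi t01 al x.
    rewrite indicE; have [h|h] := pselect (cball x0 rho (x : V)); last first.
      by rewrite memNset// mulr0 mulr_ge0// exprn_ge0.
    have [h1 h2] := hrho _ h; rewrite mem_set// mulr1 mulrC ler_pM ?exprn_ge0 ?(ltW c0) ?(ltW k0)//.
    by rewrite lerXn2r// nnegrE ltW.
  rewrite eG; apply: le_trans (ler_norm _) _; apply: norm_E_le1; first by apply: bmM; [exact: (bG be)|].
  move=> x; have /andP[s0 s1] := smear_01 be x bump_phi0; have a0 := agree_ge0 m bphi t01 be x.
  rewrite big_seq1 ger0_norm ?mulr_ge0 ?exprn_ge0//.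
  by rewrite (le_trans (ler_piMr _ s1)) ?exprn_ge0// lerXn2r.
pose q := (1 - dl ^+ 2) / kap.
have q0 : 0 <= q by rewrite divr_ge0// ltW.
have q1 : q < 1 by rewrite ltr_pdivrMr// mul1r /kap; lra.
have qlim : (fun p => q ^+ p) @ \oo --> (0 : R) by apply: cvg_expr; rewrite ger0_norm.
pose eta := c * fine (al (cball x0 rho)).
have eta0 : 0 < eta by rewrite mulr_gt0// Hx0.
have [p _ /(_ p (leqnn p))/=] := @cvgr_lt _ _ _ _ _ _ qlim eta eta0.
by rewrite ltNge expr_div_n ler_pdivlMr ?exprn_gt0// key.
Qed.

(** The positions that nearly match finitely many averages generate a filter. Matching [phi0] keeps
    them bounded, because its average under [be] vanishes at infinity while its target is positive;
    a limit matches all averages. *)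
Lemma exact_translate : exists y : V, forall phi, bump phi -> smear phi be y = smear phi al x0.
Proof.
pose D : set (seq (V -> R) * R) := [set p | (forall i, bump (nth phi0 p.1 i)) /\ 0 < p.2].
pose B (p : seq (V -> R) * R) : set V := [set y | forall i,
  `|smear (nth phi0 p.1 i) be y - smear (nth phi0 p.1 i) al x0| < p.2].
have D1 phi e : bump phi -> 0 < e -> D ([:: phi], e).
  by move=> bphi e0; split => // -[|i] //=; rewrite nth_nil; exact: bump_phi0.
have FF : ProperFilter (filter_from D B).
  apply: filter_from_proper; first apply: filter_from_filter.
  - by exists ([::], 1); split => //= i; rewrite nth_nil; exact: bump_phi0.
  - move=> [l e] [l' e'] [/= bl e0] [/= bl' e'0]; exists (l ++ l', Num.min e e').
      by split => /= [i|]; [rewrite nth_cat; case: ifP|rewrite lt_min e0].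
    move=> y /= h; split => i /=.
      have [il|il] := ltnP i (size l).
        by have := h i; rewrite nth_cat il lt_min => /andP[].
      rewrite nth_default//; have := h (size l + size l')%N.
      by rewrite nth_default ?size_cat// lt_min => /andP[].
    have := h (size l + i)%N; rewrite nth_cat ltnNge leq_addr/= addKn lt_min => /andP[] //.
  - move=> [l e] [/= bl e0].
    (* The extra index [size l] stands for all indices past the end, where [nth] returns [phi0]. *)
    have [y hy] := @near_translate (size l).+1 (nth phi0 l) e bl e0.
    exists y => i /=; have [il|il] := ltnP i (size l); first by apply: hy; rewrite ltnS ltnW.
    by rewrite nth_default// -(nth_default phi0 (leqnn (size l))); exact: hy.
have [G [UG FG]] := ultraFilterLemma FF.
have GB p : D p -> G (B p) by move=> Dp; apply: FG; exists p.
pose t0 := smear phi0 al x0; have t0gt : 0 < t0 by exact: smear_phi0_gt0.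
have t2 : 0 < t0 / 2 by rewrite divr_gt0.
have [C hC] := smear_vanish be bump_phi0 t2.
have GK : G [set y : V | `|y| <= C].
  apply: filterS (GB _ (D1 phi0 (t0 / 2) bump_phi0 t2)) => y /(_ 0%N) /= h.
  rewrite leNgt; apply/negP => /ltW/hC; move: h; rewrite -/t0 ltr_norml => /andP[]; lra.
have := @mx_closed_ball_compact R 1 d C; rewrite compact_ultra => /(_ G UG GK)[y [_ Gy]].
exists y => phi bphi; apply/eqP; rewrite -subr_eq0 -normr_le0; apply/ler_addgt0Pr => e e0.
rewrite add0r; have e2 : 0 < e / 2 by rewrite divr_gt0.
have n1 : \forall z \near (y : V), `|smear phi be y - smear phi be z| <= e / 2.
  have := @smear_cont phi be bphi y.
  by move/(@cvgrPdist_le _ _ _ (nbhs (y : V))) => /(_ _ e2).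
have [z [/= h1 h2]] := filter_ex (filterI (Gy _ n1) (GB _ (D1 phi (e / 2) bphi e2))).
have := h2 0%N => /= h3.
rewrite (le_trans (ler_distD (smear phi be z) _ _))// (_ : e = e / 2 + e / 2); last by lra.
by rewrite lerD// ltW.
Qed.

End translate_recovery.

(** Translated by [- x0] and [- y], the two measures integrate all bumps equally, hence agree on
    Borel sets. *)
Theorem pint_separates (al be : P) : al setT != 0%E ->
  (forall k (f : fn k.+2), test_function f -> pint f al = pint f be) -> sim al be.
Proof.
move=> a0 H; have [x0 Hx0] := support_point a0; have [y hy] := exact_translate H Hx0.
have sE (a : P) (x : 'rV[R]_d) phi : bump phi -> E (shift a (- x)) (phi : T -> R) = smear phi a x.
  by move=> bphi; rewrite E_shift//; have := bm_bump 0 bphi; under eq_fun do rewrite subr0.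
have e : forall A, measurable A -> shift al (- x0) A = shift be (- y) A.
  by apply: bump_separates => phi bphi; rewrite !sE// hy.
have s (a : P) x : sim a (shift a (- x)) by exists (- x).
apply: sim_trans (s al x0) _; apply: sim_sym; apply: sim_trans (s be y) _.
by exists 0 => A mA; rewrite e// shiftE; congr (shift be _ _); apply/seteqP; split => z /=; rewrite /trans addr0.
Qed.

(** * Separation of multisets *)

Section products.
Lemma measurable_cat_tuple k l :
  measurable_fun setT (fun z : k.-tuple T * l.-tuple T => [tuple of z.1 ++ z.2]).
Proof.
apply/measurable_fun_tnthP => i; case: (split_ordP i) => j ->.
  rewrite (_ : _ \o _ = fun z : k.-tuple T * l.-tuple T => tnth z.1 j); last first.
    by apply/funext => z; rewrite /= tnth_lshift.
  by apply: (measurableT_comp (f := fun t : k.-tuple T => tnth t j)); [exact: measurable_tnth|exact: measurable_fst].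
rewrite (_ : _ \o _ = fun z : k.-tuple T * l.-tuple T => tnth z.2 j); last first.
  by apply/funext => z; rewrite /= tnth_rshift.
by apply: (measurableT_comp (f := fun t : l.-tuple T => tnth t j)); [exact: measurable_tnth|exact: measurable_snd].
Qed.

Lemma bm_cat k l (F : (k + l).-tuple T -> R) : bm F ->
  bm (fun z : k.-tuple T * l.-tuple T => F [tuple of z.1 ++ z.2]).
Proof.
move=> [mF [M FM]]; split; last by exists M => z; exact: FM.
by apply: measurableT_comp => //; exact: measurable_cat_tuple.
Qed.

Lemma E_pw_add (a : P) k l (F : (k + l).-tuple T -> R) : bm F ->
  E (pw a (k + l)) F = E (pw a k) (fun s => E (pw a l) (fun t => F [tuple of s ++ t])).
Proof.
elim: k F => [|k IH] F bF.
  rewrite E_pw0; last by have [] := bm_Esection (pw a 0) (pw a l) (bm_cat bF).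
  by congr E; apply/funext => t; congr F; exact: val_inj.
rewrite [LHS](E_pwS a bF) E_pwS; last exact: (bm_Esection (pw a k.+1) (pw a l) (bm_cat bF)).
congr E; apply/funext => x; rewrite (IH _ (bm_cons1 x bF)); congr E; apply/funext => s.
by congr E; apply/funext => t; congr F; exact: val_inj.
Qed.

Variables (k l : nat) (f : fn k.+2) (g : fn l.+2).
Hypotheses (tf : test_function f) (tg : test_function g).

(* f(x) g(y) alone does not vanish when the two groups of points drift apart,
   hence the cutoff. *)
Definition couple (rho : R) (x : 'M[R]_(k.+2 + l.+2, d)) : R :=
  f (usubmx x) * g (dsubmx x) * cutoff rho (row ord0 (usubmx x) - row ord0 (dsubmx x)).

Lemma row_usubmx m n (x : 'M[R]_(m + n, d)) i : row i (usubmx x) = row (lshift n i) x.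
Proof. by apply/rowP => j; rewrite !mxE. Qed.

Lemma row_dsubmx m n (x : 'M[R]_(m + n, d)) i : row i (dsubmx x) = row (rshift m i) x.
Proof. by apply/rowP => j; rewrite !mxE. Qed.

Lemma couple_bounded : exists B, forall rho x, `|couple rho x| <= B.
Proof.
have [M hM] := test_bounded (ltn0Sn _) tf; have [N hN] := test_bounded (ltn0Sn _) tg.
exists (M * N) => rho x; rewrite /couple !normrM -[leRHS]mulr1.
rewrite ler_pM ?mulr_ge0 ?ler_pM//.
by rewrite ger0_norm ?cutoff_ge0 ?cutoff_le1.
Qed.

Lemma test_couple rho : test_function (couple rho).
Proof.
have [cf fi fd] := tf; have [cg gi gd] := tg; split.
- apply: contM; first apply: contM.
  + apply: (cont_comp _ cf); apply: continuous_mx_entrywise => i j.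
    by under eq_fun do rewrite mxE; exact: coord_continuous.
  + apply: (cont_comp _ cg); apply: continuous_mx_entrywise => i j.
    by under eq_fun do rewrite mxE; exact: coord_continuous.
  + apply: (@lipschitz_cont _ _ _ _ 2) => x y; apply: le_trans (cutoff_lip _ _ _) _.
    by rewrite mul1r !row_usubmx !row_dsubmx row_diff_lip.
- move=> x y; rewrite /couple.
  set z := \matrix_i _.
  have -> : usubmx z = \matrix_(i < k.+2) (row i (usubmx x) + y) by apply/matrixP => i j; rewrite !mxE.
  have -> : dsubmx z = \matrix_(i < l.+2) (row i (dsubmx x) + y) by apply/matrixP => i j; rewrite !mxE.
  by rewrite fi gi !rowK opprD addrACA subrr addr0.
- move=> e e0; have [M hM] := test_bounded (ltn0Sn _) tf; have [N hN] := test_bounded (ltn0Sn _) tg.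
  have M1 : 0 < `|M| + `|N| + 1 by rewrite ltr_wpDl ?addr_ge0.
  have e'0 : 0 < e / (`|M| + `|N| + 1) by rewrite divr_gt0.
  have [C1 h1] := fd _ e'0; have [C2 h2] := gd _ e'0.
  pose D := `|C1| + `|C2| + (`|rho| + 1); have D0 : 0 <= D by rewrite !addr_ge0.
  exists (D + 1) => x hx.
  have [c0|/cutoff_neq0 hc] := eqVneq (cutoff rho (row ord0 (usubmx x) - row ord0 (dsubmx x))) 0.
    by rewrite /couple c0 mulr0 normr0.
  have small (u v B : R) : `|u| < e / (`|M| + `|N| + 1) -> `|v| <= B -> B <= `|M| + `|N| -> `|u| * `|v| < e.
    move=> hu hv hB; have [->|v0] := eqVneq v 0; first by rewrite normr0 mulr0.
    apply: (@lt_le_trans _ _ (e / (`|M| + `|N| + 1) * `|v|)); first by rewrite ltr_pM2r ?normr_gt0.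
    by rewrite mulrAC ler_pdivrMr// ler_pM2l// (le_trans hv)// (le_trans hB)// lerDl.
  have cut1 : `|cutoff rho (row ord0 (usubmx x) - row ord0 (dsubmx x))| <= 1.
    by rewrite ger0_norm ?cutoff_ge0 ?cutoff_le1.
  have [s1|s1] := leP C1 (spread (usubmx x)).
    rewrite /couple !normrM (le_lt_trans (ler_piMr _ cut1)) ?mulr_ge0//.
    by apply: (small _ _ N) => //; [exact: h1|rewrite (le_trans (ler_norm _))// lerDr].
  have [s2|s2] := leP C2 (spread (dsubmx x)).
    rewrite /couple !normrM (le_lt_trans (ler_piMr _ cut1)) ?mulr_ge0// mulrC.
    by apply: (small _ _ M) => //; [exact: h2|rewrite (le_trans (ler_norm _))// lerDl].
  exfalso; move: hx; apply/negP; rewrite -ltNge; apply: (@le_lt_trans _ _ D); last by rewrite ltrDl.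
  have uu i j : `|row (lshift l.+2 i) x - row (lshift l.+2 j) x| <= `|C1|.
    by rewrite -!row_usubmx (le_trans (spread_ge _ _ _))// (le_trans (ltW s1))// ler_norm.
  have vv i j : `|row (rshift k.+2 i) x - row (rshift k.+2 j) x| <= `|C2|.
    by rewrite -!row_dsubmx (le_trans (spread_ge _ _ _))// (le_trans (ltW s2))// ler_norm.
  have uv i j : `|row (lshift l.+2 i) x - row (rshift k.+2 j) x| <= D.
    rewrite (le_trans (ler_distD (row (rshift k.+2 ord0) x) _ _))//.
    rewrite (le_trans (lerD (ler_distD (row (lshift l.+2 ord0) x) _ _) (vv _ _)))//.
    have := uu i ord0; have := hc; rewrite row_usubmx row_dsubmx /D; have := ler_norm rho; lra.
  have CD1 : `|C1| <= D by rewrite /D -addrA lerDl !addr_ge0.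
  have CD2 : `|C2| <= D by rewrite /D addrAC lerDr !addr_ge0.
  apply: spread_leP => // i j; case: (split_ordP i) => i' ->; case: (split_ordP j) => j' ->.
  + exact: le_trans (uu _ _) CD1.
  + exact: uv.
  + by rewrite distrC uv.
  + exact: le_trans (vv _ _) CD2.
Qed.

Lemma pint_couple_cvg (a : P) : (fun n : nat => pint (couple n%:R) a) @ \oo --> pint f a * pint g a.
Proof.
have [B hB] := couple_bounded.
pose F (t : (k.+2 + l.+2).-tuple T) := f (usubmx (mxt t)) * g (dsubmx (mxt t)).
have cF : (fun n : nat => pint (couple n%:R) a) @ \oo --> E (pw a (k.+2 + l.+2)) F.
  apply: (@E_dct _ _ _ _ _ _ B) => [n|n t|t]; first exact: (test_bm _ (test_couple n%:R)).
    exact: hB.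
  apply: cvg_near_cst; near=> n; rewrite /couple cutoff_eq1 ?mulr1//.
  by near: n; exact: nbhs_infty_ger.
suff <- : E (pw a (k.+2 + l.+2)) F = pint f a * pint g a by [].
(* [F] is not a test function; it is measurable and bounded as a pointwise limit of the
   couplings. *)
have bF : bm F.
  have bc n : bm (fun t : (k.+2 + l.+2).-tuple T => couple n%:R (mxt t)) by exact: (test_bm _ (test_couple n%:R)).
  apply: (bm_cvg bc (fun n t => hB n%:R (mxt t))) => t.
  apply: cvg_near_cst; near=> n; rewrite /couple cutoff_eq1 ?mulr1//.
  by near: n; exact: nbhs_infty_ger.
have bf := test_bm (ltn0Sn _) tf; have bg := test_bm (ltn0Sn _) tg.
rewrite (E_pw_add a bF) [in RHS]mulrC /pint -EZ//; congr E; apply/funext => s.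
rewrite [RHS]mulrC -EZ//; congr E; apply/funext => t; rewrite /F; congr (f _ * g _).
  by apply/matrixP => i j; rewrite mxE !mxtE tnth_lshift.
by apply/matrixP => i j; rewrite mxE !mxtE tnth_rshift.
Unshelve. all: by end_near.
Qed.

End products.

Section dominated_series.
Variables (al : nat -> P) (B : R).
Hypothesis Hmass : light al.
Hypothesis B0 : 0 <= B.

Lemma dominated_series_cvg (v : nat -> R) : (forall i, `|v i| <= B * mass (al i)) -> cvgn (series v).
Proof.
move=> hv; apply: normed_cvg.
have m0 i : 0 <= mass (al i) by exact: mass_ge0.
have cm := nneseries_series m0 (mass_fin_num Hmass).
apply: (@series_le_cvg _ _ (fun i => B * mass (al i))) => [n|n|n|].
- exact: normr_ge0.
- by rewrite mulr_ge0.
- exact: hv.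
rewrite (_ : series _ = (fun n => B * series (fun i => mass (al i)) n)); last first.
  by apply/funext => n; rewrite /series/= mulr_sumr.
by apply/cvg_ex; eexists; apply: cvgM; [exact: cvg_cst|exact: cm].
Qed.

Lemma dominated_tail (v : nat -> R) (L e : R) m : (forall i, `|v i| <= B * mass (al i)) -> 0 <= e ->
  (forall N, \sum_(m <= i < N) mass (al i) <= e) -> series v @ \oo --> L -> `|L - series v m| <= B * e.
Proof.
move=> hv e0 hm cL.
have c2 : (fun N => `|series v N - series v m|) @ \oo --> `|L - series v m|.
  by apply: cvg_norm; apply: cvgB => //; exact: cvg_cst.
apply: (cvg_le_bound c2); exists m => // N /= mN; rewrite sub_series mN.
apply: le_trans (ler_norm_sum _ _ _) _; apply: le_trans (ler_wpM2l B0 (hm N)).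
by rewrite mulr_sumr; exact: ler_sum.
Qed.

(** Tannery's theorem, with the masses as dominating sequence. *)
Lemma dominated_series_lim (v_ : nat -> nat -> R) (v : nat -> R) (L : nat -> R) :
  (forall n i, `|v_ n i| <= B * mass (al i)) -> (forall i, v_ n i @[n --> \oo] --> v i) ->
  (forall n, series (v_ n) @ \oo --> L n) ->
  exists S : R, series v @ \oo --> S /\ L @ \oo --> S.
Proof.
move=> hv cv cL.
have hv' i : `|v i| <= B * mass (al i) by apply: (cvg_le_bound (cvg_norm (cv i))); exact: nearW.
have /cvg_ex[S cS] := dominated_series_cvg hv'.
exists S; split => //; apply/cvgrPdist_le => /= e e0.
pose e' := e / (3 * (B + 1)); have B1 : 0 < B + 1 by rewrite ltr_wpDl.
have e'0 : 0 < e' by rewrite divr_gt0// mulr_gt0.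
have Be : B * e' <= e / 3.
  have -> : e / 3 = (B + 1) * e' by rewrite /e'; field; rewrite gt_eqF.
  by rewrite ler_wpM2r ?(ltW e'0)// lerDl.
have [m hm] := mass_tail Hmass e'0.
have cm : (fun n => series (v_ n) m) @ \oo --> series v m.
  by rewrite /series/=; apply: (cvg_big add_continuous).
have e3 : 0 < e / 3 by rewrite divr_gt0.
move/cvgrPdist_le : cm => /(_ _ e3); apply: filterS => n hn.
have h1 := dominated_tail hv' (ltW e'0) hm cS.
have h2 := dominated_tail (hv n) (ltW e'0) hm (cL n).
have -> : S - L n = (S - series v m) + (series v m - series (v_ n) m) + (series (v_ n) m - L n) by ring.
rewrite (le_trans (ler_normD _ _))// (_ : e = e / 3 + e / 3 + e / 3); last by field.
rewrite lerD//; last by rewrite distrC (le_trans h2).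
by rewrite (le_trans (ler_normD _ _))// lerD// (le_trans h1).
Qed.

End dominated_series.

Section multiset_separation.
Variables (al be : nat -> P).
Hypothesis Hal : light al.
Hypothesis Hbe : light be.

Definition same_sum (u : P -> R) : Prop := exists L : R,
  series (fun i => u (al i)) @ \oo --> L /\ series (fun i => u (be i)) @ \oo --> L.

Hypothesis Hsum : forall k (f : fn k.+2), test_function f -> same_sum (pint f).

Lemma same_sum_lim (u_ : nat -> P -> R) (u : P -> R) (B : R) :
  (forall n, same_sum (u_ n)) -> (forall n a, `|u_ n a| <= B * mass a) ->
  (forall i, u_ n (al i) @[n --> \oo] --> u (al i)) ->
  (forall i, u_ n (be i) @[n --> \oo] --> u (be i)) -> same_sum u.
Proof.
move=> /choice[L hL] uB ca cb.
have uB' n a : `|u_ n a| <= `|B| * mass a.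
  by rewrite (le_trans (uB n a))// ler_wpM2r ?ler_norm// mass_ge0.
have [S [h1 h2]] := dominated_series_lim Hal (normr_ge0 B) (fun n i => uB' n (al i)) ca (fun n => (hL n).1).
have [S' [h3 h4]] := dominated_series_lim Hbe (normr_ge0 B) (fun n i => uB' n (be i)) cb (fun n => (hL n).2).
by exists S; split => //; rewrite (cvg_unique _ h2 h4).
Qed.

Definition observable (u : P -> R) : Prop :=
  exists k (f : fn k.+2), test_function f /\ u = @pint k.+2 f.

(** The constant 1 may fail to be summable over the pieces, but it is a harmless multiplier of
    observables; multipliers are what [damping_closed] can be applied to. *)
Definition coefficient (U : P -> R) : Prop :=
  (exists M, forall a, `|U a| <= M) /\ forall w, observable w -> same_sum (fun a => U a * w a).

Lemma observable_le w : observable w -> exists B, 0 <= B /\ forall a, `|w a| <= B * mass a.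
Proof.
move=> [k [f [tf ->]]]; have [M hM] := test_bounded (ltn0Sn _) tf.
by exists M; split => [|a]; [exact: le_trans (hM 0)|exact: norm_pint_le].
Qed.

Lemma coefficient1 : coefficient (fun=> 1).
Proof.
split; first by exists 1 => a; rewrite normr1.
by move=> w [k [f [tf ->]]]; under eq_fun do rewrite mul1r; exact: Hsum.
Qed.

Lemma same_sum_lin c c' u v : same_sum u -> same_sum v -> same_sum (fun a => c * u a + c' * v a).
Proof.
move=> [L [h1 h2]] [L' [h3 h4]]; exists (c * L + c' * L').
have key (ga : nat -> P) : series (fun i => c * u (ga i) + c' * v (ga i)) =
    (fun n => c * series (fun i => u (ga i)) n + c' * series (fun i => v (ga i)) n).
  by apply/funext => n; rewrite /series/= big_split/= !mulr_sumr.
by rewrite !key; split; apply: cvgD; apply: cvgM => //; exact: cvg_cst.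
Qed.

Lemma coefficient_lin c c' U W : coefficient U -> coefficient W -> coefficient (fun a => c * U a + c' * W a).
Proof.
move=> [[M hM] eU] [[N hN] eW]; split.
  exists (`|c| * M + `|c'| * N) => a.
  by rewrite (le_trans (ler_normD _ _))// !normrM lerD// ler_wpM2l.
move=> w ow; have := same_sum_lin c c' (eU w ow) (eW w ow); congr same_sum.
by apply/funext => a; ring.
Qed.

(** The product of [u] with the observable being tested is a limit of observables, the couplings;
    domination by mass lets the limit pass through the sums. *)
Lemma coefficientM u U : observable u -> coefficient U -> coefficient (fun a => u a * U a).
Proof.
move=> ou [[M hM] eU]; have [B [B0 hB]] := observable_le ou; split.
  exists (B * M) => a; rewrite normrM ler_pM// (le_trans (hB a))// ler_piMr//; exact: mass_le1.
move: ou => [k [f [tf ->]]] w [l [g [tg ->]]].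
have [C hC] := couple_bounded tf tg.
have cc (a : P) : (fun n : nat => U a * pint (couple f g n%:R) a) @ \oo --> pint f a * U a * pint g a.
  rewrite -mulrA mulrCA; apply: cvgM; first exact: cvg_cst.
  exact: pint_couple_cvg.
apply: (@same_sum_lim (fun n a => U a * pint (couple f g n%:R) a) _ (M * C)) => // n.
  by apply: eU; exists (k + l.+2)%N, (couple f g n%:R); split => //; exact: test_couple.
move=> a; rewrite normrM -mulrA ler_pM//.
by apply: norm_pint_le => //; exact: (test_couple tf tg n%:R).
Qed.

Variable a0 : P.
Hypothesis a0_nz : a0 setT != 0%E.

Definition filtered (u : nat -> P -> R) m (a : P) : R := \prod_(j < m) (1 - (u j a - u j a0) ^+ 2).

Lemma coefficient_filtered u m p : (forall j, observable (u j)) ->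
  coefficient (fun a => filtered u m a ^+ p).
Proof.
move=> ou; apply: (damping_closed (fun j => u j a0) coefficient1 coefficient_lin) => j U.
exact: coefficientM.
Qed.

Lemma observable_sim u a b : observable u -> sim a b -> u a = u b.
Proof. by move=> [k [f [tf ->]]]; exact: pint_sim. Qed.

(** The bound by one half keeps differences of two values at most 1, so that the damping factors lie
    in the unit interval. *)
Lemma observable_separates (b : P) : exists u, [/\ observable u, forall a, `|u a| <= 2^-1 &
  ~ sim a0 b -> u b != u a0].
Proof.
have [k [f [tf hf]]] : exists k (f : fn k.+2), test_function f /\
    (~ sim a0 b -> pint f b != pint f a0).
  have [s|ns] := pselect (sim a0 b).
    exists 0%N, (star (fun _ : 'I_1 => cutoff 1)); split => //.
    by apply: test_star => _; exact: bump_cutoff.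
  apply: contrapT => no; apply: ns; apply: (pint_separates a0_nz) => k f tf.
  apply: contrapT => /eqP ne; apply: no; exists k, f; split => // _.
  by rewrite eq_sym.
have [M hM] := test_bounded (ltn0Sn _) tf.
have M1 : 0 < 2 * (`|M| + 1) by rewrite mulr_gt0// ltr_wpDl.
pose c := (2 * (`|M| + 1))^-1; have c0 : 0 < c by rewrite invr_gt0.
have cf a : pint (fun x => c * f x) a = c * pint f a by rewrite /pint EZ//; exact: test_bm.
exists (pint (fun x => c * f x)); split.
- by exists k, (fun x => c * f x); split => //; exact: test_functionZ.
- move=> a; rewrite cf normrM (ger0_norm (ltW c0)) /c invfM -mulrA ler_piMr//.
  rewrite mulrC ler_pdivrMr ?mul1r ?ltr_wpDl//.
  rewrite (le_trans (norm_pint_le a (ltn0Sn _) tf hM))// (@le_trans _ _ `|M|)// ?lerDl//.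
  rewrite (le_trans (ler_wpM2r (mass_ge0 a) (ler_norm M)))// ler_piMr//; exact: mass_le1.
- by move=> /hf; rewrite !cf; apply: contra_neq => /(mulfI (lt0r_neq0 c0)).
Qed.

(** A fixed observable, positive on nonzero measures, that makes the filtered sums converge. *)
Definition weight : P -> R := @pint 2 (star (fun _ : 'I_1 => cutoff 1)).

Lemma bump1 : forall _ : 'I_1, bump (cutoff 1 : V -> R).
Proof. by move=> _; exact: bump_cutoff. Qed.

Lemma observable_weight : observable weight.
Proof. by exists 0%N, (star (fun _ : 'I_1 => cutoff 1)); split => //; exact: test_star bump1. Qed.

(** Two points in the ball of radius one half around a support point are within distance 1, where
    the cutoff is 1; hence the square of the mass of that ball is a lower bound. *)
Lemma weight_gt0 : 0 < weight a0.
Proof.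
have [x0 hx0] := support_point a0_nz; have h2 : 0 < 2^-1 :> R by rewrite invr_gt0.
pose S := cball x0 2^-1; have m0 := hx0 _ h2.
rewrite /weight (pint_star _ bump1).
apply: (@lt_le_trans _ _ (fine (a0 S) * fine (a0 S))); first by rewrite mulr_gt0.
have mS : measurable (S : set T) by exact: mcball.
rewrite -[X in _ * X]E_indic// -EZ; last exact: bm_indic.
apply: le_E; first by apply: bmZ; exact: bm_indic.
  by under eq_fun do rewrite big_ord1; exact: (bm_smear _ (bump_cutoff 1)).
move=> x; rewrite big_ord1 indicE; have [Sx|Sx] := pselect (S x); last first.
  by rewrite memNset// mulr0; case/andP : (smear_01 a0 (x : V) (bump_cutoff 1)).
rewrite mem_set// mulr1 -E_indic//; apply: le_E; [exact: bm_indic|exact: (bm_bump _ (bump_cutoff 1))|].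
move=> z; rewrite indicE; have [Sz|Sz] := pselect (S z); last by rewrite memNset// cutoff_ge0.
rewrite mem_set// cutoff_eq1//; have := ler_distD x0 (z : V) (x : V); move: Sx Sz; rewrite /S /cball/=.
rewrite (distrC x0); lra.
Qed.

(* If u enumerates observables separating a0 from every other orbit among the
   al i and be i, then filtered u m ^+ m tends to the indicator of its orbit. *)
Lemma same_sum_orbit : same_sum (fun a => (`[< sim a0 a >])%:R * weight a).
Proof.
(* One enumeration of both families, so that the same [filtered u m] serves both sums. *)
pose c j : P := if odd j then be j./2 else al j./2.
have /choice[u hu] := fun j => observable_separates (c j).
have ou j : observable (u j) by case: (hu j).
have q01 j a : 0 <= 1 - (u j a - u j a0) ^+ 2 <= 1.
  have [_ h _] := hu j; have := h a; have := h a0; rewrite !ler_norml => /andP[? ?] /andP[? ?].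
  by apply: onem_sqr_01; rewrite ler_norml; apply/andP; split; lra.
have f01 m a : 0 <= filtered u m a <= 1.
  apply/andP; split; first by apply: prodr_ge0 => j _; case/andP : (q01 j a).
  by apply: prodr_ile1 => j _; exact: q01.
have [B [B0 hB]] := observable_le observable_weight.
have lim j : (fun m => filtered u m (c j) ^+ m * weight (c j)) @ \oo -->
    (`[< sim a0 (c j) >])%:R * weight (c j).
  apply: cvgM; last exact: cvg_cst.
  have [s|ns] := pselect (sim a0 (c j)).
    rewrite (asboolT s); apply: cvg_near_cst; apply: nearW => m.
    rewrite /filtered big1 ?expr1n// => i _.
    by rewrite (observable_sim (ou i) s) subrr expr0n subr0.
  rewrite (asboolF ns); pose q := 1 - (u j (c j) - u j a0) ^+ 2.
  have q1 : q < 1.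
    by have [_ _ /(_ ns) ne] := hu j; rewrite /q ltrBlDr ltrDl lt_neqAle eq_sym sqrf_eq0 subr_eq0 ne sqr_ge0.
  have q0 : 0 <= q by case/andP : (q01 j (c j)).
  have qlim : (fun m => q ^+ m) @ \oo --> (0 : R) by apply: cvg_expr; rewrite ger0_norm.
  (* Once [m > j], the j-th factor alone bounds the product by [q]. *)
  apply: (@squeeze_cvgr _ _ _ _ (fun=> 0) (fun m => q ^+ m)) => //; last exact: cvg_cst.
  near=> m; have /andP[h0 h1] := f01 m (c j); rewrite exprn_ge0//= lerXn2r//.
  have jm : (j < m)%N by near: m; exact: nbhs_infty_gt.
  rewrite /filtered (bigD1 (Ordinal jm))//= ler_piMr//.
  by apply: prodr_ile1 => i _; exact: q01.
apply: (@same_sum_lim (fun m a => filtered u m a ^+ m * weight a) _ B) => [m|m a|i|i].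
- by have [_ h] := coefficient_filtered m m ou; apply: h; exact: observable_weight.
- have /andP[h0 h1] := f01 m a; rewrite normrM ger0_norm ?exprn_ge0//.
  by rewrite (le_trans _ (hB a))// ler_piMl// exprn_ile1.
- by have := lim i.*2; rewrite /c odd_double doubleK.
- by have := lim i.*2.+1; rewrite /c /= odd_double/= uphalf_double.
Unshelve. all: by end_near.
Qed.

End multiset_separation.

(** Regrouped by orbits, the series keeps the single term at [o]; dividing by the positive weight
    then recovers the multiplicity. *)
Lemma represents_orbit_weight (m : nz_orbit R d -> nat) (al : nat -> P) (o : nz_orbit R d) (L : R) :
  represents m al ->
  series (fun i => (`[< sim (Defs.repr o) (al i) >])%:R * weight (al i)) @ \oo --> L ->
  (m o)%:R * weight (Defs.repr o) = L.
Proof.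
move=> rm cL; pose g (a : P) : R := (`[< sim (Defs.repr o) a >])%:R * weight a.
have w0 (a : P) : 0 <= weight a.
  by apply: pint_ge0 => x; apply: prodr_ge0 => i _; exact: cutoff_ge0.
have g0 a : 0 <= g a by rewrite mulr_ge0.
have wsim (a b : P) : sim a b -> weight a = weight b by move=> ab; exact: (observable_sim observable_weight ab).
have gsim : forall a b, sim a b -> g a = g b.
  move=> a b ab; rewrite /g (wsim _ _ ab); congr (_%:R * _); congr nat_of_bool.
  by apply: asbool_equiv_eq; split => h; [exact: sim_trans ab|exact: sim_trans (sim_sym ab)].
have gz (a : P) : a setT = 0%E -> g a = 0.
  move=> az; rewrite /g (_ : weight a = 0) ?mulr0//.
  by apply: pint_mass0 => //; exact: test_star (bump1).
apply/EFin_inj; transitivity (\sum_(i <oo) (g (al i))%:E)%E.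
  rewrite -(represents_esum rm g0 gsim gz).
  rewrite (esumID [set o])//; last by move=> o' _; rewrite mule_ge0// lee_fin.
  rewrite setTI esum_set1; last by rewrite mule_ge0// lee_fin.
  rewrite esum1 ?adde0; last first.
    move=> o' [_ /= oo']; rewrite /g asboolF ?mul0r ?mule0// => s; apply: oo'.
    by apply/nzo_eqP; rewrite !repr_orbit; apply/orbit_eqP; exact: sim_sym.
  by rewrite /g asboolT ?mul1r//; exact: sim_refl.
apply: cvg_lim => //; rewrite (_ : (fun n => _) = EFin \o series (fun i => g (al i))).
  by apply: cvg_EFin cL; exact: nearW.
by apply/funext => n; rewrite /= sumEFin.
Qed.

Theorem multiset_integral_separates (xi xi' : Xtilde R d) :
  (forall k (f : fn k.+2), test_function f ->
    multiset_integral f xi = multiset_integral f xi') -> xi = xi'.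
Proof.
move=> H; have [al [ra ma]] := Xtilde_represented xi; have [be [rb mb]] := Xtilde_represented xi'.
apply: Xtilde_eq => o; have hs : forall k (f : fn k.+2), test_function f -> same_sum al be (pint f).
  move=> k f tf; exists (multiset_integral f xi); split; first exact: multiset_integral_series.
  by rewrite (H _ _ tf); exact: multiset_integral_series.
have [L [h1 h2]] := same_sum_orbit ma mb hs (repr_nz o).
have e1 := represents_orbit_weight ra h1; have e2 := represents_orbit_weight rb h2.
have w0 := weight_gt0 (repr_nz o).
apply/eqP; rewrite -(eqr_nat R); apply/eqP; apply: (mulIf (lt0r_neq0 w0)).
by rewrite e1 e2.
Qed.

Lemma norm_multiset_integral_le k (f : fn k) (M : R) (xi : Xtilde R d) : (0 < k)%N ->
  test_function f -> (forall x, `|f x| <= M) -> `|multiset_integral f xi| <= M.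
Proof.
move=> k0 tf hM; have [al [ra ma]] := Xtilde_represented xi.
have M0 : 0 <= M by exact: le_trans (hM 0).
apply: (cvg_le_bound (cvg_norm (multiset_integral_series k0 tf ra ma))); apply: nearW => n.
rewrite /series/=; apply: le_trans (ler_norm_sum _ _ _) _.
apply: (@le_trans _ _ (\sum_(0 <= i < n) M * mass (al i))).
  by apply: ler_sum => i _; exact: norm_pint_le.
by rewrite -mulr_sumr big_mkord ler_piMr// partial_mass_le1.
Qed.

Lemma multiset_integral_lin k (f g : fn k) (c : R) (xi : Xtilde R d) : (0 < k)%N ->
  test_function f -> test_function g ->
  multiset_integral (fun x => f x + c * g x) xi = multiset_integral f xi + c * multiset_integral g xi.
Proof.
move=> k0 tf tg; have [al [ra ma]] := Xtilde_represented xi.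
have tcg := test_functionZ c tg.
have h := multiset_integral_series k0 (test_functionD tf tcg) ra ma.
have hf := multiset_integral_series k0 tf ra ma.
have hg := multiset_integral_series k0 tg ra ma.
apply: (cvg_unique _ h) => //.
have -> : series (fun i => pint (fun x => f x + c * g x) (al i)) =
    (fun n => series (fun i => pint f (al i)) n + c * series (fun i => pint g (al i)) n).
  apply/funext => n; rewrite /series/= mulr_sumr -big_split/=; apply: eq_bigr => i _.
  by rewrite /pint ED ?EZ//; [exact: test_bm|exact: test_bm|exact: (test_bm _ tcg)].
by apply: cvgD => //; apply: cvgM => //; exact: cvg_cst.
Qed.

Lemma multiset_integral_close k (f g : fn k) (e : R) (xi : Xtilde R d) : (0 < k)%N ->
  test_function f -> test_function g -> (forall x, `|f x - g x| <= e) ->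
  `|multiset_integral f xi - multiset_integral g xi| <= e.
Proof.
move=> k0 tf tg h.
have -> : multiset_integral f xi - multiset_integral g xi = multiset_integral (fun x => f x + (-1) * g x) xi.
  by rewrite multiset_integral_lin// mulN1r.
apply: norm_multiset_integral_le => //; first by apply: test_functionD => //; exact: test_functionZ.
by move=> x; rewrite mulN1r.
Qed.

Definition prob_orbit (mu : probability T R) : M1_orbit R d :=
  exist _ (orbit_of mu) (ex_intro _ mu erefl).

Lemma multiset_integral_embed k (f : fn k) (mu : probability T R) : (0 < k)%N ->
  test_function f -> multiset_integral f (embed (prob_orbit mu)) = pint f mu.
Proof.
move=> k0 tf; pose al (i : nat) : P := if i == 0%N then (mu : P) else @mzero _ T R.
have al0 i : i != 0%N -> al i setT = 0%E by rewrite /al => /negbTE ->.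
have ra : represents (embed (prob_orbit mu)) al.
  move=> o /=; rewrite /single; set o1 := nz_of_M1 _; have [->|oo] := eqVneq o o1.
    rewrite (_ : fibre al o1 = [set 0%N]); first by rewrite esum_set1.
    apply/seteqP; split => [i [ai _]|i ->].
      by apply/eqP; apply: contraNT ai => /al0 ->.
    split; rewrite /al/=; last by [].
    by rewrite [X in X != _](_ : _ = 1%E) ?oner_eq0//; exact: probability_setT.
  rewrite (_ : fibre al o = set0); first by rewrite esum_set0.
  apply/seteqP; split => // i [ai oi]; move/eqP : oo; apply; apply/nzo_eqP; rewrite oi.
  by have [->|/al0 a0] := eqVneq i 0%N; last by rewrite a0 eqxx in ai.
have ma : light al.
  rewrite (@nneseries_split _ _ 0%N 1%N)//; last by move=> i _; rewrite lee_fin mass_ge0.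
  rewrite add0n big_nat1 eseries0 ?adde0.
    by rewrite lee_fin; exact: mass_le1.
  by move=> i i1 _; rewrite mass_eq0// al0// -lt0n.
apply: (cvg_unique _ (multiset_integral_series k0 tf ra ma)) => //.
apply: cvg_near_cst; exists 1%N => // n /= n1.
rewrite /series/= -(prednK n1) big_nat_recl//= big1 ?addr0//.
by move=> i _; apply: pint_mass0 => //; exact: al0.
Qed.

Lemma embed_inj : injective (@embed R d).
Proof.
move=> m m' /(congr1 (fun x : Xtilde R d => x (nz_of_M1 m))).
rewrite /= /single eqxx; case: eqP => // /(congr1 sval) /= h _.
by move: m m' h => [W hW] [W' hW'] /= h; subst W'; congr exist; exact: Prop_irrelevance.
Qed.

(** * The metric, density and compactness *)

Section compactification.
Hypothesis d_gt0 : (0 < d)%N.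
Variables (f : nat -> tagged_function R d) (f_dense : dense_enumeration f).

Let Lam r (xi : Xtilde R d) := multiset_integral (tagged (f r)) xi.
Let w r : R := (2 ^+ r.+1)^-1 * (1 + sup_norm (tagged (f r)))^-1.

Lemma enumerated_test r : exists k (g : fn k.+2), test_function g /\ f r = existT _ k.+2 g.
Proof.
have [A [hA fA]] := f_dense; have : range f (f r) by exists r.
rewrite fA => -[[|[|k]] //= _ [g Ag <-]]; exists k, g; split => //.
by have [_ [h _]] := hA k.+2 isT; exact: h.
Qed.

Lemma enumerated_dense k (h : fn k.+2) (e : R) : test_function h -> 0 < e ->
  exists r (g : fn k.+2), [/\ test_function g, f r = existT _ k.+2 g &
    forall x, `|g x - h x| < e].
Proof.
move=> th e0; have [A [hA fA]] := f_dense; have [_ [At Ad]] := hA k.+2 isT.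
have [g Ag gh] := Ad h th e e0.
have : range f (existT _ k.+2 g) by rewrite fA; exists k.+2 => //; exists g.
by move=> [r _ fr]; exists r, g; split => //; exact: At.
Qed.

Lemma le_sup_norm k (g : fn k) x : (0 < k)%N -> test_function g -> `|g x| <= sup_norm g.
Proof.
move=> k0 tg; have [M hM] := test_bounded k0 tg; apply: ub_le_sup; last by exists x.
by exists M => _ [y _ <-].
Qed.

Lemma norm_Lam r xi : `|Lam r xi| <= sup_norm (tagged (f r)).
Proof.
rewrite /Lam; have [k [g [tg ->]]] := enumerated_test r.
by apply: norm_multiset_integral_le => // x; exact: le_sup_norm.
Qed.

Lemma sup_norm_ge0 r : 0 <= sup_norm (tagged (f r)).
Proof.
have [k [g [tg ->]]] := enumerated_test r.
by rewrite (le_trans _ (le_sup_norm 0 _ tg)).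
Qed.

Lemma w_gt0 r : 0 < w r.
Proof. by rewrite mulr_gt0 ?invr_gt0 ?exprn_gt0// ltr_pwDl// sup_norm_ge0. Qed.

(** A difference of two values is at most twice the sup norm, and this 2 uses up one of the [r + 1]
    halvings. *)
Lemma w_Lam r xi xi' : w r * `|Lam r xi - Lam r xi'| <= 2^-1 ^+ r.
Proof.
have S0 := sup_norm_ge0 r; have S1 : 0 < 1 + sup_norm (tagged (f r)) by rewrite ltr_pwDl.
apply: (@le_trans _ _ (w r * (2 * (1 + sup_norm (tagged (f r)))))).
  rewrite ler_wpM2l ?(ltW (w_gt0 r))// (le_trans (ler_normB _ _))//.
  by have := norm_Lam r xi; have := norm_Lam r xi'; lra.
have r0 : 2 ^+ r != 0 :> R by rewrite expf_neq0.
rewrite le_eqVlt; apply/orP; left; apply/eqP; rewrite /w exprS exprVn.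
by move: S1 r0; set S := sup_norm _ => S1 r0; field; rewrite r0 gt_eqF.
Qed.

(** Total mass at most 1 makes multiset integrals 1-Lipschitz for the uniform norm, so uniform
    density extends equality to all test functions. *)
Lemma Lam_separates xi xi' : (forall r, Lam r xi = Lam r xi') -> xi = xi'.
Proof.
move=> H; apply: multiset_integral_separates => k h th.
apply/eqP; rewrite -subr_eq0 -normr_le0; apply/ler_addgt0Pr => e e0; rewrite add0r.
have e2 : 0 < e / 2 by rewrite divr_gt0.
have [r [g [tg fr gh]]] := enumerated_dense th e2.
have c x : `|multiset_integral g x - multiset_integral h x| <= e / 2.
  by apply: multiset_integral_close => // y; exact/ltW/gh.
have := H r; rewrite /Lam fr /= => gg.
have -> : multiset_integral h xi - multiset_integral h xi' =
  (multiset_integral g xi' - multiset_integral h xi') - (multiset_integral g xi - multiset_integral h xi).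
  by rewrite gg; ring.
by rewrite (le_trans (ler_normB _ _))// (_ : e = e / 2 + e / 2); [exact: lerD|lra].
Qed.

Lemma Dmetric_is_metric : is_metric (Dmetric f).
Proof. exact: (wdist_is_metric w_gt0 w_Lam Lam_separates). Qed.

Lemma D_M1_is_metric : is_metric (D_M1 f).
Proof.
have [h1 h2 h3 h4] := Dmetric_is_metric; split; rewrite /D_M1.
- by move=> m; exact: h1.
- by move=> m m' /h2/embed_inj.
- by move=> m m'; exact: h3.
- by move=> m m' m''; exact: h4.
Qed.

Lemma Dmetric_small (e : R) : 0 < e -> exists N (dl : R), 0 < dl /\
  forall xi xi', (forall r, (r < N)%N -> `|Lam r xi - Lam r xi'| <= dl) -> Dmetric f xi xi' < e.
Proof. exact: (wdist_small w_gt0 w_Lam). Qed.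

Lemma ultra_infty : exists U : set_system nat, UltraFilter U /\ \oo `<=` U.
Proof. exact: ultraFilterLemma eventually_filter. Qed.

Lemma M1_approximates (xi : Xtilde R d) N (e : R) : 0 < e -> exists mu : probability T R,
  forall r, (r < N)%N -> `|Lam r (embed (prob_orbit mu)) - Lam r xi| < e.
Proof.
move=> e0; have [al [ra ma]] := Xtilde_represented xi; have [U [UU oU]] := ultra_infty.
have : \forall n \near U, forall r : 'I_N,
    `|Lam r (embed (prob_orbit (scattered ma (post ^~ n) n))) - Lam r xi| < e.
  apply: filter_forall => r; rewrite /Lam; have [k [g [tg ->]]] /= := enumerated_test r.
  have := scattered_cvg ma d_gt0 UU oU tg (multiset_integral_series (ltn0Sn _) tg ra ma).
  move/cvgrPdist_lt => /(_ e e0); apply: filterS => n.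
  by rewrite distrC multiset_integral_embed.
move=> /filter_ex[n hn]; exists (scattered ma (post ^~ n) n) => r rN.
exact: hn (Ordinal rN).
Qed.

Let X : metricType R := metric_space Dmetric_is_metric.

(** Along an ultrafilter all coordinates converge; the point is to find a multiset that has the
    limits as its coordinates. *)
Lemma Xtilde_compact : compact [set: X].
Proof.
rewrite compact_ultra => V UV _.
have cL r : exists l : R, (fun xi : X => Lam r xi) @ V --> l.
  have [|l [_ h]] := @ultra_bounded_cvg R X V UV (fun xi => Lam r xi) (sup_norm (tagged (f r))).
    by apply: filterE => xi; exact: norm_Lam.
  by exists l.
have /choice[l hl] := cL.
(* Half of the error goes to a multiset with coordinates near the limits, half to a single orbit
   near that multiset. *)
have approx n : exists mu : probability T R, forall r, (r < n.+1)%N ->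
    `|Lam r (embed (prob_orbit mu)) - l r| < n.+1%:R^-1.
  have n0 : 0 < n.+1%:R^-1 / 2 :> R by rewrite divr_gt0// invr_gt0.
  have : \forall xi \near V, forall r : 'I_n.+1, `|l r - Lam r xi| < n.+1%:R^-1 / 2.
    by apply: filter_forall => r; move/cvgrPdist_lt : (hl r) => /(_ _ n0).
  move=> /filter_ex[xi hxi]; have [mu hmu] := M1_approximates xi n.+1 n0.
  exists mu => r rn; rewrite (le_lt_trans (ler_distD (Lam r xi) _ _))//.
  rewrite (distrC (Lam r xi) (l r)) [ltRHS]splitr.
  exact: ltrD (hmu r rn) (hxi (Ordinal rn)).
have /choice[mu hmu] := approx.
have [U [UU oU]] := ultra_infty.
have [al [ma hal]] := galaxy_decomposition UU (fun n => mu n).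
have [xi rxi] := sequence_represents ma.
(* Along [U] the coordinates of [mu n] tend to those of [xi] by the decomposition, and to the [l r]
   by construction. *)
have lE r : l r = Lam r xi.
  have [k [g [tg fr]]] := enumerated_test r.
  have c1 : (fun n => Lam r (embed (prob_orbit (mu n)))) @ U --> Lam r xi.
    rewrite /Lam fr /=; under eq_fun do rewrite multiset_integral_embed//.
    by apply: hal => //; exact: multiset_integral_series.
  have c2 : (fun n => Lam r (embed (prob_orbit (mu n)))) @ U --> l r.
    apply/cvgrPdist_lt => e e0; apply: oU; near=> n.
    have rn : (r < n.+1)%N by near: n; exact: nbhs_infty_ge.
    rewrite distrC (lt_trans (hmu n r rn))//.
    by near: n; exact: near_infty_invS_lt.
  exact: (cvg_unique _ c2 c1).
exists (xi : X); split => //=; apply/metricType_numDomainType.fcvgrPdist_lt => e e0.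
have [N [dl [dl0 hN]]] := Dmetric_small e0.
have : \forall y \near V, forall r : 'I_N, `|l r - Lam r y| < dl.
  by apply: filter_forall => r; move/cvgrPdist_lt : (hl r) => /(_ _ dl0).
apply: filterS => y hy; apply: hN => r rN; rewrite -lE; exact/ltW/(hy (Ordinal rN)).
Unshelve. all: by end_near.
Qed.

Lemma M1_dense : dense (range (@embed R d : M1_orbit R d -> X)).
Proof.
move=> O [xi Oxi] oO; have : nbhs (xi : X) O by apply: open_nbhs_nbhs.
rewrite -metricType_numDomainType.filter_from_mdist_nbhs => -[e /= e0 eO].
have [N [dl [dl0 hN]]] := Dmetric_small e0.
have [mu hmu] := M1_approximates xi N dl0.
exists (embed (prob_orbit mu)); split; last by exists (prob_orbit mu).
by apply: eO => /=; apply: hN => r rN; rewrite distrC ltW// hmu.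
Qed.

End compactification.

End euclidean_measures.

Theorem theorem3p2 (R : realType) (d : nat) (d_gt0 : (0 < d)%N)
    (f : nat -> tagged_function R d) (f_dense : dense_enumeration f) :
  exists (hX : is_metric (Dmetric f)) (hM : is_metric (D_M1 f)),
    let X : metricType R := metric_space hX in
    let M : metricType R := metric_space hM in
    let e : M -> X := @embed R d in
    [/\ dense (range e),
        forall mu : nat -> M, exists phi : nat -> nat,
          {homo phi : m n / (m < n)%N} /\
          exists l : X, e (mu (phi n)) @[n --> \oo] --> l,
        compact [set: X],
        totally_bounded M &
        is_completion e].
Proof.
exists (Dmetric_is_metric f_dense), (D_M1_is_metric f_dense) => X M e.
have cX : compact [set: X] := @Xtilde_compact R d d_gt0 f f_dense.
have dM : dense (range e) := @M1_dense R d d_gt0 f f_dense.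
(* The distance on [M] is by definition that of the embedded orbits. *)
have iso (x y : M) : mdist (e x) (e y) = mdist x y by [].
split => //.
- by move=> mu; exact: (compact_subsequence cX (e \o mu)).
- exact: (isometric_totally_bounded cX iso).
- by split => //; exact: compact_complete.
Qed.
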